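(* Assume that the rows of $X$ are i.i.d. $\mathcal N(0,\Sigma_0)$. Suppose that $$\Lambda_{\max}^2/\|\Sigma_0\|_\infty=o(\log(2p))$$ and $$\max\left\{\left(\frac{\|\Sigma_0\|_\infty}{\kappa^2(S)}\right)\frac{\log(2p)\,|S|}{n}:\ \emptyset\neq S\subset\{1,\dots,p\},\ |S|\le\left(\frac{\Lambda_{\max}^2}{\kappa^2(S_0)}\right)4s_0\right\}=o(1).$$ For some $t>0$, let the tuning parameter $\lambda$ satisfy $$3\|\Sigma_0\|_\infty^{1/2}\left(\sqrt{2n(\log(2p)+t)}+2(\log(2p)+t)\right)\le\lambda=\mathcal O\left(\sqrt{\|\Sigma_0\|_\infty\, n\log(2p)}\right).$$ Let $$b^*\in\arg\min\left\{\|\Sigma_0^{1/2}b\|_2:\ \sum_{j\in S_0}|b_j|-\sum_{j\notin S_0}|b_j|=1\right\}$$ and for $j\in S_0$ let $z_j^*$ be the sign of $b_j^*$. Assume the betamin condition $$z_j^*\beta_j^0>\frac{z_j^*b_j^*}{\|\Sigma_0^{1/2}b^*\|_2^2}\,\frac{\lambda}{n}\qquad\text{for all } j\in S_0 .$$ Then $$\|X(\hat\beta-\beta^0)\|_2^2=\frac{\lambda^2/n}{\|\Sigma_0^{1/2}b^*\|_2^2}\,(1+o_{\mathbb P}(1))+\mathcal O_{\mathbb P}(1),$$ where $s_0\|\Sigma_0^{1/2}b^*\|_2^2=\kappa^2(S_0)$.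
   Context: Setting: $Y=X\beta^0+\epsilon\in\mathbb R^n$ with $X\in\mathbb R^{n\times p}$ random, $\beta^0\in\mathbb R^p$ non-random, and $\epsilon\in\mathbb R^n$ a vector of i.i.d. standard Gaussians independent of $X$. Asymptotics are for $n\to\infty$; $p$, $\Sigma_0$, $\beta^0$, $\lambda$ may depend on $n$. The Lasso is $\hat\beta\in\arg\min_{b\in\mathbb R^p}\{\|Y-Xb\|_2^2+2\lambda\|b\|_1\}$, $\lambda>0$. $\Sigma_0=\mathbb E X^TX/n$ is the covariance matrix of the rows, $\|\Sigma_0\|_\infty$ its maximal entry, $\Lambda_{\max}^2$ its largest eigenvalue. $S_0:=\{j:\beta^0_j\ne0\}$ (nonempty), $s_0:=|S_0|$. For $b\in\mathbb R^p$ and $S\subset\{1,\dots,p\}$, $b_S$ is the vector with entries $b_j 1\{j\in S\}$ and $b_{-S}:=b_{S^c}$. The theoretical compatibility constant of a nonempty $S$ is $$\kappa^2(S):=\min\{|S|\,\|\Sigma_0^{1/2}b\|_2^2:\ \|b_S\|_1-\|b_{-S}\|_1=1\}.$$ It is assumed that $\kappa^2(S_0)>0$. *)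

(* Defs.v *)
From HB Require Import structures.
From mathcomp Require Import all_boot all_order all_algebra.
From mathcomp Require Import all_classical all_reals all_analysis.

Set Implicit Arguments.
Unset Strict Implicit.
Unset Printing Implicit Defensive.

Import Order.TTheory GRing.Theory Num.Theory.
Import numFieldNormedType.Exports.

Local Open Scope classical_set_scope.
Local Open Scope ring_scope.

Section linear_algebra.
Context {R : realType}.

(* The library norm on matrices is the maximum of the absolute values of the
   entries, so the l1 and l2 norms of a vector are defined here. *)
Definition l1norm {p : nat} (b : 'cV[R]_p) : R := \sum_j `|b j 0|.

Definition l2norm {p : nat} (b : 'cV[R]_p) : R :=
  Num.sqrt (\sum_j b j 0 ^+ 2).

Definition subvec {p : nat} (b : 'cV[R]_p) (S : {set 'I_p}) : 'cV[R]_p :=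
  \col_j (if j \in S then b j 0 else 0).

Definition active_set {p : nat} (b : 'cV[R]_p) : {set 'I_p} :=
  [set j | b j 0 != 0].

Definition psdmx {p : nat} (A : 'M[R]_p) : Prop :=
  A^T = A /\ forall u : 'cV[R]_p, 0 <= (u^T *m A *m u) 0 0.

(* For a positive semidefinite A exactly one B qualifies. *)
Definition sqrtmx {p : nat} (A : 'M[R]_p) : 'M[R]_p :=
  xget 0 [set B | psdmx B /\ B *m B = A].

(* The set of eigenvalues is finite, and nonempty when A is symmetric and
   p > 0, so that the supremum is then a maximum. *)
Definition max_eigenvalue {p : nat} (A : 'M[R]_p) : R :=
  sup [set a : R | eigenvalue A a].

Definition compat_constraint {p : nat} (S : {set 'I_p}) : set 'cV[R]_p :=
  [set b | l1norm (subvec b S) - l1norm (subvec b (~: S)) = 1].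

(* For nonempty S the infimum is attained: a nonnegative quadratic form is
   minimized over a nonempty finite union of polyhedra. *)
Definition kappa2 {p : nat} (Sigma : 'M[R]_p) (S : {set 'I_p}) : R :=
  inf [set #|S|%:R * l2norm (sqrtmx Sigma *m b) ^+ 2
      | b in compat_constraint S].

Definition compat_argmin {p : nat} (Sigma : 'M[R]_p) (S : {set 'I_p}) :
    set 'cV[R]_p :=
  [set b | compat_constraint S b /\
    forall b', compat_constraint S b' ->
      l2norm (sqrtmx Sigma *m b) <= l2norm (sqrtmx Sigma *m b')].

(* Extended reals, because kappa2 Sigma S may vanish for some S: the quotient
   is then +oo, whereas x / 0 = 0 in R. For Sigma positive semidefinite,
   `|Sigma| is the largest entry of Sigma. *)
Definition max_compat_ratio (n : nat) {p : nat} (Sigma : 'M[R]_p)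
    (S0 : {set 'I_p}) : \bar R :=
  \big[maxe/-oo%E]_(S : {set 'I_p} | (S != finset.set0) &&
      (#|S|%:R <= max_eigenvalue Sigma / kappa2 Sigma S0 * (4 * #|S0|%:R)))
    (`|Sigma|%:E / (kappa2 Sigma S)%:E *
      (ln (2 * p%:R) * #|S|%:R / n%:R)%:E)%E.

Definition lasso_objective {n p : nat} (X : 'M[R]_(n, p)) (Y : 'cV[R]_n)
    (lambda : R) (b : 'cV[R]_p) : R :=
  l2norm (Y - X *m b) ^+ 2 + 2 * lambda * l1norm b.

Definition lasso {n p : nat} (X : 'M[R]_(n, p)) (Y : 'cV[R]_n) (lambda : R) :
    set 'cV[R]_p :=
  [set b | forall b', lasso_objective X Y lambda b <=
                      lasso_objective X Y lambda b'].

End linear_algebra.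

Section probability.
Context {R : realType}.

Definition random_mx {d : measure_display} {T : measurableType d} {m n : nat}
    (Z : T -> 'M[R]_(m, n)) : Prop :=
  forall i j, measurable_fun [set: T] (fun w => Z w i j).

Definition sigma_generated {d : measure_display} {T : measurableType d}
    {I : Type} (f : I -> T -> R) : set (set T) :=
  <<s \bigcup_i preimage_set_system [set: T] (f i) measurable >>.

Definition sigma_mx {d : measure_display} {T : measurableType d} {m n : nat}
    (Z : T -> 'M[R]_(m, n)) : set (set T) :=
  sigma_generated (fun (ij : 'I_m * 'I_n) w => Z w ij.1 ij.2).

Definition mutually_independent {d : measure_display} {T : measurableType d}
    (P : probability T R) {I : finType} (G : I -> set (set T)) : Prop :=
  forall (J : {set I}) (A : I -> set T),
    (forall i, i \in J -> G i (A i)) ->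
    P (\bigcap_(i in [set` J]) A i) = (\prod_(i in J) P (A i))%E.

Definition independent {d : measure_display} {T : measurableType d}
    (P : probability T R) (G H : set (set T)) : Prop :=
  forall A B, G A -> H B -> P (A `&` B) = (P A * P B)%E.

(* normal_prob takes the standard deviation and is not the point mass when
   that is 0. *)
Definition normal_law (m v : R) (B : set R) : \bar R :=
  if v == 0 then \d_m B else normal_prob m (Num.sqrt v) B.

Definition has_normal_law {d : measure_display} {T : measurableType d}
    (P : probability T R) (Z : T -> R) (m v : R) : Prop :=
  measurable_fun [set: T] Z /\
  forall B : set R, measurable B -> P (Z @^-1` B) = normal_law m v B.

(* The law N(0, Sigma), possibly degenerate, characterized by the laws of the
   linear functionals. *)
Definition centered_gaussian {d : measure_display} {T : measurableType d}
    (P : probability T R) {p : nat} (x : T -> 'rV[R]_p) (Sigma : 'M[R]_p) :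
    Prop :=
  random_mx x /\
  forall u : 'cV[R]_p,
    has_normal_law P (fun w => (x w *m u) 0 0) 0 ((u^T *m Sigma *m u) 0 0).

(* Stochastic order symbols for a sequence of random variables, each on a
   probability space of its own. *)
Definition cvg0_in_prob {d : nat -> measure_display}
    {T : forall n, measurableType (d n)} (P : forall n, probability (T n) R)
    (Z : forall n, T n -> R) : Prop :=
  forall e : R, 0 < e -> P n [set w | e < `|Z n w|] @[n --> \oo] --> 0%E.

Definition bounded_in_prob {d : nat -> measure_display}
    {T : forall n, measurableType (d n)} (P : forall n, probability (T n) R)
    (Z : forall n, T n -> R) : Prop :=
  forall e : R, 0 < e -> exists M : R,
    \forall n \near \oo, (P n [set w | (M < `|Z n w|)%R] <= e%:E)%E.

End probability.

(* Main.v *)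
Require Import Defs.
From HB Require Import structures.
From mathcomp Require Import all_boot all_order all_algebra.
From mathcomp Require Import all_classical all_reals all_analysis.
From mathcomp Require Import measurable_realfun spectral complex.
From mathcomp Require Import ring lra.

Set Implicit Arguments.
Unset Strict Implicit.
Unset Printing Implicit Defensive.

Import Order.TTheory GRing.Theory Num.Theory.
Import numFieldNormedType.Exports.

Local Open Scope classical_set_scope.
Local Open Scope ring_scope.

(** Put q = |Sigma0^(1/2) b*|^2. By the optimality conditions for b* and the
    betamin condition, z = Sigma0 b* / q is a subgradient of the l1 norm at
    beta0 - (lambda / (n q)) b*, which is therefore a Lasso solution for the
    noiseless population objective. Its prediction error is lambda^2 / (n q) up
    to the factor |X b*|^2 / (n q) -> 1, and it remains to show that |X w|^2 is
    of smaller order for the difference w to the actual Lasso.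

    The sum of the two optimality inequalities penalizes w by
    lambda sum_j (1 - |z_j|) |w_j|, hence by lambda |w_-S|_1 / 2 for
    S = {j : |z_j| >= 1/2}. This set contains S0, and
    |Sigma0 b*|^2 <= Lambda_max^2 q gives |S| <= 4 s0 Lambda_max^2 / kappa2(S0),
    so the compatibility assumption applies to it. As S is not random, the
    noise eps^T X w splits into a Sigma0-orthogonal projection onto the span of
    the e_j, j in S, with second moment at most of the order
    n |S| = o(lambda^2 / q), and residuals which are uniformly below 9/20
    lambda. The comparison of |X w|^2 with n |Sigma0^(1/2) w|^2 follows from
    Maurey's sparsification and a union bound over sums of d signed basis
    vectors. All probabilities come from Markov's inequality and the
    exponential moments of |X u|^2 and eps^T X u. *)

(** * Independence and Fubini *)

(** Centering at [beta0] loses constant factors. The population solution is a centre whose own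
    prediction error is already the leading term, so estimates for w may be wasteful in constants.
    Bounding all of eps^T X w by lambda |w|_1 would fail: on S it costs lambda^2 |S| / (n
    kappa2(S)), which is at least the leading term because kappa2(S) / |S| <= q. The projection
    costs n |S| instead, and |S| q <= 4 Lambda_max^2 = o(|Sigma0|_oo log(2p)) while lambda^2 >= 18 n
    |Sigma0|_oo log(2p). This is where the first assumption enters. It also forces log(2p) to
    infinity, since |Sigma0|_oo <= Lambda_max^2; failure probabilities of order 1 / log(2p)
    therefore vanish. The threshold 1/2 leaves a penalty lambda |w_-S|_1, of which twice 9/20 goes
    to the noise, whose maximum is about lambda / 3. The last tenth pays for the deviation of X^T X
    b* from n Sigma0 b* and for Maurey's slack. The argument is carried out at fixed n: r^2 bounds
    every small ratio, h is the relative accuracy, and the failure probability is at most 10^6 (r /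
    h)^2. *)

Section weighted_integral.
Context {R : realType} {d1 d2 : measure_display}.
Context {T1 : measurableType d1} {T2 : measurableType d2}.
Variables (mu1 : {measure set T1 -> \bar R}) (mu2 : {measure set T2 -> \bar R}).

Import HBNNSimple.

(** The simple functions on the right approximate [h] on the line and do not involve [Z], so the
    integral depends on [Z] and [H] only through the [H]-weighted measures of preimages under
    [Z]. *)
Lemma integral_comp_approx d (T : measurableType d) (mu : {measure set T -> \bar R})
    (Z : T -> R) (H : T -> R) (h : R -> R)
    (mh : measurable_fun [set: R] (EFin \o h)) :
  measurable_fun [set: T] Z -> measurable_fun [set: T] H ->
  (forall w, 0 <= H w) -> (forall x, 0 <= h x) ->
  (\int[mu]_w ((H w)%:E * (h (Z w))%:E))%E =
    limn (fun n => \sum_(r \in range (nnsfun_approx measurableT mh n))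
       (r%:E * \int[mu]_w ((H w)%:E *
         (\1_(nnsfun_approx measurableT mh n @^-1` [set r]) (Z w))%:E)))%E.
Proof.
move=> mZ mH' H0 h0.
have mH : measurable_fun [set: T] (fun w => (H w)%:E) by apply/measurable_EFinP.
have mind (B : set R) : measurable B ->
    measurable_fun [set: T] (fun w => (\1_B (Z w) : R)%:E).
  move=> mB; apply/measurable_EFinP; apply: measurableT_comp => //.
pose h_ := nnsfun_approx measurableT mh.
transitivity (limn (fun n => \int[mu]_w ((H w)%:E * (h_ n (Z w))%:E))%E).
  rewrite -monotone_convergence//.
  - apply: eq_integral => w _; apply/esym/cvg_lim => //.
    have ch : EFin \o h_ ^~ (Z w) @ \oo --> (h (Z w))%:E by apply: (cvg_nnsfun_approx measurableT
      mh) => // x _; rewrite lee_fin.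
    exact: cvgeZl.
  - move=> n; apply: emeasurable_funM => //; apply/measurable_EFinP.
    by apply: measurableT_comp => //; exact/measurable_funP.
  - by move=> n w _; by rewrite mule_ge0// lee_fin.
  - move=> w _ m n mn; rewrite lee_wpmul2l ?lee_fin//.
    exact/lefP/nd_nnsfun_approx.
congr (limn _); apply/funext => n.
transitivity (\int[mu]_w (\sum_(r \in range (h_ n))
   (r%:E * ((H w)%:E * (\1_(h_ n @^-1` [set r]) (Z w))%:E))))%E.
  apply: eq_integral => w _.
  rewrite fimfunE -fsumEFin// ge0_mule_fsumr; last first.
    by move=> r; rewrite nnfun_muleindic_ge0.
  by apply: eq_fsbigr => r _; rewrite EFinM muleCA.
rewrite ge0_integral_fsum//.
- apply: eq_fsbigr => r; rewrite inE => -[x _ <-].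
  rewrite ge0_integralZl//; last by rewrite lee_fin.
  + by apply: emeasurable_funM => //; apply: mind.
  + by move=> w _; by rewrite mule_ge0// lee_fin.
- move=> r; apply: emeasurable_funM => //; apply: emeasurable_funM => //.
  exact: mind.
- move=> r w _; rewrite muleCA mule_ge0 ?lee_fin//.
  exact: nnfun_muleindic_ge0.
Qed.

(** The weights serve twice: in product expectations, where a constant replaces the remaining
    factors, and for laws with a density, where Lebesgue measure is weighted. *)
Lemma eq_integral_comp (Z1 : T1 -> R) (Z2 : T2 -> R) (F : T1 -> R) (G : T2 -> R)
    (h : R -> R) :
  measurable_fun [set: T1] Z1 -> measurable_fun [set: T2] Z2 ->
  measurable_fun [set: T1] F -> measurable_fun [set: T2] G ->
  measurable_fun [set: R] h ->
  (forall w, 0 <= F w) -> (forall w, 0 <= G w) -> (forall x, 0 <= h x) ->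
  (forall B, measurable B ->
    \int[mu1]_w ((F w)%:E * (\1_B (Z1 w))%:E) =
    \int[mu2]_w ((G w)%:E * (\1_B (Z2 w))%:E))%E ->
  (\int[mu1]_w ((F w)%:E * (h (Z1 w))%:E) =
   \int[mu2]_w ((G w)%:E * (h (Z2 w))%:E))%E.
Proof.
move=> mZ1 mZ2 mF mG /measurable_EFinP mh F0 G0 h0 FG.
rewrite !(integral_comp_approx _ mh)//; congr (limn _); apply/funext => n.
by apply: eq_fsbigr => r _; rewrite FG.
Qed.

End weighted_integral.

Section independence.
Context {R : realType} {d : measure_display} {T : measurableType d}.
Variable P : probability T R.

(** Independence is known for indicators only. One coordinate at a time is freed from being an
    indicator: those below [k] are general, the others still indicators. *)
Lemma expectation_prod n (Z : 'I_n -> T -> R) (f : 'I_n -> R -> R) (m : 'I_n -> R) :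
  (forall i, measurable_fun [set: T] (Z i)) ->
  (forall B : 'I_n -> set R, (forall i, measurable (B i)) ->
    P (\bigcap_(i in [set: 'I_n]) (Z i @^-1` B i)) = \prod_i P (Z i @^-1` B i))%E ->
  (forall i, measurable_fun [set: R] (f i)) ->
  (forall i x, 0 <= f i x) ->
  (forall i, \int[P]_w (f i (Z i w))%:E = (m i)%:E)%E ->
  (\int[P]_w (\prod_i f i (Z i w))%:E = (\prod_i m i)%:E)%E.
Proof.
move=> mZ indZ.
suff main k : forall (f : 'I_n -> R -> R) (m : 'I_n -> R), (forall i, measurable_fun [set: R] (f i)) ->
    (forall i x, 0 <= f i x) ->
    (forall i, \int[P]_w (f i (Z i w))%:E = (m i)%:E)%E ->
    (forall i : 'I_n, (k <= i)%N -> exists2 B, measurable B & f i = \1_B) ->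
    (\int[P]_w (\prod_i f i (Z i w))%:E = (\prod_i m i)%:E)%E.
  move=> mf f0 fm; apply: (main n) => // i; by rewrite leqNgt ltn_ord.
elim: k => [|k IH] f0 m0 mf f_ge0 fm find.
  have {}find : forall i, exists B, measurable B /\ f0 i = \1_B.
    by move=> i; have [//|B mB ->] := find i; exists B.
  have [B HB] := choice find.
  have mB i : measurable (B i) by have [] := HB i.
  have fE i : f0 i = \1_(B i) by have [] := HB i.
  have mpre i : measurable (Z i @^-1` B i) by rewrite -[_ @^-1` _]setTI; exact: mZ.
  transitivity (\int[P]_w (\1_(\bigcap_(i in [set: 'I_n]) (Z i @^-1` B i)) w)%:E)%E.
    apply: eq_integral => w _; congr EFin.
    have [h|h] := pselect ((\bigcap_(i in [set: 'I_n]) (Z i @^-1` B i)) w).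
      rewrite indicE mem_set// big1// => i _; rewrite fE indicE mem_set//.
      exact: h.
    rewrite indicE memNset//.
    have [i hi] : exists i, ~ B i (Z i w).
      by apply/existsNP => hB; apply: h => i _; exact: hB.
    by rewrite (bigD1 i)//= fE indicE memNset// mul0r.
  rewrite integral_indic//; last first.
    by apply: fin_bigcap_measurable => //; exact: finite_finset.
  rewrite setIT; transitivity (\prod_i P (Z i @^-1` B i))%E; first exact: indZ.
  rewrite -prodEFin; apply: eq_bigr => i _.
  rewrite -fm; under eq_integral do rewrite fE.
  by rewrite (integral_indic _ _ (mpre i))// setIT.
have [kn|nk] := ltnP k n; last first.
  by apply: IH => // i ki; have := ltn_ord i; rewrite ltnNge (leq_trans nk ki).
pose j := Ordinal kn.
(* The induction hypothesis with an indicator in coordinate [j] shows that the product [F] of the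
   other factors acts on events of [Z j] like the constant [c]. *)
pose F w := \prod_(i < n | i != j) f0 i (Z i w).
pose c := \prod_(i < n | i != j) m0 i.
have m0_ge0 i : 0 <= m0 i.
  by rewrite -lee_fin -fm integral_ge0// => w _; rewrite lee_fin.
have c0 : 0 <= c by apply: prodr_ge0.
have F0 w : 0 <= F w by apply: prodr_ge0.
have mF : measurable_fun [set: T] F.
  rewrite /F; under eq_fun do rewrite big_mkcond.
  by apply: measurable_prod => i _; case: (i != j) => //=; exact: measurableT_comp.
transitivity (\int[P]_w ((F w)%:E * (f0 j (Z j w))%:E))%E.
  by apply: eq_integral => w _; rewrite (bigD1 j)//= mulrC EFinM.
rewrite (@eq_integral_comp _ _ _ _ _ P P (Z j) (Z j) F (cst c))//.
- rewrite /= ge0_integralZl_EFin//; last 2 first.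
  + by move=> w _; rewrite lee_fin.
  + by apply/measurable_EFinP; exact: measurableT_comp.
  by rewrite fm (bigD1 j)//= mulrC.
- move=> B mB.
  pose f1 i := if i == j then \1_B else f0 i.
  pose m1 i := if i == j then fine (P (Z j @^-1` B)) else m0 i.
  have mpre : measurable (Z j @^-1` B) by rewrite -[_ @^-1` _]setTI; exact: mZ.
  have IB : (\int[P]_w (\1_B (Z j w))%:E = P (Z j @^-1` B))%E.
    by rewrite (integral_indic _ _ mpre)// setIT.
  have fP : (fine (P (Z j @^-1` B)))%:E = P (Z j @^-1` B).
    by apply: fineK; apply: fin_num_measure.
  have m1E : \prod_i m1 i = fine (P (Z j @^-1` B)) * c.
    rewrite (bigD1 j)//= {1}/m1 eqxx; congr (_ * _).
    by apply: eq_bigr => i /negbTE ij; rewrite /m1 ij.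
  transitivity (\int[P]_w (\prod_i f1 i (Z i w))%:E)%E.
    apply: eq_integral => w _; rewrite -EFinM (bigD1 j)//= /f1 eqxx mulrC.
    congr (_ * _)%:E; apply: eq_bigr => i /negbTE ij; by rewrite ij.
  rewrite (IH f1 m1) ?m1E.
  + rewrite ge0_integralZl_EFin//; last first.
      apply/measurable_EFinP; exact: measurableT_comp.
    by rewrite mulrC EFinM fP; congr (_ * _)%E; exact/esym.
  + by move=> i; rewrite /f1; case: ifP.
  + by move=> i x; rewrite /f1; case: ifP.
  + move=> i; rewrite /f1 /m1; case: eqP => [->|_]; last exact: fm.
    by rewrite fP; exact: IB.
  + move=> i ki; rewrite /f1; case: eqP => [_|/eqP ij]; first by exists B.
    apply: find; rewrite ltn_neqAle ki andbT; apply: contra ij => /eqP ki'.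
    by apply/eqP/val_inj.
Qed.

(** The diagonal map into the product of the two generated sigma-algebras pushes [P] forward to the
    product of the marginals: on rectangles this is independence. *)
Lemma independent_fubini (A B : set (set T)) (F : T * T -> \bar R) :
  A `<=` measurable -> B `<=` measurable ->
  independent P <<s A>> <<s B>> ->
  measurable_fun [set: g_sigma_algebraType A * g_sigma_algebraType B] F ->
  (forall z, 0 <= F z)%E ->
  (\int[P]_w F (w, w) = \int[P]_x \int[P]_y F (x, y))%E.
Proof.
move=> AM BM indAB mF F0.
have mA : measurable_fun [set: T] (id : T -> g_sigma_algebraType A).
  move=> _ C mC; rewrite setTI preimage_id.
  by have := smallest_sub (sigma_algebra_measurable T) AM; apply.
have mB : measurable_fun [set: T] (id : T -> g_sigma_algebraType B).
  move=> _ C mC; rewrite setTI preimage_id.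
  by have := smallest_sub (sigma_algebra_measurable T) BM; apply.
have mAB : measurable_fun [set: T]
    (fun w => (w, w) : g_sigma_algebraType A * g_sigma_algebraType B).
  exact/measurable_fun_pair.
pose XA : {RV P >-> g_sigma_algebraType A} := HB.pack (id : T -> g_sigma_algebraType A)
  (isMeasurableFun.Build _ _ _ _ _ mA).
pose XB : {RV P >-> g_sigma_algebraType B} := HB.pack (id : T -> g_sigma_algebraType B)
  (isMeasurableFun.Build _ _ _ _ _ mB).
pose XAB : {RV P >-> (g_sigma_algebraType A * g_sigma_algebraType B)%type} :=
  HB.pack (fun w : T => (w, w) : g_sigma_algebraType A * g_sigma_algebraType B)
    (isMeasurableFun.Build _ _ _ _ _ mAB).
transitivity (\int[distribution P XAB]_z F z)%E.
  by rewrite ge0_integral_distribution.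
transitivity (\int[distribution P XA \x distribution P XB]_z F z)%E.
  apply: eq_measure_integral => C mC _; apply/esym.
  apply: product_measure_unique => //.
rewrite fubini_tonelli1//.
rewrite ge0_integral_distribution//=.
- apply: eq_integral => x _; rewrite /fubini_F ge0_integral_distribution//.
  apply: (measurableT_comp (g := fun y : g_sigma_algebraType B => (x : g_sigma_algebraType A, y)) mF).
  exact: pair1_measurable.
- exact: measurable_fun_fubini_tonelli_F.
- by move=> y; apply: integral_ge0.
Qed.
End independence.

(** * Gaussian exponential moments *)

Section normal.
Context {R : realType} {d : measure_display} {T : measurableType d}.
Variable P : probability T R.

Lemma normal_law_integral (Z : T -> R) (m v : R) (h : R -> R) :
  has_normal_law P Z m v -> measurable_fun [set: R] h -> (forall x, 0 <= h x) ->
  (\int[P]_w (h (Z w))%:E = if (v == 0)%R then (h m)%:E else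
     \int[lebesgue_measure]_x (normal_pdf m (Num.sqrt v) x * h x)%:E)%E.
Proof.
move=> [mZ lawZ] mh h0.
have PB (B : set R) : measurable B ->
    (\int[P]_w ((cst 1 w : R)%:E * (\1_B (Z w))%:E) = normal_law m v B)%E.
  move=> mB; have mZB : measurable (Z @^-1` B) by rewrite -[_ @^-1` _]setTI; exact: mZ.
  under eq_integral do rewrite mul1e.
  transitivity (P (Z @^-1` B)); last exact: lawZ.
  by rewrite (integral_indic _ _ mZB)// setIT.
transitivity (\int[P]_w ((cst 1 w : R)%:E * (h (Z w))%:E))%E.
  by apply: eq_integral => w _; rewrite mul1e.
have [v0|v0] := eqVneq v 0.
  rewrite (@eq_integral_comp _ _ _ _ _ P P Z (cst m) (cst 1) (cst 1))//.
    under eq_integral do rewrite mul1e.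
    by rewrite (integral_cst _ _ (h m)%:E)// [X in (_ * X)%E]probability_setT mule1.
  move=> B mB; rewrite PB// /normal_law v0 eqxx.
  under eq_integral do rewrite mul1e.
  by rewrite (integral_cst _ _ (\1_B m)%:E)// [X in (_ * X)%E]probability_setT mule1 diracE indicE.
rewrite (@eq_integral_comp _ _ _ _ _ P (@lebesgue_measure R)
  Z id (cst 1) (normal_pdf m (Num.sqrt v)))//.
- exact: measurable_normal_pdf.
- by move=> x; exact: normal_pdf_ge0.
move=> B mB; rewrite PB// /normal_law (negbTE v0) /normal_prob [LHS]integral_mkcond.
by apply: eq_integral => x _; rewrite patchE indicE; case: (x \in B); rewrite ?mule1 ?mule0.
Qed.

(** Completing the square turns the integrand into a multiple of the density of N(a, 1). *)
Lemma normal_law_exp (Z : T -> R) (a : R) : has_normal_law P Z 0 1 ->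
  (\int[P]_w (expR (a * Z w))%:E = (expR (a ^+ 2 / 2))%:E)%E.
Proof.
move=> hZ.
rewrite (normal_law_integral (h := fun x => expR (a * x)) hZ)//; last first.
  apply: measurableT_comp => //; exact: measurable_funM.
rewrite oner_eq0 sqrtr1.
rewrite -[RHS]mule1 -(@integral_normal_pdf R a 1) -ge0_integralZl_EFin//.
- apply: eq_integral => x _; rewrite -EFinM !normal_pdfE ?oner_eq0//; congr EFin.
  rewrite /normal_fun mulrCA -[LHS]mulrA; congr (_ * _).
  by rewrite -!expRD; congr expR; field.
- by move=> x _; rewrite lee_fin normal_pdf_ge0.
- by apply/measurable_EFinP; exact: measurable_normal_pdf.
Qed.

(** For v > 0 and t = 1 - 2 a v > 0, the integrand is a multiple of the density of N(0, v / t). *)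
Lemma normal_law_exp_sqr (Z : T -> R) (v a : R) : has_normal_law P Z 0 v ->
  0 <= v -> 2 * a * v < 1 ->
  (\int[P]_w (expR (a * Z w ^+ 2))%:E = ((Num.sqrt (1 - 2 * a * v))^-1)%:E)%E.
Proof.
move=> hZ v0 av.
rewrite (normal_law_integral (h := fun x => expR (a * x ^+ 2)) hZ)//; last first.
  apply: measurableT_comp => //; apply: measurable_funM => //; exact: measurable_funX.
have [->|vn0] := eqVneq v 0.
  by rewrite expr0n mulr0 expR0 mulr0 subr0 sqrtr1 invr1.
have vgt0 : 0 < v by rewrite lt_neqAle eq_sym vn0.
set t := 1 - 2 * a * v.
have t0 : 0 < t by rewrite subr_gt0.
have sv0 : Num.sqrt v != 0 by rewrite gt_eqF// sqrtr_gt0.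
have st0 : Num.sqrt t != 0 by rewrite gt_eqF// sqrtr_gt0.
have svt0 : Num.sqrt (v / t) != 0 by rewrite gt_eqF// sqrtr_gt0 divr_gt0.
rewrite -[RHS]mule1 -(@integral_normal_pdf R 0 (Num.sqrt (v / t))) -ge0_integralZl_EFin//.
- apply: eq_integral => x _; rewrite -EFinM !normal_pdfE//; congr EFin.
  rewrite /normal_peak /normal_fun !subr0 !sqr_sqrtr ?(ltW vgt0) ?divr_ge0 ?(ltW t0)//.
  rewrite -[LHS]mulrA [RHS]mulrA -[in LHS]expRD; congr (_ * expR _).
    rewrite -invfM -sqrtrM ?(ltW t0)//; congr (_ ^-1); congr Num.sqrt.
    by field; rewrite gt_eqF.
  by rewrite /t; field; rewrite vn0 -/t gt_eqF.
- by move=> x _; rewrite lee_fin normal_pdf_ge0.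
- by apply/measurable_EFinP; exact: measurable_normal_pdf.
Qed.
End normal.

Lemma measurable_sigma_generated (R : realType) d (T : measurableType d) I (f : I -> T -> R) i :
  measurable_fun [set: g_sigma_algebraType
    (\bigcup_i preimage_set_system [set: T] (f i) measurable)] (f i).
Proof.
move=> _ B mB; rewrite setTI; apply: sub_gen_smallest; exists i => //.
by exists B => //; rewrite setTI.
Qed.

Lemma row_mulE (R : pzRingType) n p (A : 'M[R]_(n, p)) (u : 'cV[R]_p) i :
  (row i A *m u) 0 0 = (A *m u) i 0.
Proof. by rewrite -row_mul mxE. Qed.

Section gaussian_design.
Context {R : realType} {d : measure_display} {T : measurableType d}.
Variable P : probability T R.

Lemma l2norm_sqr n (v : 'cV[R]_n) : l2norm v ^+ 2 = \sum_i v i 0 ^+ 2.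
Proof. by rewrite sqr_sqrtr// sumr_ge0// => i _; exact: sqr_ge0. Qed.

Lemma measurable_sigma_mx m n (W : T -> 'M[R]_(m, n)) i j :
  measurable_fun [set: g_sigma_algebraType
    (\bigcup_ij preimage_set_system [set: T]
       (fun w => W w (ij : 'I_m * 'I_n).1 ij.2) measurable)] (fun w => W w i j).
Proof.
exact: (@measurable_sigma_generated R d T _
  (fun (ij : 'I_m * 'I_n) w => W w ij.1 ij.2) (i, j)).
Qed.

Lemma sigma_mx_functional m n (W : T -> 'M[R]_(m, n)) (a : 'I_m -> 'I_n -> R) (B : set R) :
  measurable B -> sigma_mx W ((fun w => \sum_i \sum_j W w i j * a i j) @^-1` B).
Proof.
move=> mB.
have : measurable_fun [set: g_sigma_algebraType
    (\bigcup_ij preimage_set_system [set: T]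
       (fun w => W w (ij : 'I_m * 'I_n).1 ij.2) measurable)]
    (fun w => \sum_i \sum_j W w i j * a i j).
  apply: measurable_sum => i; apply: measurable_sum => j.
  by apply: measurable_funM => //; exact: measurable_sigma_mx.
by move=> /(_ measurableT B mB); rewrite setTI.
Qed.

Lemma mutual_indep_comp n p (W : 'I_n -> T -> 'rV[R]_p) (u : 'cV[R]_p) (B : 'I_n -> set R) :
  mutually_independent P (fun i : 'I_n => sigma_mx (W i)) ->
  (forall i, measurable (B i)) ->
  P (\bigcap_(i in [set: 'I_n]) ((fun w => (W i w *m u) 0 0) @^-1` B i)) =
   (\prod_i P ((fun w => (W i w *m u) 0%R 0%R) @^-1` B i))%E.
Proof.
move=> ind mB.
have := ind [set: 'I_n]%SET (fun i => (fun w => (W i w *m u) 0 0) @^-1` B i).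
have -> : [set` [set: 'I_n]%SET] = [set: 'I_n] by apply/seteqP; split => // i; rewrite /= inE.
move=> -> => [|i _].
  by apply: eq_bigl => i; rewrite inE.
rewrite [X in sigma_mx _ X](_ : _ =
  (fun w => \sum_(k < 1) \sum_j W i w k j * u j 0) @^-1` B i).
  exact: (sigma_mx_functional (fun=> u^~ 0)).
by apply/seteqP; split => w /=; rewrite big_ord1 mxE.
Qed.

Variables (n p : nat) (X : T -> 'M[R]_(n, p)) (eps : T -> 'cV[R]_n).
Variable Sigma : 'M[R]_p.
Hypothesis hXlaw : forall i : 'I_n, centered_gaussian P (fun w => row i (X w)) Sigma.
Hypothesis hXind : mutually_independent P (fun i : 'I_n => sigma_mx (fun w => row i (X w))).
Hypothesis hepslaw : forall i : 'I_n, has_normal_law P (fun w => eps w i 0) 0 1.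
Hypothesis hepsind :
  mutually_independent P (fun i : 'I_n => sigma_mx (fun w => row i (eps w))).
Hypothesis hXeps : independent P (sigma_mx X) (sigma_mx eps).

Lemma design_measurable i j : measurable_fun [set: T] (fun w => X w i j).
Proof.
have [mX _] := hXlaw i; have := mX 0 j.
by under eq_fun do rewrite mxE.
Qed.

Lemma design_mul_measurable (u : 'cV[R]_p) i : measurable_fun [set: T] (fun w => (X w *m u) i 0).
Proof.
under eq_fun do rewrite mxE.
by apply: measurable_sum => j; apply: measurable_funM => //; exact: design_measurable.
Qed.

Lemma design_exp_sqr (u : 'cV[R]_p) (a : R) :
  0 <= (u^T *m Sigma *m u) 0 0 -> 2 * a * (u^T *m Sigma *m u) 0 0 < 1 ->
  (\int[P]_w (expR (a * l2norm (X w *m u) ^+ 2))%:E =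
    ((Num.sqrt (1 - 2 * a * (u^T *m Sigma *m u) 0 0))^-1 ^+ n)%:E)%E.
Proof.
move=> v0 av.
transitivity (\int[P]_w (\prod_i expR (a * ((row i (X w) *m u) 0 0) ^+ 2))%:E)%E.
  apply: eq_integral => w _; rewrite l2norm_sqr mulr_sumr expR_sum.
  by congr EFin; apply: eq_bigr => i _; rewrite row_mulE.
rewrite (@expectation_prod _ _ _ P n (fun i w => (row i (X w) *m u) 0 0)
  (fun i x => expR (a * x ^+ 2))
  (fun=> (Num.sqrt (1 - 2 * a * (u^T *m Sigma *m u) 0 0))^-1)).
- by rewrite prodr_const card_ord.
- move=> i; under eq_fun do rewrite row_mulE; exact: design_mul_measurable.
- move=> B mB; exact: (mutual_indep_comp u hXind mB).
- move=> i; apply: measurableT_comp => //; apply: measurable_funM => //.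
- by move=> i x; exact: expR_ge0.
- move=> i; apply: normal_law_exp_sqr => //.
  by have [_ /(_ u)] := hXlaw i.
Qed.

Lemma noise_exp (x : 'I_n -> R) :
  (\int[P]_w (expR (\sum_i x i * eps w i 0))%:E = (expR ((\sum_i x i ^+ 2) / 2))%:E)%E.
Proof.
transitivity (\int[P]_w (\prod_i expR (x i * eps w i 0))%:E)%E.
  by apply: eq_integral => w _; rewrite expR_sum.
rewrite (@expectation_prod _ _ _ P n (fun i w => eps w i 0)
  (fun i y => expR (x i * y)) (fun i => expR (x i ^+ 2 / 2))).
- by rewrite mulr_suml expR_sum.
- by move=> i; have [] := hepslaw i.
- move=> B mB; have := mutual_indep_comp (const_mx 1) hepsind mB.
  have E i w : (row i (eps w) *m const_mx 1) 0 0 = eps w i 0.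
    by rewrite mxE big_ord1 !mxE mulr1.
  have {}E i : (fun w => (row i (eps w) *m const_mx 1) 0 0) = (fun w => eps w i 0).
    by apply/funext => w; exact: E.
  rewrite (eq_bigcapr (G := fun i => (fun w => eps w i 0) @^-1` B i)); last by move=> i _; rewrite E.
  by move=> ->; apply: eq_bigr => i _; rewrite E.
- by move=> i; apply: measurableT_comp => //; exact: measurable_funM.
- by move=> i y; exact: expR_ge0.
- by move=> i; apply: normal_law_exp.
Qed.

(* Conditionally on X, the variable eps^T X u is N(0, |X u|^2). *)
Lemma noise_design_exp (u : 'cV[R]_p) (s : R) :
  (\int[P]_w (expR (s * (\sum_i eps w i 0 * (X w *m u) i 0)))%:E =
   \int[P]_w (expR (s ^+ 2 / 2 * l2norm (X w *m u) ^+ 2))%:E)%E.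
Proof.
pose F (z : T * T) : \bar R := (expR (s * (\sum_i eps z.2 i 0 * (X z.1 *m u) i 0)))%:E.
pose GX := \bigcup_ij preimage_set_system [set: T]
  (fun w => X w (ij : 'I_n * 'I_p).1 ij.2) measurable.
pose GE := \bigcup_ij preimage_set_system [set: T]
  (fun w => eps w (ij : 'I_n * 'I_1).1 ij.2) measurable.
have := independent_fubini (F := F) _ _ hXeps; rewrite /F/= => ->.
- apply: eq_integral => w _.
  transitivity (\int[P]_y (expR (\sum_i (s * (X w *m u) i 0) * eps y i 0))%:E)%E.
    apply: eq_integral => y _; rewrite mulr_sumr; congr (expR _)%:E.
    by apply: eq_bigr => i _; rewrite -mulrA; congr (_ * _); rewrite mulrC.
  rewrite noise_exp l2norm_sqr; congr (expR _)%:E.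
  rewrite mulr_sumr mulr_suml; apply: eq_bigr => i _; by rewrite exprMn mulrAC.
- move=> _ [ij _ [B mB <-]]; exact: design_measurable.
- move=> _ [[i j] _ [B mB <-]] /=; rewrite ord1; have [me _] := hepslaw i; exact: me.
- apply/measurable_EFinP; apply: measurableT_comp => //; apply: measurable_funM => //.
  apply: measurable_sum => i; apply: measurable_funM.
    apply: (measurableT_comp (f := (fun w => eps w i 0) : g_sigma_algebraType GE -> R)).
      exact: measurable_sigma_mx.
    exact: measurable_snd.
  rewrite [Y in measurable_fun _ Y](_ : _ = fun z => \sum_j X z.1 i j * u j 0); last first.
    by apply/funext => z; rewrite mxE.
  apply: measurable_sum => j; apply: measurable_funM => //.
  apply: (measurableT_comp (f := (fun w => X w i j) : g_sigma_algebraType GX -> R)).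
    exact: measurable_sigma_mx.
  exact: measurable_fst.
- by move=> z; rewrite lee_fin expR_ge0.
Qed.

End gaussian_design.

(** * Tail bounds *)

Definition qform (R : pzRingType) p (A : 'M[R]_p) (u : 'cV[R]_p) : R := (u^T *m A *m u) 0 0.

(** The logarithm of the left side is x + x^2 + O(x^3); doubling the quadratic term absorbs the
    remainder for |x| <= 1/8. *)
Lemma inv_sqrt_le_expR (R : realType) (x : R) : `|x| <= 1 / 8 ->
  (Num.sqrt (1 - 2 * x))^-1 <= expR (x + 2 * x ^+ 2).
Proof.
rewrite ler_norml => /andP[x1 x2].
have t0 : 0 < 1 - 2 * x by lra.
have h : 1 <= (1 - 2 * x) * expR (2 * x + 4 * x ^+ 2).
  have y1 : 1 + (x + 2 * x ^+ 2) <= expR (x + 2 * x ^+ 2) by exact: expR_ge1Dx.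
  have -> : 2 * x + 4 * x ^+ 2 = (x + 2 * x ^+ 2) + (x + 2 * x ^+ 2) by ring.
  (* For x <= 0 the linear bound on exp is enough, as (1 - 2x)(1 + 2x + 4x^2) = 1 - 8x^3. For x > 0
     the cubic term has the wrong sign and the square of a linear bound is used. *)
  have [x0|x0] := ltP 0 x; last first.
    rewrite expRD.
    have a1 : 1 + (x + 2 * x ^+ 2) + (x + 2 * x ^+ 2) <= expR (x + 2 * x ^+ 2) * expR (x + 2 * x ^+ 2).
      by rewrite -expRD -addrA; exact: expR_ge1Dx.
    apply: le_trans (_ : _ <= (1 - 2 * x) * (1 + (x + 2 * x ^+ 2) + (x + 2 * x ^+ 2))) _.
      by nra.
    by rewrite ler_wpM2l// ltW.
  rewrite expRD.
  have z0 : 0 <= 1 + (x + 2 * x ^+ 2) by nra.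
  have z1 : (1 + (x + 2 * x ^+ 2)) ^+ 2 <= expR (x + 2 * x ^+ 2) * expR (x + 2 * x ^+ 2).
    by rewrite -expr2 ler_sqr ?nnegrE ?expR_ge0.
  apply: le_trans (_ : _ <= (1 - 2 * x) * (1 + (x + 2 * x ^+ 2)) ^+ 2) _; last first.
    by rewrite ler_wpM2l// ltW.
  have -> : (1 - 2 * x) * (1 + (x + 2 * x ^+ 2)) ^+ 2 =
    1 + x ^+ 2 * (1 - 6 * x - 4 * x ^+ 2 - 8 * x ^+ 3) by ring.
  have x3 : x ^+ 3 <= 1 / 8 * x ^+ 2.
    by rewrite exprS ler_wpM2r// sqr_ge0.
  by rewrite lerDl mulr_ge0 ?sqr_ge0//; nra.
have st0 : 0 < Num.sqrt (1 - 2 * x) by rewrite sqrtr_gt0.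
rewrite -[leLHS]mul1r ler_pdivrMr//.
rewrite -ler_sqr ?nnegrE ?mulr_ge0 ?expR_ge0 ?sqrtr_ge0//.
rewrite expr1n exprMn sqr_sqrtr ?(ltW t0)// expr2 -expRD mulrC.
by have -> : x + 2 * x ^+ 2 + (x + 2 * x ^+ 2) = 2 * x + 4 * x ^+ 2 by ring.
Qed.

Section probability_bounds.
Context {R : realType} {d : measure_display} {T : measurableType d}.
Variable P : probability T R.

(** Markov's inequality; [g] will be an exponential, a sum of two exponentials, or a normalized sum
    of squares. *)
Lemma prob_le_integral (A : set T) (g : T -> R) : measurable A ->
  measurable_fun [set: T] g -> (forall w, 0 <= g w) ->
  (forall w, A w -> 1 <= g w) -> (P A <= \int[P]_w (g w)%:E)%E.
Proof.
move=> mA mg g0 g1.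
rewrite -[X in P X]setIT -(integral_indic P measurableT mA).
apply: ge0_le_integral => //.
- by apply/measurable_EFinP; exact: measurable_indic.
- exact/measurable_EFinP.
move=> w _; rewrite lee_fin indicE; have [wA|wA] := boolP (w \in A); last exact: g0.
by apply: g1; rewrite inE in wA.
Qed.

Lemma prob_exists_le (I : finType) (A : I -> set T) (c : R) :
  (forall i, measurable (A i)) -> (forall i, (P (A i) <= c%:E)%E) ->
  (P [set w | exists i, A i w] <= (#|I|%:R * c)%:E)%E.
Proof.
move=> mA Ac.
have -> : [set w | exists i, A i w] = \big[setU/set0]_(i <- enum I) A i.
  rewrite -bigcup_seq/=.
  apply/seteqP; split => w /=; last by move=> [i _ ?]; exists i.
  by move=> [i ?]; exists i => //=; rewrite mem_enum.
apply: (@le_trans _ _ (\sum_(i <- enum I) P (A i))%E).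
  elim: (enum I) => [|i s IH]; first by rewrite !big_nil measure0.
  rewrite !big_cons; apply: le_trans (measureU2 _ _ _) _ => //.
    exact: bigsetU_measurable.
  exact: leeD2l.
apply: (@le_trans _ _ (\sum_(i <- enum I) c%:E)%E); first exact: lee_sum.
by rewrite sumEFin big_enum/= sumr_const mulr_natl.
Qed.

Lemma measurable_gt (f : T -> R) (c : R) : measurable_fun [set: T] f ->
  measurable [set w | c < f w].
Proof.
move=> mf; have -> : [set w | c < f w] = f @^-1` `]c, +oo[.
  by apply/seteqP; split => w /=; rewrite in_itv/= andbT.
by rewrite -[X in measurable X]setTI; exact: mf.
Qed.

End probability_bounds.

Section gaussian_tails.
Context {R : realType} {d : measure_display} {T : measurableType d}.
Variable P : probability T R.
Variables (n p : nat) (X : T -> 'M[R]_(n, p)) (eps : T -> 'cV[R]_n).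
Variable Sigma : 'M[R]_p.
Hypothesis hXlaw : forall i : 'I_n, centered_gaussian P (fun w => row i (X w)) Sigma.
Hypothesis hXind : mutually_independent P (fun i : 'I_n => sigma_mx (fun w => row i (X w))).
Hypothesis hepslaw : forall i : 'I_n, has_normal_law P (fun w => eps w i 0) 0 1.
Hypothesis hepsind :
  mutually_independent P (fun i : 'I_n => sigma_mx (fun w => row i (eps w))).
Hypothesis hXeps : independent P (sigma_mx X) (sigma_mx eps).
Hypothesis hSigma : psdmx Sigma.

Lemma qform_ge0 (u : 'cV[R]_p) : 0 <= qform Sigma u.
Proof. by have [_] := hSigma; apply. Qed.

Definition noise_form (w : T) (u : 'cV[R]_p) : R := \sum_i eps w i 0 * (X w *m u) i 0.

Lemma measurable_design_norm (u : 'cV[R]_p) :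
  measurable_fun [set: T] (fun w => l2norm (X w *m u) ^+ 2).
Proof.
under eq_fun do rewrite l2norm_sqr.
apply: measurable_sum => i; apply: measurable_funX; exact: (design_mul_measurable hXlaw).
Qed.

Lemma measurable_noise_form (u : 'cV[R]_p) : measurable_fun [set: T] (noise_form ^~ u).
Proof.
apply: measurable_sum => i; apply: measurable_funM; last exact: (design_mul_measurable hXlaw).
by have [] := hepslaw i.
Qed.

Lemma design_exp_le (u : 'cV[R]_p) (a b : R) :
  `|a| * qform Sigma u <= 1 / 8 ->
  (\int[P]_w (expR (a * l2norm (X w *m u) ^+ 2 + b))%:E <=
    (expR (n%:R * (a * qform Sigma u + 2 * (a * qform Sigma u) ^+ 2) + b))%:E)%E.
Proof.
move=> au; have q0 := qform_ge0 u.
have a8 : `|a * qform Sigma u| <= 1 / 8 by rewrite normrM (ger0_norm q0).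
have au1 : 2 * a * qform Sigma u < 1.
  by move: a8; rewrite ler_norml => /andP[_ ?]; rewrite -mulrA; lra.
under eq_integral do rewrite addrC expRD EFinM.
rewrite ge0_integralZl_EFin ?expR_ge0//; last first.
  apply/measurable_EFinP; apply: measurableT_comp => //.
  by apply: measurable_funM => //; exact: measurable_design_norm.
rewrite (design_exp_sqr hXlaw hXind)// -EFinM lee_fin expRD [leRHS]mulrC.
rewrite ler_wpM2l ?expR_ge0// expRM_natl lerXn2r ?nnegrE ?invr_ge0 ?sqrtr_ge0 ?expR_ge0//.
rewrite -mulrA; exact: inv_sqrt_le_expR.
Qed.

(** The rate n / 32 is linear in n, so a union over (2p)^d sums of signed basis vectors is
    affordable when d log(2p) is a small multiple of n. *)
Lemma design_lower_tail (u : 'cV[R]_p) :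
  (P [set w | (l2norm (X w *m u) ^+ 2 < n%:R * qform Sigma u / 2)%R] <=
    (expR (- n%:R / 32))%:E)%E.
Proof.
have q0 := qform_ge0 u.
have [qE|qn0] := eqVneq (qform Sigma u) 0.
  rewrite (_ : [set w | _] = set0) ?measure0 ?lee_fin ?expR_ge0//.
  by apply/seteqP; split => w //=; rewrite qE mulr0 mul0r ltNge sqr_ge0.
have qgt0 : 0 < qform Sigma u by rewrite lt_neqAle eq_sym qn0.
(* With a q = -1/8 the exponent is n (-1/8 + 2/64) + n/16 = -n/32. *)
pose a := - (8 * qform Sigma u)^-1.
have aq : a * qform Sigma u = - (1 / 8) by rewrite /a; field.
have a0 : a <= 0 by rewrite oppr_le0 invr_ge0 mulr_ge0// ltW.
apply: (@le_trans _ _ (\int[P]_w (expR (a * l2norm (X w *m u) ^+ 2 + n%:R / 16))%:E)%E).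
  apply: prob_le_integral.
  - have -> : [set w | (l2norm (X w *m u) ^+ 2 < n%:R * qform Sigma u / 2)%R] =
      [set w | (- (n%:R * qform Sigma u / 2) < - l2norm (X w *m u) ^+ 2)%R].
      by apply/seteqP; split => w /=; rewrite ltrN2.
    by apply: measurable_gt; apply: measurableT_comp => //; exact: measurable_design_norm.
  - apply: measurableT_comp => //; apply: measurable_funD => //; apply: measurable_funM => //.
    exact: measurable_design_norm.
  - by move=> w; exact: expR_ge0.
  - move=> w /= hw; rewrite -[leLHS]expR0 ler_expR.
    have : a * (n%:R * qform Sigma u / 2) <= a * l2norm (X w *m u) ^+ 2.
      by rewrite ler_wnM2l// ltW.
    have -> : a * (n%:R * qform Sigma u / 2) = a * qform Sigma u * (n%:R / 2) by ring.
    by rewrite aq; lra.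
apply: le_trans (design_exp_le _ _) _.
  by rewrite ler0_norm// mulNr aq opprK.
by rewrite lee_fin ler_expR aq; lra.
Qed.

Lemma design_deviation (u : 'cV[R]_p) (t s : R) :
  0 < t -> qform Sigma u <= t -> 0 <= s <= 1 / 2 ->
  (P [set w | (n%:R * t * s < `|l2norm (X w *m u) ^+ 2 - n%:R * qform Sigma u|)%R] <=
    (2 * expR (- (n%:R * s ^+ 2 / 8)))%:E)%E.
Proof.
move=> t0 qt /andP[s0 s1].
have q0 := qform_ge0 u.
have nE : 0 <= n%:R :> R by [].
(* The linear terms in the form cancel; a t = s/4 then leaves n (2 s^2/16 - s^2/4) = -n s^2/8, so an
   upper bound [t] on the form is enough. *)
pose a := s / (4 * t).
have a0 : 0 <= a by rewrite divr_ge0// mulr_ge0// ltW.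
have at_ : a * t = s / 4 by rewrite /a; field; rewrite gt_eqF.
have aq : a * qform Sigma u <= s / 4 by rewrite -at_ ler_wpM2l.
have aq0 : 0 <= a * qform Sigma u by rewrite mulr_ge0.
pose g (b : R) w := expR (b * l2norm (X w *m u) ^+ 2 + (- b * (n%:R * qform Sigma u) - a * (n%:R
  * t * s))).
have mg b : measurable_fun [set: T] (g b).
  apply: measurableT_comp => //; apply: measurable_funD => //; apply: measurable_funM => //.
  exact: measurable_design_norm.
have sq : (a * qform Sigma u) ^+ 2 <= s ^+ 2 / 16.
  rewrite (_ : s ^+ 2 / 16 = (s / 4) ^+ 2); last by field.
  by rewrite lerXn2r ?nnegrE// divr_ge0.
have ig b : `|b| = a -> (\int[P]_w (g b w)%:E <= (expR (- (n%:R * s ^+ 2 / 8)))%:E)%E.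
  move=> ba; apply: le_trans (design_exp_le _ _) _.
    by rewrite ba; lra.
  rewrite lee_fin ler_expR.
  have -> : (b * qform Sigma u) ^+ 2 = (a * qform Sigma u) ^+ 2.
    have b2 : b ^+ 2 = a ^+ 2 by rewrite -ba real_normK ?num_real.
    by rewrite [LHS]exprMn b2 -exprMn.
  have -> : a * (n%:R * t * s) = n%:R * (s ^+ 2 / 4).
    transitivity (a * t * (n%:R * s)); first by ring.
    by rewrite at_; field.
  have : n%:R * (2 * (a * qform Sigma u) ^+ 2) <= n%:R * (2 * (s ^+ 2 / 16)).
    by rewrite ler_wpM2l// ler_wpM2l.
  nra.
apply: (@le_trans _ _ (\int[P]_w (g a w + g (- a) w)%:E)%E).
  apply: prob_le_integral.
  - apply: measurable_gt; apply: measurableT_comp => //; apply: measurable_funB => //.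
    exact: measurable_design_norm.
  - exact: measurable_funD.
  - by move=> w; rewrite addr_ge0// expR_ge0.
  - move=> w /=; rewrite lter_normr => /orP[h|h].
      apply: (@le_trans _ _ (g a w)); last by rewrite lerDl expR_ge0.
      rewrite -[leLHS]expR0 ler_expR.
      have := ler_wpM2l a0 (ltW h); lra.
    apply: (@le_trans _ _ (g (- a) w)); last by rewrite lerDr expR_ge0.
    rewrite -[leLHS]expR0 ler_expR.
    have := ler_wpM2l a0 (ltW h); lra.
under eq_integral do rewrite EFinD.
rewrite ge0_integralD//; last 4 first.
- by move=> w _; rewrite lee_fin expR_ge0.
- exact/measurable_EFinP.
- by move=> w _; rewrite lee_fin expR_ge0.
- exact/measurable_EFinP.
rewrite mulr2n mulrDl mul1r EFinD; apply: leeD; apply: ig.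
  by rewrite ger0_norm.
by rewrite normrN ger0_norm.
Qed.

Lemma noise_exp_le (u : 'cV[R]_p) (s t b : R) :
  qform Sigma u <= t -> s ^+ 2 * t <= 1 / 4 ->
  (\int[P]_w (expR (s * noise_form w u + b))%:E <=
    (expR (n%:R * (s ^+ 2 * t / 2 + (s ^+ 2 * t) ^+ 2 / 2) + b))%:E)%E.
Proof.
move=> qt st; have q0 := qform_ge0 u.
have sq0 : 0 <= s ^+ 2 * qform Sigma u by rewrite mulr_ge0// sqr_ge0.
have sqt : s ^+ 2 * qform Sigma u <= s ^+ 2 * t by rewrite ler_wpM2l// sqr_ge0.
have := @design_exp_le u (s ^+ 2 / 2) b.
rewrite ger0_norm ?divr_ge0 ?sqr_ge0// mulrAC => /(_ _)/le_trans H.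
under eq_integral do rewrite addrC expRD EFinM.
rewrite ge0_integralZl_EFin ?expR_ge0//; last first.
  apply/measurable_EFinP; apply: measurableT_comp => //.
  by apply: measurable_funM => //; exact: measurable_noise_form.
rewrite (noise_design_exp hXlaw hepslaw hepsind hXeps).
rewrite -ge0_integralZl_EFin ?expR_ge0//; last first.
  apply/measurable_EFinP; apply: measurableT_comp => //.
  by apply: measurable_funM => //; exact: measurable_design_norm.
under eq_integral do rewrite -EFinM -expRD addrC.
apply: H; first lra.
rewrite lee_fin ler_expR lerD2r ler_wpM2l//.
have -> : 2 * (s ^+ 2 * qform Sigma u / 2) ^+ 2 = (s ^+ 2 * qform Sigma u) ^+ 2 / 2 by field.
have : (s ^+ 2 * qform Sigma u) ^+ 2 <= (s ^+ 2 * t) ^+ 2 by rewrite lerXn2r ?nnegrE// (le_trans sq0).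
lra.
Qed.

Lemma noise_tail (u : 'cV[R]_p) (s t x : R) :
  qform Sigma u <= t -> 0 <= s -> s ^+ 2 * t <= 1 / 4 ->
  (P [set w | (x < `|noise_form w u|)%R] <=
    (2 * expR (n%:R * (s ^+ 2 * t / 2 + (s ^+ 2 * t) ^+ 2 / 2) - s * x))%:E)%E.
Proof.
move=> qt s0 st.
pose g (b : R) w := expR (b * noise_form w u - s * x).
have mg b : measurable_fun [set: T] (g b).
  apply: measurableT_comp => //; apply: measurable_funD => //; apply: measurable_funM => //.
  exact: measurable_noise_form.
apply: (@le_trans _ _ (\int[P]_w (g s w + g (- s) w)%:E)%E).
  apply: prob_le_integral.
  - apply: measurable_gt; apply: measurableT_comp => //; exact: measurable_noise_form.
  - exact: measurable_funD.
  - by move=> w; rewrite addr_ge0// expR_ge0.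
  - move=> w /=; rewrite lter_normr => /orP[h|h].
      apply: (@le_trans _ _ (g s w)); last by rewrite lerDl expR_ge0.
      rewrite -[leLHS]expR0 ler_expR.
      have := ler_wpM2l s0 (ltW h); lra.
    apply: (@le_trans _ _ (g (- s) w)); last by rewrite lerDr expR_ge0.
    rewrite -[leLHS]expR0 ler_expR.
    have := ler_wpM2l s0 (ltW h); lra.
under eq_integral do rewrite EFinD.
rewrite ge0_integralD//; last 4 first.
- by move=> w _; rewrite lee_fin expR_ge0.
- exact/measurable_EFinP.
- by move=> w _; rewrite lee_fin expR_ge0.
- exact/measurable_EFinP.
rewrite mulr2n mulrDl mul1r EFinD; apply: leeD.
  exact: noise_exp_le.
by have := @noise_exp_le u (- s) t (- (s * x)) qt; rewrite sqrrN; apply.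
Qed.

(** Read off from the exponential moments at s^2 = 1/(4n) through y^2 <= 2 (e^y + e^-y). The
    constant is 32 = 8 (2 + 2), each moment being at most e^(1/4) <= 2. *)
Lemma noise_second_moment (u : 'cV[R]_p) : (0 < n)%N -> qform Sigma u <= 1 ->
  (\int[P]_w (noise_form w u ^+ 2)%:E <= (32 * n%:R)%:E)%E.
Proof.
move=> n0 q1.
have nR0 : 0 < n%:R :> R by rewrite ltr0n.
have nR1 : 1 <= n%:R :> R by rewrite ler1n.
pose s := (Num.sqrt (4 * n%:R))^-1 : R.
have s2 : s ^+ 2 = (4 * n%:R)^-1 by rewrite exprVn sqr_sqrtr// mulr_ge0.
have ns : n%:R * s ^+ 2 = 1 / 4 by rewrite s2; field; rewrite gt_eqF.
have s2le : s ^+ 2 <= 1 / 4 by have := sqr_ge0 s; nra.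
have e2 : expR (1 / 4 : R) <= 2.
  have h := expR_ge1Dx (- (1 / 4) : R); rewrite expRN in h.
  have e0 := expR_gt0 (1 / 4 : R).
  have : (1 + - (1 / 4)) * expR (1 / 4) <= 1 :> R.
    by rewrite -ler_pdivlMr// [leRHS]mul1r.
  lra.
pose g (b : R) w := expR (b * noise_form w u + 0).
have mg b : measurable_fun [set: T] (g b).
  apply: measurableT_comp => //; apply: measurable_funD => //; apply: measurable_funM => //.
  exact: measurable_noise_form.
have ig b : b ^+ 2 = s ^+ 2 -> (\int[P]_w (g b w)%:E <= 2%:E)%E.
  move=> bs; apply: le_trans (noise_exp_le (t := 1) _ q1 _) _; first by rewrite bs mulr1.
  rewrite lee_fin bs mulr1 addr0 (le_trans _ e2)// ler_expR.
  have -> : n%:R * (s ^+ 2 / 2 + (s ^+ 2) ^+ 2 / 2) = (n%:R * s ^+ 2) * (1 + s ^+ 2) / 2 by field.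
  rewrite ns; lra.
have mN := measurable_noise_form u.
apply: (@le_trans _ _ (\int[P]_w ((8 * n%:R)%:E * (g s w + g (- s) w)%:E))%E).
  apply: ge0_le_integral => //.
  - by move=> w _; rewrite lee_fin sqr_ge0.
  - by apply/measurable_EFinP; exact: measurable_funX.
  - apply: emeasurable_funM => //; apply/measurable_EFinP; exact: measurable_funD.
  move=> w _; rewrite -EFinM lee_fin /g !addr0.
  have h (y : R) : y ^+ 2 <= 2 * (expR y + expR (- y)).
    have hp (z : R) : 0 <= z -> z ^+ 2 <= 2 * expR z.
      by move=> z0; have := expR_ge1Dxn 1 z0; have -> : (2`!)%:R = 2 :> R by []; lra.
    have [y0|y0] := leP 0 y.
      by have := hp y y0; have := expR_gt0 (- y); lra.
    have := hp (- y); rewrite sqrrN oppr_ge0 => /(_ (ltW y0)); have := expR_gt0 y; lra.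
  have := h (s * noise_form w u); rewrite exprMn s2 mulrC ler_pdivrMr ?mulr_gt0//.
  by rewrite mulNr; lra.
rewrite ge0_integralZl_EFin//; last 2 first.
- by move=> w _; rewrite lee_fin addr_ge0// expR_ge0.
- apply/measurable_EFinP; exact: measurable_funD.
under eq_integral do rewrite EFinD.
rewrite ge0_integralD//; last 4 first.
- by move=> w _; rewrite lee_fin expR_ge0.
- exact/measurable_EFinP.
- by move=> w _; rewrite lee_fin expR_ge0.
- exact/measurable_EFinP.
have -> : 32 * n%:R = 8 * n%:R * (2 + 2) :> R by ring.
rewrite [leRHS]EFinM; apply: lee_wpmul2l; first by rewrite lee_fin mulr_ge0.
rewrite EFinD; apply: leeD; apply: ig => //.
by rewrite sqrrN.
Qed.

End gaussian_tails.

(** * Spectral theory of symmetric real matrices *)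

Lemma poly_interpolation (F : fieldType) (s : seq F) (f : F -> F) :
  exists g : {poly F}, forall x, x \in s -> g.[x] = f x.
Proof.
elim: s => [|a s [g Hg]]; first by exists 0.
have [as_|as_] := boolP (a \in s).
  by exists g => x; rewrite inE => /orP[/eqP ->|]; exact: Hg.
pose q := \prod_(b <- s) ('X - b%:P).
have qa : q.[a] != 0.
  by have := root_prod_XsubC s a; rewrite /root => ->.
exists (g + ((f a - g.[a]) / q.[a]) *: q) => x; rewrite inE => /orP[/eqP ->|xs].
  by rewrite hornerD hornerZ divfK// addrC subrK.
rewrite hornerD hornerZ (_ : q.[x] = 0) ?mulr0 ?addr0 ?Hg//.
by apply/eqP; have := root_prod_XsubC s x; rewrite /root xs.
Qed.

Section spectral.
Variable R : rcfType.
Implicit Type (n : nat).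
Local Open Scope complex_scope.

Lemma trmx_horner_mx n (A : 'M[R]_n.+1) (q : {poly R}) :
  A^T = A -> (horner_mx A q)^T = horner_mx A q.
Proof.
move=> sA; elim/poly_ind: q => [|q c IH]; first by rewrite !rmorph0 trmx0.
rewrite rmorphD rmorphM/= horner_mx_X horner_mx_C linearD/= tr_scalar_mx.
congr (_ + _).
have -> : (horner_mx A q * A)^T = A^T *m (horner_mx A q)^T by rewrite trmx_mul.
by rewrite IH sA; have := comm_horner_mx q (erefl (A *m A)) ; rewrite /comm_mx => <-.
Qed.

Lemma row_sqr_gt0 n (v : 'rV[R]_n) : v != 0 -> 0 < (v *m v^T) 0 0.
Proof.
move=> v0; rewrite mxE lt_neqAle; apply/andP; split; last first.
  by apply: sumr_ge0 => j _; rewrite mxE -expr2 sqr_ge0.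
apply: contra v0; rewrite eq_sym psumr_eq0; last first.
  by move=> j _; rewrite mxE -expr2 sqr_ge0.
move=> /allP h; apply/eqP/rowP => j; rewrite mxE.
by have := h j (mem_index_enum _); rewrite /= mxE -expr2 sqrf_eq0 => /eqP.
Qed.

Lemma eigenvalue_psd_ge0 n (A : 'M[R]_n) (a : R) :
  (forall u : 'cV[R]_n, 0 <= (u^T *m A *m u) 0 0) -> eigenvalue A a -> 0 <= a.
Proof.
move=> pA /eigenvalueP[v vA v0].
by have := pA v^T; rewrite trmxK vA -scalemxAl mxE pmulr_lge0// row_sqr_gt0.
Qed.

(** Diagonalization takes place over the complex numbers, where a symmetric real matrix is
    Hermitian. The weights [y i] are the squared moduli of the coordinates of V u; being real, they
    give the Rayleigh quotient without a real eigenbasis. *)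
Lemma real_spectral n (A : 'M[R]_n) : A^T = A ->
  exists (V : 'M[R[i]]_n) (e : 'I_n -> R),
  [/\ V \in unitmx, forall i, eigenvalue A (e i),
      map_mx (real_complex R) A = invmx V *m diag_mx (\row_i (e i)%:C) *m V &
      forall u : 'cV[R]_n, exists y : 'I_n -> R,
        [/\ forall i, 0 <= y i, (u^T *m A *m u) 0 0 = \sum_i e i * y i &
            (u^T *m u) 0 0 = \sum_i y i]].
Proof.
move=> sA; set Ac := map_mx (real_complex R) A.
have Areal : Ac \is a mxOver Num.real.
  by apply/mxOverP => i j; rewrite mxE; apply/complex_realP; exists (A i j).
have Asym : Ac \is symmetricmx.
  by apply/is_hermitianmxP; rewrite expr0 scale1r map_mx_id// /Ac map_trmx sA.
have Aherm := realsym_hermsym Asym Areal.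
have /orthomx_spectralP := hermitian_normalmx Aherm.
set V := spectralmx Ac; set D := spectral_diag Ac => AE.
have Dreal : D \is a mxOver Num.real by exact: hermitian_spectral_diag_real.
have VU : V \in unitmx by exact: spectral_unit.
pose e i := complex.Re (D 0 i).
have DE i : D 0 i = (e i)%:C.
  by have /mxOverP/(_ 0 i)/complex_realP[x xE] := Dreal; rewrite /e xE.
have DE' : D = \row_i (e i)%:C by apply/rowP => i; rewrite mxE DE.
exists V, e; split; [exact: VU | | by rewrite -DE' | ].
- move=> i; rewrite eigenvalue_root_char -(fmorph_root (real_complex R)) map_char_poly.
  rewrite -eigenvalue_root_char; apply/eigenvalueP; exists (row i V).
    rewrite -/Ac AE !mulmxA -row_mul mulmxV// row1 -rowE row_diag_mx -scalemxAl DE.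
    by rewrite -rowE.
  apply/eqP => rV0; have : row i (V *m invmx V) = 0 by rewrite row_mul rV0 mul0mx.
  rewrite mulmxV// => /rowP/(_ i); rewrite !mxE eqxx => /eqP; by rewrite oner_eq0.
move=> u; pose uc := map_mx (real_complex R) u.
pose z := V *m uc.
have Vinv : invmx V = map_mx Num.conj V^T by exact/invmx_unitary/spectral_unitarymx.
have uc_conj : map_mx Num.conj uc^T = uc^T.
  by apply/matrixP => i j; rewrite !mxE; apply/conj_Creal/complex_realP; exists (u j i).
have zE : uc^T *m map_mx Num.conj V^T = map_mx Num.conj z^T.
  by rewrite /z trmx_mul map_mxM uc_conj.
pose y i := complex.Re (`|z i 0| ^+ 2).
have yE i : (y i)%:C = z i 0 * (z i 0)^*.
  by rewrite -normCK /y; have /complex_realP[x ->] : `|z i 0| ^+ 2 \is Num.real by rewrite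
    realX// normr_real.
exists y; split.
- by move=> i; have := exprn_ge0 2 (normr_ge0 (z i 0)); rewrite normCK -yE lecR.
- apply: (fmorph_inj (real_complex R)) => /=.
  rewrite rmorph_sum/=.
  transitivity ((uc^T *m Ac *m uc) 0 0).
    by rewrite /uc /Ac map_trmx -!map_mxM [RHS]mxE.
  rewrite AE Vinv !mulmxA zE -mulmxA -/z mxE; apply: eq_bigr => i _.
  by rewrite rmorphM/= yE -DE mul_mx_diag !mxE; ring.
- apply: (fmorph_inj (real_complex R)) => /=.
  rewrite rmorph_sum/=.
  transitivity ((uc^T *m uc) 0 0).
    by rewrite /uc map_trmx -!map_mxM [RHS]mxE.
  rewrite -[uc in X in _ *m X]mul1mx -(mulVmx VU) Vinv !mulmxA zE -mulmxA -/z mxE.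
  by apply: eq_bigr => i _; rewrite yE mulrC; congr (_ * _); rewrite !mxE.
Qed.
End spectral.

Section psd.
Variable R : realType.
Local Open Scope complex_scope.

Lemma sqrtmx_exists n (A : 'M[R]_n) : psdmx A -> exists B : 'M[R]_n, psdmx B /\ B *m B = A.
Proof.
case: n A => [|n] A [sA pA].
  exists 0; split; last by apply/matrixP => -[].
  by split => [|u]; [rewrite trmx0 | rewrite mulmx0 mul0mx mxE].
have [V [e [VU eA AE _]]] := real_spectral sA.
have e0 i : 0 <= e i by exact: eigenvalue_psd_ge0 pA (eA i).
(* The fourth root is interpolated so that G = g(A) is real and symmetric, B = G^2 is visibly
   semidefinite, and B^2 = A. *)
have [g gE] := poly_interpolation [seq e i | i <- enum 'I_n.+1] (fun x => Num.sqrt (Num.sqrt x)).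
have ge i : g.[e i] ^+ 4 = e i.
  rewrite gE ?map_f ?mem_enum// (exprM _ 2 2) sqr_sqrtr ?sqrtr_ge0//.
  by rewrite sqr_sqrtr.
pose G := horner_mx A g.
have sG : G^T = G by exact: trmx_horner_mx.
exists (G *m G); split.
  split; first by rewrite trmx_mul sG.
  move=> u; rewrite !mulmxA -mulmxA -{1}sG -trmx_mul mxE.
  by apply: sumr_ge0 => j _; rewrite mxE -expr2 sqr_ge0.
have -> : G *m G *m (G *m G) = horner_mx A (g ^+ 4).
  by rewrite rmorphXn/= -/G !exprS expr0 mulr1 -[LHS]/(G * G * (G * G)) -!mulrA.
apply: (@map_mx_inj _ _ (real_complex R)); rewrite map_horner_mx AE.
pose q := map_poly (real_complex R) (g ^+ 4); rewrite -/q.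
pose dd : 'rV[R[i]]_n.+1 := \row_i (e i)%:C; rewrite -/dd.
have dq : horner_mx (diag_mx dd) q = diag_mx dd.
  rewrite horner_mx_diag; congr diag_mx; apply/rowP => i; rewrite !mxE /q.
  by rewrite horner_map/= horner_exp ge.
transitivity (invmx V *m horner_mx (diag_mx dd) q *m V); last by rewrite dq.
exact: horner_mx_uconjC.
Qed.

Lemma max_eigenvalue_ge n (A : 'M[R]_n) (u : 'cV[R]_n) : psdmx A ->
  (u^T *m A *m u) 0 0 <= max_eigenvalue A * (u^T *m u) 0 0.
Proof.
move=> [sA pA]; have [V [e [VU eA AE eu]]] := real_spectral sA.
have [y [y0 -> ->]] := eu u; rewrite mulr_sumr; apply: ler_sum => i _.
rewrite ler_wpM2r//; apply: ub_le_sup; last exact: eA.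
(* The supremum is meaningful only for a bounded set. The Rayleigh quotient at an eigenvector shows
   that the sum of the [e i] is an upper bound. *)
exists (\sum_i e i) => a /= /eigenvalueP[v vA v0].
have [z [z0 zA zv]] := eu v^T; rewrite trmxK vA -scalemxAl mxE in zA.
rewrite trmxK in zv; have vv := row_sqr_gt0 v0.
rewrite -(ler_pM2r vv) zA zv mulr_sumr; apply: ler_sum => j _.
rewrite ler_wpM2r// (bigD1 j)//= lerDl; apply: sumr_ge0 => k _.
exact: eigenvalue_psd_ge0 pA (eA k).
Qed.

Lemma sqrtmxP n (A : 'M[R]_n) : psdmx A -> psdmx (sqrtmx A) /\ sqrtmx A *m sqrtmx A = A.
Proof. by move=> /sqrtmx_exists ex; exact: (xgetPex 0 ex). Qed.

Lemma l2norm_dot n (v : 'cV[R]_n) : l2norm v ^+ 2 = (v^T *m v) 0 0.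
Proof. by rewrite l2norm_sqr mxE; apply: eq_bigr => i _; rewrite mxE expr2. Qed.

Lemma l2norm_sqrtmx n (A : 'M[R]_n) (u : 'cV[R]_n) : psdmx A ->
  l2norm (sqrtmx A *m u) ^+ 2 = (u^T *m A *m u) 0 0.
Proof.
move=> /sqrtmxP[[sB _] BB]; move: (sqrtmx A) sB BB => B sB <-.
by rewrite l2norm_dot trmx_mul sB !mulmxA.
Qed.

(** With B the square root of A, |A u|^2 is the quadratic form of A at B u, and the form of A at u
    is |B u|^2. *)
Lemma l2norm_mul_psd n (A : 'M[R]_n) (u : 'cV[R]_n) : psdmx A ->
  l2norm (A *m u) ^+ 2 <= max_eigenvalue A * (u^T *m A *m u) 0 0.
Proof.
move=> hA; have [[sB _] BB] := sqrtmxP hA.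
have := max_eigenvalue_ge (sqrtmx A *m u) hA.
rewrite -l2norm_dot l2norm_sqrtmx//; congr (_ <= _).
move: (sqrtmx A) sB BB => B sB <-.
by rewrite l2norm_dot !trmx_mul sB !mulmxA.
Qed.

End psd.

(** * Quadratic forms and sparsification *)

Section bilinear.
Variable (R : realType) (p : nat).
Implicit Types (A : 'M[R]_p) (u v w : 'cV[R]_p).

Definition bform A u v : R := (u^T *m A *m v) 0 0.

Lemma bformDl A u v w : bform A (u + v) w = bform A u w + bform A v w.
Proof. by rewrite /bform linearD/= !mulmxDl mxE. Qed.

Lemma bformDr A u v w : bform A w (u + v) = bform A w u + bform A w v.
Proof. by rewrite /bform mulmxDr mxE. Qed.

Lemma bformZl A a u v : bform A (a *: u) v = a * bform A u v.
Proof. by rewrite /bform linearZ/= -!scalemxAl mxE. Qed.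

Lemma bformZr A a u v : bform A u (a *: v) = a * bform A u v.
Proof. by rewrite /bform -scalemxAr mxE. Qed.

Lemma bformNr A u v : bform A u (- v) = - bform A u v.
Proof. by rewrite -scaleN1r bformZr mulN1r. Qed.

Lemma bform_sumr A u (I : Type) (r : seq I) (a : I -> R) (f : I -> 'cV[R]_p) :
  bform A u (\sum_(i <- r) a i *: f i) = \sum_(i <- r) a i * bform A u (f i).
Proof.
elim: r => [|i r IH]; first by rewrite !big_nil /bform mulmx0 mxE.
by rewrite !big_cons bformDr bformZr IH.
Qed.

Lemma bformC A u v : A^T = A -> bform A u v = bform A v u.
Proof.
move=> sA; rewrite /bform -[in RHS]sA.
have -> : v^T *m A^T *m u = (u^T *m A *m v)^T by rewrite !trmx_mul trmxK mulmxA.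
by rewrite [RHS]mxE.
Qed.

Lemma qformE A u : qform A u = bform A u u. Proof. by []. Qed.

Lemma qformD A u v : A^T = A ->
  qform A (u + v) = qform A u + 2 * bform A u v + qform A v.
Proof.
by move=> sA; rewrite !qformE bformDl !bformDr (bformC v u sA); ring.
Qed.

Lemma qformZ A a u : qform A (a *: u) = a ^+ 2 * qform A u.
Proof. by rewrite !qformE bformZl bformZr mulrA expr2. Qed.

Lemma qformN A u : qform A (- u) = qform A u.
Proof. by rewrite -scaleN1r qformZ sqrrN expr1n mul1r. Qed.

Definition basis_vec (j : 'I_p) : 'cV[R]_p := delta_mx j 0.

Lemma bform_basisr A u j : bform A u (basis_vec j) = (u^T *m A) 0 j.
Proof. by rewrite /bform /basis_vec -colE mxE. Qed.

Lemma bform_basisl A u j : bform A (basis_vec j) u = (A *m u) j 0.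
Proof. by rewrite /bform /basis_vec trmx_delta -mulmxA -rowE mxE. Qed.

Lemma qform_basis A j : qform A (basis_vec j) = A j j.
Proof. by rewrite qformE bform_basisl /basis_vec -colE mxE. Qed.

Lemma basis_vecE j k : basis_vec j k 0 = (k == j)%:R.
Proof. by rewrite mxE eqxx andbT. Qed.

Lemma col_basis_sum u : u = \sum_j u j 0 *: basis_vec j.
Proof.
apply/colP => k; rewrite summxE (bigD1 k)//= big1 ?addr0.
  by rewrite mxE basis_vecE eqxx mulr1.
by move=> j jk; rewrite mxE basis_vecE eq_sym (negbTE jk) mulr0.
Qed.

Lemma bform_sum A u v : bform A u v = \sum_j v j 0 * bform A u (basis_vec j).
Proof. by rewrite {1}(col_basis_sum v) bform_sumr. Qed.

(** Along u + a v the form is affine in [a]; being nonnegative on the whole line, it has slope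
    zero. *)
Lemma bform_null A u v : psdmx A -> qform A v = 0 -> bform A u v = 0.
Proof.
move=> [sA pA] v0.
have h a : 0 <= qform A u + 2 * a * bform A u v.
  have := pA (u + a *: v); rewrite -/(qform _ _) qformD// qformZ v0 bformZr; lra.
have q0 : 0 <= qform A u by exact: pA.
apply/eqP; case: (ltgtP (bform A u v) 0) => // hb.
  have := h (- ((qform A u + 1) / (2 * bform A u v))).
  have -> : 2 * - ((qform A u + 1) / (2 * bform A u v)) * bform A u v = - (qform A u + 1).
    by field; rewrite lt_eqF.
  lra.
have := h (- ((qform A u + 1) / (2 * bform A u v))).
have -> : 2 * - ((qform A u + 1) / (2 * bform A u v)) * bform A u v = - (qform A u + 1).
  by field; rewrite gt_eqF.
lra.
Qed.

End bilinear.

Section maurey.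
Variable (R : realType) (p : nat) (A : 'M[R]_p).
Hypothesis symA : A^T = A.

Definition signed_sum (s : seq ('I_p * bool)) : 'cV[R]_p :=
  \sum_(i <- s) (-1) ^+ i.2 *: basis_vec R i.1.

Lemma l1norm_ge0 (w : 'cV[R]_p) : 0 <= l1norm w.
Proof. exact: sumr_ge0. Qed.

(** The expression is the expectation of the form at [signed_sum s] plus m independent draws, each
    equal to sgn(w_j) e_j with probability |w_j|. The induction averages over one draw at a time, so
    no probability space is needed; m = 0 is the hypothesis. *)
Lemma maurey_unit (d : nat) (w : 'cV[R]_p) :
  (forall s : d.-tuple ('I_p * bool), 0 <= qform A (signed_sum s)) ->
  l1norm w = 1 ->
  forall m s, (size s + m)%N = d ->
  0 <= qform A (signed_sum s) + 2 * m%:R * bform A (signed_sum s) w +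
       m%:R * (m%:R - 1) * qform A w +
       m%:R * \sum_j `|w j 0| * qform A (basis_vec R j).
Proof.
move=> hd w1; elim=> [|m IH] s sd.
  rewrite addn0 in sd; have := hd (Tuple (introT eqP sd)).
  by rewrite !(mul0r, mulr0, addr0).
set b := signed_sum s; set t := \sum_j _.
have step j : 0 <= `|w j 0| * (qform A b + 2 * m%:R * bform A b w +
      m%:R * (m%:R - 1) * qform A w + m%:R * t) +
    2 * (w j 0 * bform A b (basis_vec R j)) + `|w j 0| * qform A (basis_vec R j) +
    2 * m%:R * (w j 0 * bform A w (basis_vec R j)).
  have := IH ((j, w j 0 < 0) :: s); rewrite /= addSn -addnS => /(_ sd).
  rewrite /signed_sum big_cons -/(signed_sum s) -/b -/t /=.
  set e : R := (-1) ^+ _; rewrite [e *: _ + b]addrC.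
  have e2 : e ^+ 2 = 1 by rewrite /e sqrr_sign.
  have we : `|w j 0| * e = w j 0 by rewrite /e mulrC -realEsign ?num_real.
  rewrite qformD// qformZ e2 bformZr bformDl bformZl (bformC (basis_vec R j))// => h.
  have := mulr_ge0 (normr_ge0 (w j 0)) h.
  move: we; set x : R := `|w j 0|; move: x => x; move: (w j 0) => y <-.
  by congr (0 <= _); ring.
have : 0 <= \sum_j (`|w j 0| * (qform A b + 2 * m%:R * bform A b w +
      m%:R * (m%:R - 1) * qform A w + m%:R * t) +
    2 * (w j 0 * bform A b (basis_vec R j)) + `|w j 0| * qform A (basis_vec R j) +
    2 * m%:R * (w j 0 * bform A w (basis_vec R j))) by exact: sumr_ge0.
rewrite !big_split/= -mulr_suml -!mulr_sumr -!bform_sum -/(qform A w) -/t.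
have -> : \sum_j `|w j 0| = 1 by rewrite -w1.
by congr (0 <= _); rewrite -natr1 (qformE A w); ring.
Qed.

(* Maurey's empirical method: w is the mean of random signed multiples of basis
   vectors, so a quadratic form which is nonnegative on all sums of d of these
   is almost nonnegative at w. *)
Lemma maurey (d : nat) (D : R) (w : 'cV[R]_p) : (0 < d)%N ->
  (forall s : d.-tuple ('I_p * bool), 0 <= qform A (signed_sum s)) ->
  (forall j, qform A (basis_vec R j) <= D) ->
  0 <= (d%:R - 1) * qform A w + D * l1norm w ^+ 2.
Proof.
move=> d0 hd hD; have d0' : 0 < d%:R :> R by rewrite ltr0n.
have [w0|wn0] := eqVneq (l1norm w) 0.
  have -> : w = 0.
    apply/colP => j; rewrite mxE; apply/eqP; rewrite -normr_eq0.
    by move: w0 => /eqP; rewrite psumr_eq0// => /allP/(_ j (mem_index_enum _)).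
  by rewrite qformE /bform mulmx0 mxE mulr0 add0r /l1norm big1 ?expr0n ?mulr0// => j _; rewrite
    mxE normr0.
have wgt0 : 0 < l1norm w by rewrite lt_neqAle eq_sym wn0 l1norm_ge0.
pose v := (l1norm w)^-1 *: w.
have v1 : l1norm v = 1.
  rewrite /l1norm; under eq_bigr do rewrite mxE normrM gtr0_norm ?invr_gt0//.
  by rewrite -mulr_sumr mulVf.
have := maurey_unit hd v1 (m := d) (s := [::]) erefl.
rewrite /signed_sum big_nil qformE /bform trmx0 !mul0mx mxE mulr0 !add0r => h.
have {h} : 0 <= (d%:R - 1) * qform A v + D.
  have : \sum_j `|v j 0| * qform A (basis_vec R j) <= D.
    apply: (@le_trans _ _ (\sum_j `|v j 0| * D)).
      by apply: ler_sum => j _; rewrite ler_wpM2l.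
    by rewrite -mulr_suml -/(l1norm v) v1 mul1r.
  move=> hs; rewrite -(pmulr_rge0 _ d0'); nra.
rewrite qformZ => h.
have -> : (d%:R - 1) * qform A w + D * l1norm w ^+ 2 =
  l1norm w ^+ 2 * ((d%:R - 1) * ((l1norm w)^-1 ^+ 2 * qform A w) + D) by field.
by rewrite mulr_ge0// sqr_ge0.
Qed.

End maurey.

(** * Orthogonal projection for a possibly degenerate form *)

Section gram_schmidt.
Variables (R : realType) (p : nat) (A : 'M[R]_p).
Hypothesis psdA : psdmx A.
Local Notation basis_vec := (basis_vec R).

Definition residual (F : seq 'cV[R]_p) (v : 'cV[R]_p) : 'cV[R]_p :=
  v - \sum_(f <- F) bform A f v *: f.

(** Orthonormality in the form in which it is used: residuals are orthogonal to the family, and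
    Pythagoras' identity holds. Both survive the addition of a normalized residual, without any
    indexing of pairs. *)
Definition orthonormal_seq (F : seq 'cV[R]_p) : Prop :=
  (forall v f, f \in F -> bform A f (residual F v) = 0) /\
  (forall v, qform A v = qform A (residual F v) + \sum_(f <- F) bform A f v ^+ 2).

Lemma residual_cons f F v : bform A f v = bform A f (residual F v) ->
  residual (f :: F) v = residual F v - bform A f (residual F v) *: f.
Proof. by move=> <-; rewrite /residual big_cons opprD addrA addrAC. Qed.

(** Pythagoras at v = f contains the square of the form at f, which is therefore at most the form
    itself. *)
Lemma orthonormal_qform F f : orthonormal_seq F -> f \in F -> qform A f <= 1.
Proof.
move=> [_ Fn] fF; have sA := proj1 psdA.
have h := Fn f.
have q0 : 0 <= qform A (residual F f) by exact: (proj2 psdA).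
have : qform A f ^+ 2 <= qform A f.
  rewrite [leRHS]h -[leLHS]add0r lerD// (big_rem f)//= lerDl.
  by apply: sumr_ge0 => g _; exact: sqr_ge0.
have : 0 <= qform A f by exact: (proj2 psdA).
move=> f0 f2; rewrite leNgt; apply/negP => f1.
have : qform A f * 1 < qform A f * qform A f by rewrite ltr_pM2l// (lt_trans _ f1).
by rewrite mulr1 -expr2 ltNge f2.
Qed.

Lemma residual_le F v : orthonormal_seq F -> qform A (residual F v) <= qform A v.
Proof.
by move=> [_ Fn]; rewrite [leRHS]Fn lerDl; apply: sumr_ge0 => f _; exact: sqr_ge0.
Qed.

Lemma bessel F v : orthonormal_seq F -> \sum_(f <- F) bform A f v ^+ 2 <= qform A v.
Proof. by move=> [_ ->]; rewrite lerDr; exact: (proj2 psdA). Qed.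

(** The form may be degenerate: a null residual is skipped, whence an inequality for the size and
    residuals that are null rather than zero. The support clause lets [residual_support] upgrade
    null to zero. *)
Lemma gram_schmidt (J : seq 'I_p) : exists F : seq 'cV[R]_p,
  [/\ (size F <= size J)%N, orthonormal_seq F,
      forall j, j \in J -> qform A (residual F (basis_vec j)) = 0 &
      forall f i, f \in F -> i \notin J -> f i 0 = 0].
Proof.
have sA := proj1 psdA.
elim: J => [|j J [F [sF [Fo Fn] FJ F0]]].
  exists [::]; split => //; split => // v.
  by rewrite /residual !big_nil subr0 addr0.
set r := residual F (basis_vec j).
have suppr i : i \notin j :: J -> r i 0 = 0.
  rewrite inE negb_or => /andP[ij iJ].
  rewrite mxE basis_vecE (negbTE ij) add0r mxE summxE big1_seq ?oppr0// => f /andP[_ fF].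
  by rewrite mxE F0// mulr0.
have [r0|rn0] := eqVneq (qform A r) 0.
  exists F; split => //.
  - exact: leqW.
  - by move=> k; rewrite inE => /orP[/eqP ->|]; [exact: r0 | exact: FJ].
  - by move=> f i fF; rewrite inE negb_or => /andP[_]; exact: F0.
have rgt0 : 0 < qform A r by rewrite lt_neqAle eq_sym rn0; exact: (proj2 psdA).
pose f0 := (Num.sqrt (qform A r))^-1 *: r.
have f01 : qform A f0 = 1.
  by rewrite qformZ exprVn sqr_sqrtr ?(ltW rgt0)// mulVf.
have f0F f : f \in F -> bform A f f0 = 0.
  by move=> fF; rewrite bformZr Fo// mulr0.
have f0E v : bform A f0 v = bform A f0 (residual F v).
  rewrite /residual bformDr bformNr bform_sumr big1_seq ?subr0// => f /andP[_ fF].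
  by rewrite (bformC f0)// f0F// mulr0.
have resE v : residual (f0 :: F) v = residual F v - bform A f0 v *: f0.
  by rewrite residual_cons -f0E.
exists (f0 :: F); split => //.
- split.
    move=> v f; rewrite resE inE => /orP[/eqP ->|fF].
      by rewrite bformDr bformNr bformZr -f0E -[bform A f0 f0]/(qform A f0) f01 mulr1 subrr.
    by rewrite bformDr bformNr bformZr Fo// f0F// mulr0 subr0.
  move=> v; rewrite big_cons Fn resE qformD// qformN qformZ f01 bformNr bformZr.
  rewrite (bformC (residual F v))// -f0E; ring.
- move=> k kJ; rewrite resE.
  have [kJ'|kJ'] := boolP (k \in J).
    have z : bform A f0 (basis_vec k) = 0.
      by rewrite f0E; apply: bform_null => //; exact: FJ.
    by rewrite z scale0r subr0 FJ.
  have -> : k = j by move: kJ; rewrite inE (negbTE kJ') orbF => /eqP.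
  rewrite -/r f0E -/r.
  have -> : bform A f0 r = Num.sqrt (qform A r).
    rewrite bformZl -[bform A r r]/(qform A r) -{2}(sqr_sqrtr (ltW rgt0)) expr2 mulKf//.
    by rewrite gt_eqF// sqrtr_gt0.
  rewrite /f0 scalerA mulfV ?scale1r ?subrr ?gt_eqF ?sqrtr_gt0//.
  by rewrite qformE /bform mulmx0 mxE.
- move=> f i; rewrite inE => /orP[/eqP ->|fF].
    by move=> iJ; rewrite mxE suppr// mulr0.
  by rewrite inE negb_or => /andP[_]; exact: F0.
Qed.

End gram_schmidt.

(** * The compatibility constant *)

Section compatibility.
Variables (R : realType) (p : nat) (A : 'M[R]_p) (S : {set 'I_p}).
Hypothesis psdA : psdmx A.
Implicit Types (v b : 'cV[R]_p).
Local Notation basis_vec := (basis_vec R).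

Definition l1gap v : R := l1norm (subvec v S) - l1norm (subvec v (~: S)).

Lemma l1norm_subvec v (U : {set 'I_p}) : l1norm (subvec v U) = \sum_(j in U) `|v j 0|.
Proof.
rewrite /l1norm [RHS]big_mkcond; apply: eq_bigr => j _.
by rewrite mxE; case: ifP; rewrite ?normr0.
Qed.

Lemma l1norm_split v (U : {set 'I_p}) :
  l1norm v = l1norm (subvec v U) + l1norm (subvec v (~: U)).
Proof.
rewrite !l1norm_subvec /l1norm (bigID (mem U))/=; congr (_ + _).
by apply: eq_bigl => j; rewrite inE.
Qed.

Lemma l1gapE v : l1gap v = \sum_j (if j \in S then 1 else -1) * `|v j 0|.
Proof.
rewrite /l1gap !l1norm_subvec [RHS](bigID (mem S))/= -sumrN; congr (_ + _).
  by apply: eq_bigr => j ->; rewrite mul1r.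
by apply: eq_big => [j|j]; rewrite inE// => /negbTE ->; rewrite mulN1r.
Qed.

Lemma l1gapZ a v : 0 <= a -> l1gap (a *: v) = a * l1gap v.
Proof.
move=> a0; rewrite !l1gapE mulr_sumr; apply: eq_bigr => j _.
by rewrite mxE normrM (ger0_norm a0) mulrCA.
Qed.

Lemma kappa2_le v : compat_constraint S v -> kappa2 A S <= #|S|%:R * qform A v.
Proof.
move=> cv; rewrite /qform -(l2norm_sqrtmx v psdA); apply: ge_inf; last by exists v.
by exists 0 => _ [b _ <-]; rewrite mulr_ge0// sqr_ge0.
Qed.

Lemma kappa2_ge0 : 0 <= kappa2 A S.
Proof.
rewrite /kappa2; set U := [set _ | _ in _].
have [->|/set0P U0] := eqVneq U set0; first by rewrite inf0.
by apply: lb_le_inf => // _ [b _ <-]; rewrite mulr_ge0// sqr_ge0.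
Qed.

(** By homogeneity the constraint, stated at gap 1, extends to every nonnegative gap. *)
Lemma kappa2_gap v : 0 <= l1gap v -> kappa2 A S * l1gap v ^+ 2 <= #|S|%:R * qform A v.
Proof.
rewrite le_eqVlt => /orP[/eqP <-|g0].
  by rewrite expr0n mulr0 mulr_ge0//; exact: (proj2 psdA).
have := @kappa2_le ((l1gap v)^-1 *: v); rewrite qformZ => h.
have /h {h} : compat_constraint S ((l1gap v)^-1 *: v).
  by rewrite /compat_constraint /= -/(l1gap _) l1gapZ ?invr_ge0 ?(ltW g0)// mulVf// gt_eqF.
by rewrite mulrCA exprVn [leRHS]mulrC -ler_pdivlMr ?exprn_gt0// invrK.
Qed.

Variable b : 'cV[R]_p.
Hypothesis argmin_b : compat_argmin A S b.

Lemma argmin_gap : l1gap b = 1. Proof. by have [] := argmin_b. Qed.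

Lemma argmin_qform v : 0 <= l1gap v -> qform A b * l1gap v ^+ 2 <= qform A v.
Proof.
rewrite le_eqVlt => /orP[/eqP <-|g0].
  by rewrite expr0n mulr0; exact: (proj2 psdA).
have [_ h] := argmin_b.
have /h {h} : compat_constraint S ((l1gap v)^-1 *: v).
  by rewrite /compat_constraint /= -/(l1gap _) l1gapZ ?invr_ge0 ?(ltW g0)// mulVf// gt_eqF.
rewrite -ler_sqr ?nnegrE ?sqrtr_ge0// !l2norm_sqrtmx//.
rewrite -!/(qform A _) qformZ exprVn => h.
by rewrite -ler_pdivlMr ?exprn_gt0// [leRHS]mulrC.
Qed.

Lemma kappa2_argmin : #|S|%:R * qform A b = kappa2 A S.
Proof.
apply/le_anti/andP; split; last by apply: kappa2_le; have [] := argmin_b.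
apply: lb_le_inf.
  by exists (#|S|%:R * l2norm (sqrtmx A *m b) ^+ 2); exists b => //; have [] := argmin_b.
move=> _ [v cv <-]; rewrite ler_wpM2l// l2norm_sqrtmx//.
have gv : l1gap v = 1 by exact: cv.
by have := @argmin_qform v; rewrite gv ler01 expr1n mulr1; apply.
Qed.

Lemma small_quadratic_ge0 (a c t0 : R) : 0 < t0 ->
  (forall t, 0 < t < t0 -> 0 <= a * t + c * t ^+ 2) -> 0 <= a.
Proof.
move=> t00 h; rewrite leNgt; apply/negP => a0.
(* Small enough that |c| t < -a/2, so that a negative slope would dominate. *)
pose t := Num.min (t0 / 2) (- a / (2 * (`|c| + 1))).
have c1 : 0 < 2 * (`|c| + 1) by rewrite mulr_gt0// ltr_wpDl.
have t1 : 0 < t by rewrite /t lt_min !divr_gt0// oppr_gt0.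
have t2 : t < t0.
  by rewrite /t gt_min; apply/orP; left; rewrite ltr_pdivrMr// ltr_pMr// ltr1n.
have t3 : t * (2 * (`|c| + 1)) <= - a.
  by rewrite -ler_pdivlMr// /t ge_min lexx orbT.
have := h t; rewrite t1 t2 => /(_ isT).
have cc : c <= `|c| by exact: ler_norm.
nra.
Qed.

(* One-sided derivative of the constraint along +-e_j at the minimizer. *)
Lemma argmin_derivative j (s D t0 : R) : 0 < t0 -> s ^+ 2 = 1 -> D ^+ 2 <= 1 ->
  (forall t, 0 < t < t0 -> `|b j 0 + s * t| = `|b j 0| + D * t) ->
  (if j \in S then 1 else -1) * D * qform A b <= s * (A *m b) j 0.
Proof.
move=> t00 s2 D2 habs; set o : R := if _ then _ else _.
have o2 : o ^+ 2 = 1 by rewrite /o; case: ifP; rewrite ?sqrrN expr1n.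
have q0 : 0 <= qform A b by exact: (proj2 psdA).
suff : 0 <= 2 * (s * (A *m b) j 0 - o * D * qform A b) by rewrite pmulr_rge0// subr_ge0.
(* For t < 1 the gap 1 + o D t stays nonnegative, as [argmin_qform] requires; the claim is the
   first-order term in t of the inequality it gives. *)
pose t1 := Num.min t0 1.
apply: (@small_quadratic_ge0 _ (A j j - (o * D) ^+ 2 * qform A b) t1).
  by rewrite /t1 lt_min t00 ltr01.
move=> t /andP[tg]; rewrite /t1 lt_min => /andP[tt0 tlt1].
have gE : l1gap (b + (s * t) *: basis_vec j) = 1 + o * D * t.
  rewrite l1gapE (bigD1 j)//= -/o.
  rewrite !mxE eqxx mulr1 habs ?tg//.
  have g1 := argmin_gap; rewrite l1gapE (bigD1 j)//= -/o in g1.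
  rewrite (eq_bigr (fun i => (if i \in S then 1 else -1) * `|b i 0|)).
    by rewrite -[X in _ = X + _]g1; ring.
  by move=> i ij; rewrite !mxE (negbTE ij) mulr0 addr0.
have oD : `|o * D| <= 1.
  by rewrite -(@ler_sqr _ `|_|) ?nnegrE// real_normK ?num_real// expr1n exprMn o2 mul1r.
have gge : 0 <= l1gap (b + (s * t) *: basis_vec j).
  by rewrite gE; move: oD; rewrite ler_norml => /andP[? ?]; nra.
have := argmin_qform gge; rewrite gE qformD ?(proj1 psdA)// qformZ qform_basis.
rewrite bformZr bform_basisr.
have -> : (b^T *m A) 0 j = (A *m b) j 0.
  by rewrite -[in LHS](proj1 psdA) -trmx_mul mxE.
rewrite exprMn s2 mul1r; nra.
Qed.

(** Away from the kink the constraint is smooth along e_j, and the inequalities for the two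
    directions combine into an equality. *)
Lemma argmin_kkt_sign j : b j 0 != 0 ->
  (A *m b) j 0 = (if j \in S then 1 else -1) * Num.sg (b j 0) * qform A b.
Proof.
move=> bj0; set s := Num.sg (b j 0).
have s2 : s ^+ 2 = 1 by rewrite /s sqr_sg bj0.
have bs : b j 0 = s * `|b j 0| by rewrite /s -numEsg.
have bp : 0 < `|b j 0| by rewrite normr_gt0.
have ns : `|s| = 1 by rewrite /s normr_sg bj0.
have h1 := @argmin_derivative j s 1 `|b j 0| bp s2.
have h2 := @argmin_derivative j (- s) (-1) `|b j 0| bp.
have {h1} : (if j \in S then 1 else -1) * 1 * qform A b <= s * (A *m b) j 0.
  apply: h1; first by rewrite expr1n.
  move=> t /andP[t0 _]; rewrite {1}bs -mulrDr normrM ns !mul1r ger0_norm//.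
  by rewrite addr_ge0// ltW.
have {h2} : (if j \in S then 1 else -1) * (-1) * qform A b <= - s * (A *m b) j 0.
  apply: h2; rewrite ?sqrrN ?expr1n//.
  move=> t /andP[t0 tb]; rewrite {1}bs mulNr -mulrBr normrM ns mul1r mulN1r ger0_norm//.
  by rewrite subr_ge0 ltW.
set o : R := if _ then _ else _; set y := (A *m b) j 0 => a1 a2.
have : s * y = o * qform A b by apply/le_anti/andP; split; lra.
have yE : y = s * (s * y) by rewrite mulrA -expr2 s2 mul1r.
by move=> sy; rewrite [LHS]yE sy; ring.
Qed.

(** Outside [S], moving either way from the kink lowers the gap, which bounds the gradient on both
    sides. Inside [S] the same argument would instead force the form at [b] to be at most 0. *)
Lemma argmin_kkt_zero j : j \notin S -> b j 0 = 0 -> `|(A *m b) j 0| <= qform A b.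
Proof.
move=> jS bj0.
have h (s : R) : s ^+ 2 = 1 -> `|s| = 1 -> - qform A b <= s * (A *m b) j 0.
  move=> s2 s1; have := @argmin_derivative j s 1 1 ltr01 s2.
  rewrite (negbTE jS) mulr1 mulN1r; apply; first by rewrite expr1n.
  by move=> t /andP[t0 _]; rewrite bj0 normr0 !add0r normrM s1 !mul1r gtr0_norm.
have h1 := h 1 (expr1n _ _) (normr1 _).
have h2 : - qform A b <= -1 * (A *m b) j 0.
  by apply: h; rewrite ?sqrrN ?expr1n// normrN normr1.
by rewrite ler_norml; apply/andP; split; lra.
Qed.

End compatibility.

(** * Deterministic analysis of the Lasso *)

Section vectors.
Variable R : realType.

Definition dotv n (u v : 'cV[R]_n) : R := \sum_i u i 0 * v i 0.

Lemma dotvDl n (u v x : 'cV[R]_n) : dotv (u + v) x = dotv u x + dotv v x.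
Proof. by rewrite /dotv -big_split; apply: eq_bigr => i _; rewrite mxE mulrDl. Qed.

Lemma dotvDr n (u v x : 'cV[R]_n) : dotv x (u + v) = dotv x u + dotv x v.
Proof. by rewrite /dotv -big_split; apply: eq_bigr => i _; rewrite mxE mulrDr. Qed.

Lemma dotvZl n a (u x : 'cV[R]_n) : dotv (a *: u) x = a * dotv u x.
Proof. by rewrite /dotv mulr_sumr; apply: eq_bigr => i _; rewrite mxE mulrA. Qed.

Lemma dotvZr n a (u x : 'cV[R]_n) : dotv x (a *: u) = a * dotv x u.
Proof. by rewrite /dotv mulr_sumr; apply: eq_bigr => i _; rewrite mxE mulrCA. Qed.

Lemma dotv_sumr n (I : Type) (r : seq I) (P : pred I) (u : 'cV[R]_n) (f : I -> 'cV[R]_n) :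
  dotv u (\sum_(i <- r | P i) f i) = \sum_(i <- r | P i) dotv u (f i).
Proof.
elim/big_rec2: _ => [|i y x _ <-]; last by rewrite dotvDr.
by rewrite /dotv big1// => i _; rewrite mxE mulr0.
Qed.

Lemma l2normD_sqr n (u v : 'cV[R]_n) :
  l2norm (u + v) ^+ 2 = l2norm u ^+ 2 + 2 * dotv u v + l2norm v ^+ 2.
Proof.
rewrite !l2norm_sqr /dotv mulr_sumr -!big_split; apply: eq_bigr => i _ /=.
by rewrite mxE; ring.
Qed.

Lemma l2normN n (u : 'cV[R]_n) : l2norm (- u) = l2norm u.
Proof. by congr Num.sqrt; apply: eq_bigr => i _; rewrite mxE sqrrN. Qed.

Lemma l2norm_ge0 n (u : 'cV[R]_n) : 0 <= l2norm u.
Proof. exact: sqrtr_ge0. Qed.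

Lemma cauchy_schwarz (I : Type) (s : seq I) (a c : I -> R) :
  (\sum_(i <- s) a i * c i) ^+ 2 <= (\sum_(i <- s) a i ^+ 2) * (\sum_(i <- s) c i ^+ 2).
Proof.
elim: s => [|i s]; first by rewrite !big_nil expr0n mul0r.
rewrite !big_cons.
have : 0 <= \sum_(j <- s) a j ^+ 2 by apply: sumr_ge0 => j _; exact: sqr_ge0.
have : 0 <= \sum_(j <- s) c j ^+ 2 by apply: sumr_ge0 => j _; exact: sqr_ge0.
move: (\sum_(j <- s) a j * c j) (\sum_(j <- s) a j ^+ 2) (\sum_(j <- s) c j ^+ 2).
move=> x P Q Q0 P0 xPQ; move: (a i) (c i) => {}a {}c.
suff : 2 * x * (a * c) <= P * c ^+ 2 + Q * a ^+ 2 by nra.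
have [P0'|Pn0] := eqVneq P 0.
  have x0 : x = 0.
    by apply/eqP; rewrite -sqrf_eq0; apply/eqP/le_anti; rewrite sqr_ge0 andbT (le_trans xPQ)// P0' mul0r.
  by rewrite x0 mulr0 mul0r P0' mul0r add0r mulr_ge0// sqr_ge0.
have Pgt0 : 0 < P by rewrite lt_neqAle eq_sym Pn0.
rewrite -(ler_pM2l Pgt0).
have h1 := sqr_ge0 (P * c - x * a).
have h2 : 0 <= (P * Q - x ^+ 2) * a ^+ 2 by rewrite mulr_ge0 ?sqr_ge0// subr_ge0.
nra.
Qed.

Lemma dotv_le n (u v : 'cV[R]_n) : `|dotv u v| <= l2norm u * l2norm v.
Proof.
rewrite -(@ler_sqr _ `|_|) ?nnegrE ?mulr_ge0 ?l2norm_ge0// real_normK ?num_real//.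
by rewrite exprMn !l2norm_sqr cauchy_schwarz.
Qed.

End vectors.

Section gram.
Variables (R : realType) (n p : nat) (X : 'M[R]_(n, p)).

Lemma dotv_mul (u v : 'cV[R]_p) : dotv (X *m u) (X *m v) = bform (X^T *m X) u v.
Proof.
rewrite /bform -mulmxA -!mulmxA mulmxA -trmx_mul mxE.
by apply: eq_bigr => i _; rewrite [in RHS]mxE.
Qed.

Lemma qform_gram (u : 'cV[R]_p) : qform (X^T *m X) u = l2norm (X *m u) ^+ 2.
Proof.
by rewrite qformE -dotv_mul l2norm_sqr; apply: eq_bigr => i _; rewrite expr2.
Qed.

Lemma gram_sym : (X^T *m X)^T = X^T *m X.
Proof. by rewrite trmx_mul trmxK. Qed.

Lemma bformBl (A B : 'M[R]_p) a u v : bform (A - a *: B) u v = bform A u v - a * bform B u v.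
Proof.
by rewrite /bform mulmxBr mulmxBl -scalemxAr -scalemxAl [LHS]mxE; congr (_ + _); rewrite !mxE.
Qed.

Lemma qformB (A B : 'M[R]_p) a u : qform (A - a *: B) u = qform A u - a * qform B u.
Proof. by rewrite !qformE bformBl. Qed.

End gram.

(* To be read with a = |X w|_2, tau = |A^(1/2) w|_2, W and W1 the l1 norms of w
   off and on the support, r = sqrt n and sk^2 = kappa2 / |support|. *)
Lemma lasso_error_arith (R : realType) (a tau W W1 r lam eta sk A0 x : R) :
  0 <= a -> 0 <= tau -> 0 <= W -> 0 <= W1 -> 0 < r -> 0 < lam -> 0 < sk -> 0 <= A0 ->
  0 <= eta <= 1 / 80 -> 0 <= x ->
  a ^+ 2 + lam * W <= 2 * (A0 * (r * tau) + 9 / 20 * lam * W) + 2 * (lam * eta * (W1 + W)) ->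
  W1 <= W + tau / sk ->
  r ^+ 2 / 2 * tau ^+ 2 <= a ^+ 2 + x * (W1 + W) ^+ 2 ->
  8 * x <= r ^+ 2 * sk ^+ 2 ->
  512 * 100 * x * (A0 + lam * eta / (r * sk)) ^+ 2 <= lam ^+ 2 ->
  a <= 4 * (A0 + lam * eta / (r * sk)).
Proof.
move=> a0 tau0 W0 W10 r0 lam0 sk0 A00 /andP[eta0 eta1] x0 h1 h2 h3 hx1 hx2.
set H := A0 + _ in hx2 *.
have H0 : 0 <= H by rewrite addr_ge0// divr_ge0 ?mulr_ge0// ltW.
pose y := tau / sk; have y0 : 0 <= y by rewrite divr_ge0// ltW.
have {}h2 : W1 <= W + y by [].
have ysk : y * sk = tau by rewrite /y divfK// gt_eqF.
(* Of lam W, nine tenths go to the noise and 4 eta <= 1/20 to the Gram deviation; one twentieth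
   remains. *)
have s1 : a ^+ 2 + lam * W / 20 <= 2 * (r * tau) * H.
  have -> : 2 * (r * tau) * H = 2 * (A0 * (r * tau)) + 2 * (lam * eta * y).
    by rewrite /H /y; field; rewrite !gt_eqF.
  have le0 : 0 <= lam * eta by rewrite mulr_ge0// ltW.
  have : lam * eta * (W1 + W) <= lam * eta * (2 * W + y).
    by rewrite ler_wpM2l//; lra.
  have : lam * eta * W <= lam * W / 80.
    by rewrite -!mulrA ler_wpM2l ?(ltW lam0)// mulrC ler_wpM2l//; lra.
  rewrite mulrDr; lra.
have sW : (W1 + W) ^+ 2 <= 8 * W ^+ 2 + 2 * y ^+ 2.
  have : (W1 + W) ^+ 2 <= (2 * W + y) ^+ 2.
    by apply: lerXn2r; rewrite ?nnegrE; lra.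
  have := sqr_ge0 (2 * W - y); nra.
(* By 8 x <= r^2 sk^2 the term 2 x y^2 is at most half of r^2 tau^2 / 2 and is absorbed there. *)
have s2 : (r * tau) ^+ 2 <= (2 * a + Num.sqrt (32 * x) * W) ^+ 2.
  have b1 : x * (W1 + W) ^+ 2 <= x * (8 * W ^+ 2 + 2 * y ^+ 2) by rewrite ler_wpM2l.
  have b2 : 8 * x * y ^+ 2 <= (r * tau) ^+ 2.
    have -> : (r * tau) ^+ 2 = r ^+ 2 * sk ^+ 2 * y ^+ 2 by rewrite -ysk; ring.
    by rewrite ler_wpM2r ?sqr_ge0.
  have b3 : r ^+ 2 / 2 * tau ^+ 2 = (r * tau) ^+ 2 / 2 by rewrite exprMn; ring.
  have b4 : (r * tau) ^+ 2 <= 4 * a ^+ 2 + 32 * x * W ^+ 2.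
    rewrite b3 in h3; lra.
  apply: le_trans b4 _.
  rewrite sqrrD !exprMn sqr_sqrtr ?mulr_ge0//.
  have -> : 2 ^+ 2 = 4 :> R by ring.
  rewrite addrAC lerDl mulrn_wge0// !mulr_ge0// sqrtr_ge0.
have s3 : r * tau <= 2 * a + Num.sqrt (32 * x) * W.
  move: s2; rewrite ler_sqr ?nnegrE// ?mulr_ge0 ?(ltW r0)//.
  by rewrite addr_ge0 ?mulr_ge0// sqrtr_ge0.
(* As 512 * 100 = 32 * 40^2, the cross term 2 sqrt(32 x) W H is at most the remaining lam W / 20. *)
have s4 : Num.sqrt (32 * x) * H <= lam / 40.
  rewrite -ler_sqr ?nnegrE ?mulr_ge0 ?sqrtr_ge0 ?(ltW lam0)//.
  rewrite exprMn sqr_sqrtr ?mulr_ge0// exprMn; lra.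
have s5 : 2 * (r * tau) * H <= 4 * a * H + lam * W / 20.
  have : (r * tau) * H <= (2 * a + Num.sqrt (32 * x) * W) * H by rewrite ler_wpM2r.
  have : Num.sqrt (32 * x) * H * W <= lam / 40 * W by rewrite ler_wpM2r.
  nra.
have s6 : a * a <= 4 * H * a by rewrite -expr2; lra.
have [->|an0] := eqVneq a 0; first by rewrite mulr_ge0.
by rewrite -(@ler_pM2r _ a)// lt_neqAle eq_sym an0.
Qed.

(** * Comparison of the Lasso with its population counterpart *)

Section lasso_deterministic.
Variables (R : realType) (n p : nat) (X : 'M[R]_(n, p)) (e : 'cV[R]_n).
Variables (A : 'M[R]_p) (beta0 b bhat : 'cV[R]_p) (lam : R).
Local Notation S0 := (active_set beta0).
Local Notation basis_vec := (basis_vec R).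
Hypotheses (psdA : psdmx A) (argmin_b : compat_argmin A S0 b).
Hypotheses (n0 : (0 < n)%N) (lam0 : 0 < lam) (q0 : 0 < qform A b).
Hypothesis hbetamin : forall j, j \in S0 ->
  Num.sg (b j 0) * b j 0 / qform A b * (lam / n%:R) < Num.sg (b j 0) * beta0 j 0.

Definition pop_scale : R := lam / (n%:R * qform A b).
(* beta0 - pop_scale * b is the Lasso for the noiseless population objective;
   its subgradient is [pop_subgrad]. *)
Definition pop_lasso : 'cV[R]_p := beta0 - pop_scale *: b.
Definition pop_subgrad (j : 'I_p) : R := (A *m b) j 0 / qform A b.
(** Off this set a penalty of at least (1 - 1/2) lam per unit is left to beat the noise. The price
    of the threshold is the factor 4 in the cardinality, the one in the compatibility assumption. *)
Definition pop_support : {set 'I_p} := [set j | 1 / 2 <= `|pop_subgrad j|].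

Local Notation c := pop_scale.
Local Notation z := pop_subgrad.
Local Notation So := pop_support.

Lemma pop_scale_gt0 : 0 < c.
Proof. by rewrite divr_gt0// mulr_gt0// ltr0n. Qed.

(** On the active set the betamin condition says that subtracting [pop_scale *: b] leaves a
    coordinate with the strict sign of b_j. At b_j = 0 it would read 0 < 0. *)
Lemma betamin_sign j : j \in S0 -> b j 0 != 0 /\ 0 < Num.sg (b j 0) * pop_lasso j 0.
Proof.
move=> /hbetamin h; split.
  by apply/negP => /eqP bj; move: h; rewrite bj sgr0 !mul0r ltxx.
rewrite !mxE mulrBr subr_gt0; apply: le_lt_trans h.
by rewrite /pop_scale invfM le_eqVlt; apply/orP; left; apply/eqP; ring.
Qed.

Lemma pop_subgrad_active j : b j 0 != 0 ->
  z j = (if j \in S0 then 1 else -1) * Num.sg (b j 0).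
Proof.
by move=> bj; rewrite /pop_subgrad (argmin_kkt_sign psdA argmin_b bj) mulfK// gt_eqF.
Qed.

Lemma active_sub_support : S0 \subset So.
Proof.
apply/fintype.subsetP => j jS; have [bj _] := betamin_sign jS.
have zj : `|z j| = 1 by rewrite pop_subgrad_active// jS mul1r normr_sg bj.
by rewrite inE zj; lra.
Qed.

(** If b_j is nonzero, z_j is a sign that agrees with [pop_lasso] and the left side vanishes.
    Otherwise j is inactive, [pop_lasso] is 0 there, and the slack 1 - |z_j| is kept. *)
Lemma pop_subgrad_ineq j x :
  (1 - `|z j|) * `|x| <= `|pop_lasso j 0 - x| - `|pop_lasso j 0| + z j * x.
Proof.
have sign_case (s : R) : `|s| = 1 -> 0 <= s * pop_lasso j 0 -> z j = s ->
    (1 - `|z j|) * `|x| <= `|pop_lasso j 0 - x| - `|pop_lasso j 0| + z j * x.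
  move=> s1 sp ->; rewrite s1 subrr mul0r.
  have -> : `|pop_lasso j 0| = s * pop_lasso j 0.
    by rewrite -[LHS]mul1r -s1 -normrM ger0_norm.
  have : s * (pop_lasso j 0 - x) <= `|pop_lasso j 0 - x|.
    by rewrite -[leRHS]mul1r -s1 -normrM ler_norm.
  by rewrite mulrBr; lra.
have [jS|jS] := boolP (j \in S0).
  have [bj sp] := betamin_sign jS.
  apply: (sign_case (Num.sg (b j 0))); [by rewrite normr_sg bj | exact: ltW |].
  by rewrite pop_subgrad_active// jS mul1r.
have b0 : beta0 j 0 = 0 by apply/eqP; move: jS; rewrite inE negbK.
have [bj|bj] := eqVneq (b j 0) 0.
  have -> : pop_lasso j 0 = 0 by rewrite !mxE b0 bj mulr0 subr0.
  rewrite normr0 sub0r normrN subr0 mulrBl mul1r lerD2l lerNl.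
  by rewrite -normrM -normrN ler_norm.
apply: (sign_case (- Num.sg (b j 0))).
- by rewrite normrN normr_sg bj.
- rewrite !mxE b0 sub0r mulrNN mulrCA -normrEsg mulr_ge0//.
  exact: ltW pop_scale_gt0.
- by rewrite pop_subgrad_active// (negbTE jS) mulN1r.
Qed.

Lemma pop_subgrad_gap (w : 'cV[R]_p) :
  l1norm (subvec w (~: So)) / 2 <=
  l1norm (pop_lasso - w) - l1norm pop_lasso + \sum_j z j * w j 0.
Proof.
have z1 j : `|z j| <= 1.
  have [bj|bj] := eqVneq (b j 0) 0.
    have jS : j \notin S0 by apply/negP => /betamin_sign[]; rewrite bj eqxx.
    rewrite /pop_subgrad normrM normfV (gtr0_norm q0) ler_pdivrMr// mul1r.
    exact: (argmin_kkt_zero psdA argmin_b jS bj).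
  by rewrite pop_subgrad_active//; case: ifP => _; rewrite ?mul1r ?mulN1r ?normrN normr_sg bj.
apply: (@le_trans _ _ (\sum_j (1 - `|z j|) * `|w j 0|)).
  rewrite l1norm_subvec mulr_suml big_mkcond; apply: ler_sum => j _.
  case: ifP; rewrite !inE => hj; last by rewrite mulr_ge0// subr_ge0.
  by rewrite mulrC ler_wpM2r//; move: hj; rewrite -ltNge; lra.
rewrite -sumrB -big_split/=; apply: ler_sum => j _.
have := pop_subgrad_ineq j (w j 0); rewrite !mxE; exact.
Qed.

(** Each index counted contributes at least q^2 / 4 to |A b|^2, which is at most the largest
    eigenvalue times q, with q the form at [b]. *)
Lemma card_pop_support : #|So|%:R * qform A b <= 4 * max_eigenvalue A.
Proof.
have h1 := l2norm_mul_psd b psdA; rewrite -/(qform A b) l2norm_sqr in h1.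
have h2 : #|So|%:R * (qform A b ^+ 2 / 4) <= \sum_j (A *m b) j 0 ^+ 2.
  rewrite mulr_natl -sumr_const big_mkcond; apply: ler_sum => j _.
  case: ifP; last by rewrite sqr_ge0.
  rewrite inE /pop_subgrad normrM normfV (gtr0_norm q0) ler_pdivlMr// => hj.
  have -> : qform A b ^+ 2 / 4 = (1 / 2 * qform A b) ^+ 2 by field.
  rewrite -[leRHS]real_normK ?num_real// lerXn2r ?nnegrE//.
  by rewrite mulr_ge0// ltW.
have {h1 h2} h := le_trans h2 h1.
rewrite -(ler_pM2r q0); lra.
Qed.

Definition lasso_error : 'cV[R]_p := pop_lasso - bhat.
Local Notation w := lasso_error.
(** The subgradient is proportional to n A b, whereas the data supply X^T X b; this is the
    discrepancy in direction [v]. *)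
Definition gram_error (v : 'cV[R]_p) : R := bform (X^T *m X - n%:R *: A) b v.

Hypothesis hbhat : lasso X (X *m beta0 + e) lam bhat.

(** Optimality of [bhat] is tested at [pop_lasso] only. The cross term c (X b)^T X w equals lam z^T
    w up to the Gram discrepancy, and z^T w completes the difference of l1 norms to the subgradient
    gap. *)
Lemma lasso_basic_inequality :
  l2norm (X *m w) ^+ 2 + lam * l1norm (subvec w (~: So)) <=
  2 * `|dotv e (X *m w)| + 2 * (c * `|gram_error w|).
Proof.
have nR : 0 < n%:R :> R by rewrite ltr0n.
have := hbhat pop_lasso; rewrite /lasso_objective.
have -> : X *m beta0 + e - X *m bhat = (e + c *: (X *m b)) + X *m w.
  rewrite /lasso_error /pop_lasso !mulmxBr -scalemxAr.
  by rewrite addrC addrA [in RHS]addrC; apply/colP => i; rewrite !mxE; ring.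
have -> : X *m beta0 + e - X *m pop_lasso = e + c *: (X *m b).
  by rewrite /pop_lasso !mulmxBr -scalemxAr; apply/colP => i; rewrite !mxE; ring.
rewrite (l2normD_sqr (e + _)) dotvDl dotvZl dotv_mul.
have -> : bhat = pop_lasso - w by rewrite /lasso_error opprB addrC subrK.
have gE : bform (X^T *m X) b w = gram_error w + n%:R * bform A b w.
  by rewrite /gram_error bformBl subrK.
have zE : c * (n%:R * bform A b w) = lam * \sum_j z j * w j 0.
  rewrite bform_sum !mulr_sumr; apply: eq_bigr => j _.
  rewrite bformC ?(proj1 psdA)// bform_basisl /pop_subgrad /pop_scale.
  by field; rewrite !gt_eqF.
rewrite gE => h.
have hgap := pop_subgrad_gap w.
have {}hgap := ler_wpM2l (ltW lam0) hgap.
have h1 : - `|dotv e (X *m w)| <= dotv e (X *m w) by rewrite lerNl -normrN ler_norm.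
have h2 : - (c * `|gram_error w|) <= c * gram_error w.
  by rewrite lerNl -mulrN ler_wpM2l ?(ltW pop_scale_gt0)// -normrN ler_norm.
move: h; rewrite (mulrDr c) zE; move: hgap; rewrite mulrDr mulrBr.
set u1 := l1norm (pop_lasso - w); set u2 := l1norm pop_lasso.
set s := \sum_j _; lra.
Qed.

Variables (K eta A0 : R) (d : nat).
Local Notation kap := (kappa2 A So / #|So|%:R).
Hypotheses (kap0 : 0 < kappa2 A So) (So0 : So != finset.set0).
Hypotheses (K0 : 0 < K) (eta01 : 0 <= eta <= 1 / 80) (A00 : 0 <= A0) (d1 : (1 < d)%N).

(** A vector living on the support has gap equal to its l1 norm, so a positive compatibility
    constant allows no nonzero null vector there. *)
Lemma residual_support (F : seq 'cV[R]_p) j :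
  (forall f i, f \in F -> i \notin enum So -> f i 0 = 0) ->
  qform A (residual A F (basis_vec j)) = 0 -> j \in So ->
  residual A F (basis_vec j) = 0.
Proof.
move=> F0 q0' jS; set u := residual _ _ _ in q0' *.
have uS i : i \notin So -> u i 0 = 0.
  move=> iS; rewrite /u /residual mxE basis_vecE.
  have -> : (i == j) = false by apply: contraNF iS => /eqP ->.
  rewrite add0r mxE summxE big1_seq ?oppr0// => f /andP[_ fF].
  by rewrite mxE F0 ?mulr0// mem_enum.
have gE : l1gap So u = l1norm u.
  rewrite (l1norm_split u So) /l1gap; congr (_ + _).
  have -> : l1norm (subvec u (~: So)) = 0; last by rewrite oppr0.
  by rewrite l1norm_subvec big1// => i; rewrite inE => /uS ->; rewrite normr0.
have := @kappa2_gap _ _ A So psdA u; rewrite gE l1norm_ge0 => /(_ isT).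
rewrite q0' mulr0 pmulr_rle0// => h.
have u1 : l1norm u = 0 by apply/eqP; rewrite -sqrf_eq0; apply/eqP/le_anti; rewrite h sqr_ge0.
apply/colP => i; rewrite [RHS]mxE; apply/eqP; rewrite -normr_eq0.
by move: u1 => /eqP; rewrite psumr_eq0// => /allP/(_ i (mem_index_enum _)).
Qed.

(** The component in the span of [F] is handled by Cauchy-Schwarz and Bessel. The rest is a
    combination of residuals of basis vectors, which vanish on the support, so only the l1 norm off
    it is charged. *)
Lemma noise_bound (F : seq 'cV[R]_p) (x : R) (v : 'cV[R]_p) :
  orthonormal_seq A F ->
  (forall j, j \in So -> residual A F (basis_vec j) = 0) ->
  (forall j, `|dotv e (X *m residual A F (basis_vec j))| <= x) ->
  \sum_(f <- F) dotv e (X *m f) ^+ 2 <= n%:R * A0 ^+ 2 ->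
  `|dotv e (X *m v)| <=
    A0 * (Num.sqrt n%:R * Num.sqrt (qform A v)) + x * l1norm (subvec v (~: So)).
Proof.
move=> Fo Fres hx hF.
have vE : v = \sum_(f <- F) bform A f v *: f + \sum_j v j 0 *: residual A F (basis_vec j).
  rewrite /residual; under [in X in _ + X]eq_bigr do rewrite scalerBr.
  rewrite sumrB -col_basis_sum.
  have -> : \sum_j v j 0 *: (\sum_(f <- F) bform A f (basis_vec j) *: f) =
            \sum_(f <- F) bform A f v *: f.
    under eq_bigr do rewrite scaler_sumr.
    rewrite exchange_big/=; apply: eq_bigr => f _.
    rewrite [in RHS]bform_sum scaler_suml; apply: eq_bigr => j _.
    by rewrite scalerA.
  by rewrite addrC subrK.
rewrite {1}vE mulmxDr dotvDr; apply: le_trans (ler_normD _ _) _; apply: lerD.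
  rewrite mulmx_sumr dotv_sumr.
  under eq_bigr do rewrite -scalemxAr dotvZr.
  rewrite -(@ler_sqr _ `|_|) ?nnegrE ?mulr_ge0 ?sqrtr_ge0// real_normK ?num_real//.
  apply: le_trans (cauchy_schwarz _ _ _) _.
  have qv : 0 <= qform A v by exact: (proj2 psdA).
  rewrite !exprMn !sqr_sqrtr// mulrC mulrA [A0 ^+ 2 * _]mulrC.
  apply: ler_pM => //; try by apply: sumr_ge0 => f _; exact: sqr_ge0.
  exact: bessel.
rewrite mulmx_sumr dotv_sumr; apply: le_trans (ler_norm_sum _ _ _) _.
rewrite l1norm_subvec mulr_sumr [leRHS]big_mkcond; apply: ler_sum => j _.
rewrite -scalemxAr dotvZr normrM inE; case: ifPn => [jS|].
  by rewrite mulrC ler_wpM2r.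
rewrite negbK => jS; rewrite Fres//.
by rewrite mulmx0 /dotv big1 ?normr0 ?mulr0// => i _; rewrite mxE mulr0.
Qed.

Hypothesis good_sums : forall s : d.-tuple ('I_p * bool),
  n%:R * qform A (signed_sum R s) / 2 <= l2norm (X *m signed_sum R s) ^+ 2.
Hypothesis good_columns : forall j, l2norm (X *m basis_vec j) ^+ 2 <= 2 * n%:R * K.
Hypothesis good_gram : forall j, c * `|gram_error (basis_vec j)| <= lam * eta.
Hypothesis good_noise : exists F : seq 'cV[R]_p, [/\ orthonormal_seq A F,
  forall j, j \in So -> residual A F (basis_vec j) = 0,
  forall j, `|dotv e (X *m residual A F (basis_vec j))| <= 9 / 20 * lam &
  \sum_(f <- F) dotv e (X *m f) ^+ 2 <= n%:R * A0 ^+ 2].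

(** Maurey's lemma applied to X^T X - (n/2) A, which may be indefinite: it is nonnegative on the
    sums of [d] signed basis vectors, and its diagonal is at most 2 n K. *)
Lemma restricted_eigenvalue (v : 'cV[R]_p) :
  n%:R / 2 * qform A v <=
  l2norm (X *m v) ^+ 2 + 2 * n%:R * K / (d%:R - 1) * l1norm v ^+ 2.
Proof.
have dR : 0 < d%:R - 1 :> R by rewrite subr_gt0 ltr1n.
have symM : (X^T *m X - (n%:R / 2) *: A)^T = X^T *m X - (n%:R / 2) *: A.
  by rewrite linearB linearZ/= gram_sym (proj1 psdA).
have := @maurey _ _ _ symM d (2 * n%:R * K) v (ltnW d1).
have QE u : qform (X^T *m X - (n%:R / 2) *: A) u =
    l2norm (X *m u) ^+ 2 - n%:R / 2 * qform A u by rewrite qformB qform_gram.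
have hs s : 0 <= qform (X^T *m X - (n%:R / 2) *: A) (signed_sum R (s : d.-tuple ('I_p * bool))).
  by rewrite QE subr_ge0; have := good_sums s; lra.
have hc j : qform (X^T *m X - (n%:R / 2) *: A) (basis_vec j) <= 2 * n%:R * K.
  rewrite QE; have := good_columns j.
  have : 0 <= n%:R / 2 * qform A (basis_vec j) by rewrite mulr_ge0//; exact: (proj2 psdA).
  lra.
move=> /(_ hs hc); rewrite QE => h.
rewrite -subr_ge0 -(pmulr_rge0 _ dR).
congr (0 <= _) : h; field; exact: lt0r_neq0.
Qed.

Lemma gram_bound (v : 'cV[R]_p) : c * `|gram_error v| <= lam * eta * l1norm v.
Proof.
rewrite /gram_error bform_sum; apply: le_trans (_ : c * \sum_j `|v j 0| * `|gram_error (basis_vec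
  j)| <= _).
  rewrite ler_wpM2l ?(ltW pop_scale_gt0)//; apply: le_trans (ler_norm_sum _ _ _) _.
  by apply: ler_sum => j _; rewrite normrM.
rewrite !mulr_sumr; apply: ler_sum => j _.
by rewrite mulrCA [leRHS]mulrC ler_wpM2l.
Qed.

Lemma lasso_error_bound :
  16 * K <= (d%:R - 1) * kap ->
  18 ^+ 4 * K * (n%:R * (A0 + lam * eta / (Num.sqrt n%:R * Num.sqrt kap)) ^+ 2) <=
    (d%:R - 1) * lam ^+ 2 ->
  l2norm (X *m w) <= 4 * (A0 + lam * eta / (Num.sqrt n%:R * Num.sqrt kap)).
Proof.
move=> hd1 hd2.
have nR : 0 < n%:R :> R by rewrite ltr0n.
have dR : 0 < d%:R - 1 :> R by rewrite subr_gt0 ltr1n.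
have cS : 0 < #|So|%:R :> R by rewrite ltr0n card_gt0.
have kap_gt0 : 0 < kap by rewrite divr_gt0.
have [F [Fo Fres Fn FA]] := good_noise.
have qw : 0 <= qform A w by exact: (proj2 psdA).
apply: (@lasso_error_arith _ _ (Num.sqrt (qform A w)) (l1norm (subvec w (~: So)))
  (l1norm (subvec w So)) _ _ _ _ _ (2 * n%:R * K / (d%:R - 1))) => //.
- exact: l2norm_ge0.
- exact: l1norm_ge0.
- exact: l1norm_ge0.
- by rewrite sqrtr_gt0.
- by rewrite sqrtr_gt0.
- by rewrite divr_ge0 ?mulr_ge0 ?(ltW K0) ?(ltW dR).
- have h1 := lasso_basic_inequality.
  have h2 := noise_bound w Fo Fres Fn FA.
  have h3 := gram_bound w.
  rewrite (l1norm_split w So) in h3; lra.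
- have [g0|g0] := leP 0 (l1gap So w); last first.
    have : 0 <= Num.sqrt (qform A w) / Num.sqrt kap by rewrite divr_ge0 ?sqrtr_ge0.
    by move: g0; rewrite /l1gap; lra.
  have := kappa2_gap psdA g0 => h.
  rewrite -lerBlDl -/(l1gap So w) ler_pdivlMr ?sqrtr_gt0//.
  rewrite -ler_sqr ?nnegrE ?mulr_ge0 ?sqrtr_ge0// exprMn !sqr_sqrtr ?(ltW kap_gt0)//.
  by rewrite mulrA ler_pdivrMr// [leLHS]mulrC [leRHS]mulrC.
- rewrite sqr_sqrtr ?(ltW nR)// (sqr_sqrtr qw).
  have <- := l1norm_split w So; exact: restricted_eigenvalue.
- rewrite !sqr_sqrtr ?(ltW nR) ?(ltW kap_gt0)// mulrA ler_pdivrMr//.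
  have := ler_wpM2l (ltW nR) hd1; lra.
(* Here 18^4 = 104976 exceeds 512 * 100 * 2, the last factor coming from Maurey's slack 2 n K / (d -
   1). *)
- move: hd2; set H := A0 + _ => hd2.
  have -> : 512 * 100 * (2 * n%:R * K / (d%:R - 1)) * H ^+ 2 =
    512 * 100 * 2 * (K * (n%:R * H ^+ 2)) / (d%:R - 1) by field; exact: lt0r_neq0.
  rewrite ler_pdivrMr// [leRHS]mulrC; apply: le_trans hd2; rewrite -[leRHS]mulrA.
  have KH : 0 <= K * (n%:R * H ^+ 2) by rewrite mulr_ge0 ?(ltW K0)// mulr_ge0 ?sqr_ge0// ltW.
  rewrite ler_wpM2r//; lra.
Qed.

(** The error vector is -(c X b + X w). The square of the first part is M up to the relative error
    h/2; since |X w| <= (h/25) sqrt(M), the cross term and |X w|^2 fit into the other h/2. *)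
Lemma lasso_prediction_error (h : R) :
  0 < h <= 1 ->
  16 * K <= (d%:R - 1) * kap ->
  18 ^+ 4 * K <= (d%:R - 1) * qform A b ->
  `|l2norm (X *m b) ^+ 2 - n%:R * qform A b| <= n%:R * qform A b * (h / 2) ->
  A0 + lam * eta / (Num.sqrt n%:R * Num.sqrt kap) <=
    h / 100 * Num.sqrt (lam ^+ 2 / n%:R / qform A b) ->
  `|l2norm (X *m (bhat - beta0)) ^+ 2 - lam ^+ 2 / n%:R / qform A b| <=
    h * (lam ^+ 2 / n%:R / qform A b).
Proof.
move=> /andP[h0 h1] hd1 hd2 hb.
set M := lam ^+ 2 / n%:R / qform A b; set H := A0 + _ => HM.
have nR : 0 < n%:R :> R by rewrite ltr0n.
have dR : 0 < d%:R - 1 :> R by rewrite subr_gt0 ltr1n.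
have kap_gt0 : 0 < kap by rewrite divr_gt0// ltr0n card_gt0.
have M0 : 0 < M by rewrite !divr_gt0// exprn_gt0.
have H0 : 0 <= H.
  by rewrite addr_ge0// divr_ge0 ?mulr_ge0 ?sqrtr_ge0 ?(ltW lam0)//; case/andP: eta01.
have sM0 : 0 < Num.sqrt M by rewrite sqrtr_gt0.
have sM2 : Num.sqrt M ^+ 2 = M by rewrite sqr_sqrtr// ltW.
have aH : l2norm (X *m w) <= 4 * H.
  apply: lasso_error_bound => //; rewrite -/H.
  have HM2 : H ^+ 2 <= M.
    rewrite -sM2 lerXn2r ?nnegrE ?(ltW sM0)// (le_trans HM)//; nra.
  have : n%:R * H ^+ 2 <= n%:R * M by rewrite ler_wpM2l// ltW.
  have nM : n%:R * M * qform A b = lam ^+ 2 by rewrite /M; field; rewrite !gt_eqF.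
  move=> nH; rewrite -nM.
  have -> : (d%:R - 1) * (n%:R * M * qform A b) = (d%:R - 1) * qform A b * (n%:R * M) by ring.
  have := mulr_ge0 (exprn_ge0 4 (ler0n R 18)) (ltW K0).
  move: (18 ^+ 4 * K) hd2 => C hd2 C0.
  by apply: ler_pM; rewrite // mulr_ge0// sqr_ge0.
have -> : X *m (bhat - beta0) = - (c *: (X *m b) + X *m w).
  rewrite /lasso_error /pop_lasso !mulmxBr -scalemxAr.
  by apply/colP => i; rewrite !mxE; ring.
rewrite l2normN l2normD_sqr.
have cE : c ^+ 2 * (n%:R * qform A b) = M by rewrite /pop_scale /M; field; rewrite !gt_eqF.
have xE : l2norm (c *: (X *m b)) ^+ 2 = c ^+ 2 * l2norm (X *m b) ^+ 2.
  by rewrite !l2norm_sqr mulr_sumr; apply: eq_bigr => i _; rewrite mxE exprMn.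
have xM : `|l2norm (c *: (X *m b)) ^+ 2 - M| <= M * (h / 2).
  rewrite xE -cE -mulrBr normrM ger0_norm ?sqr_ge0// -mulrA.
  by rewrite ler_wpM2l ?sqr_ge0.
have y1 : l2norm (X *m w) <= h / 25 * Num.sqrt M by apply: le_trans aH _; lra.
have x1 : l2norm (c *: (X *m b)) <= 13 / 10 * Num.sqrt M.
  rewrite -ler_sqr ?nnegrE ?l2norm_ge0 ?mulr_ge0 ?sqrtr_ge0// exprMn sM2.
  move: xM; rewrite ler_norml => /andP[_ ?].
  have : M * (h / 2) <= M * (1 / 2) by rewrite ler_wpM2l ?(ltW M0)//; lra.
  lra.
have xy := dotv_le (c *: (X *m b)) (X *m w).
have x0 := l2norm_ge0 (c *: (X *m b)); have y0 := l2norm_ge0 (X *m w).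
have {}xy : `|dotv (c *: (X *m b)) (X *m w)| <= 13 / 250 * h * M.
  apply: le_trans xy _.
  have -> : 13 / 250 * h * M = (13 / 10 * Num.sqrt M) * (h / 25 * Num.sqrt M).
    by rewrite -{1}sM2; field.
  exact: ler_pM.
have y2 : l2norm (X *m w) ^+ 2 <= h / 625 * M.
  have : l2norm (X *m w) ^+ 2 <= (h / 25 * Num.sqrt M) ^+ 2.
    by rewrite lerXn2r ?nnegrE// mulr_ge0 ?sqrtr_ge0// divr_ge0// ltW.
  rewrite exprMn sM2.
  have : (h / 25) ^+ 2 * M <= h / 625 * M by rewrite ler_wpM2r ?(ltW M0)//; nra.
  lra.
have y2' := sqr_ge0 (l2norm (X *m w)).
have hM0 : 0 < h * M by rewrite mulr_gt0.
move: xM xy; rewrite !ler_norml => /andP[? ?] /andP[? ?].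
by apply/andP; split; lra.
Qed.

End lasso_deterministic.

(** * The probability of the good event *)

Section entry_bounds.
Variables (R : realType) (p : nat) (A : 'M[R]_p).
Hypothesis psdA : psdmx A.

Lemma mx_entry_le_norm (i j : 'I_p) : `|A i j| <= `|A|.
Proof.
rewrite -[leRHS]/(mx_norm A) mx_normrE.
exact: (le_bigmax _ (fun ij : 'I_p * 'I_p => `|A ij.1 ij.2|) (i, j)).
Qed.

Lemma qform_basis_le_norm (j : 'I_p) : qform A (basis_vec R j) <= `|A|.
Proof. by rewrite qform_basis (le_trans (ler_norm _))// mx_entry_le_norm. Qed.

Lemma diag_le_max_eigenvalue (i : 'I_p) : A i i <= max_eigenvalue A.
Proof.
have := max_eigenvalue_ge (basis_vec R i) psdA.
rewrite -/(qform _ _) qform_basis => /le_trans; apply.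
have -> : ((basis_vec R i)^T *m basis_vec R i) 0 0 = qform 1%:M (basis_vec R i).
  by rewrite /qform mulmx1.
by rewrite qform_basis mxE eqxx mulr1.
Qed.

(** Semidefiniteness at e_i + e_j and e_i - e_j bounds |A_ij| by the mean of two diagonal
    entries. *)
Lemma norm_le_max_eigenvalue : (0 < p)%N -> `|A| <= max_eigenvalue A.
Proof.
move=> p0; have L0 : 0 <= max_eigenvalue A.
  apply: le_trans (diag_le_max_eigenvalue (Ordinal p0)).
  by rewrite -qform_basis; exact: (proj2 psdA).
have [->|] := eqVneq `|A| 0; first exact: L0.
move=> /mx_norm_neq0[[i j] AE]; rewrite -[leLHS]/(mx_norm A) AE /=.
have h s : s ^+ 2 = 1 -> - s * A i j * 2 <= A i i + A j j.
  move=> s2; have := (proj2 psdA) (basis_vec R i + s *: basis_vec R j).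
  rewrite -/(qform _ _) qformD ?(proj1 psdA)// qformZ s2 bformZr !qform_basis.
  rewrite bform_basisl /basis_vec -colE mxE; lra.
have h1 := h 1 (expr1n _ _); have h2 := h (-1) (etrans (sqrrN 1) (expr1n _ _)).
have d1 := diag_le_max_eigenvalue i; have d2 := diag_le_max_eigenvalue j.
rewrite ler_norml; apply/andP; split; lra.
Qed.

Lemma argmin_le_norm (S : {set 'I_p}) (b : 'cV[R]_p) :
  compat_argmin A S b -> S != finset.set0 -> qform A b <= `|A|.
Proof.
move=> hb /finset.set0Pn[j jS].
have gj : l1gap S (basis_vec R j) = 1.
  rewrite l1gapE (bigD1 j)//= jS basis_vecE eqxx normr1 mulr1 big1 ?addr0// => i ij.
  by rewrite basis_vecE (negbTE ij) normr0 mulr0.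
have := argmin_qform psdA hb (v := basis_vec R j); rewrite gj ler01 expr1n mulr1.
by move=> /(_ isT) h; rewrite (le_trans h)// qform_basis_le_norm.
Qed.

End entry_bounds.

Section union_bound.
Context {R : realType} {d : measure_display} {T : measurableType d}.
Variable P : probability T R.

Lemma measurable_exists (I : finType) (A : I -> set T) :
  (forall i, measurable (A i)) -> measurable [set w | exists i, A i w].
Proof.
move=> mA; have -> : [set w | exists i, A i w] = \bigcup_(i in [set: I]) A i.
  by apply/seteqP; split => w /= [k]; [exists k | move=> _; exists k].
by apply: fin_bigcup_measurable => //; exact: finite_finset.
Qed.

Lemma prob_setU_le (A B : set T) (a b : R) : measurable A -> measurable B ->
  (P A <= a%:E)%E -> (P B <= b%:E)%E -> (P (A `|` B) <= (a + b)%:E)%E.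
Proof. by move=> mA mB ha hb; rewrite EFinD (le_trans (measureU2 _ mA mB))// leeD. Qed.

Lemma dim_double_gt1 (p : nat) (S : {set 'I_p}) : S != finset.set0 -> 1 < 2 * p%:R :> R.
Proof.
move=> /finset.set0Pn[[j jp] _]; rewrite -natrM ltr1n mul2n -addnn.
by case: p S jp => // k _ _; rewrite addSn ltnS addnS.
Qed.

Lemma expRN_le_inv (x : R) : 0 < x -> expR (- x) <= x^-1.
Proof.
move=> x0; rewrite expRN lef_pV2 ?posrE ?expR_gt0//.
by apply: le_trans (expR_ge1Dx x); rewrite lerDr.
Qed.

(** It rests on 18^4 + 16 + 2 < 4000^2 / 64. *)
Lemma block_size_arith (D a c l x N : R) : 0 < N -> a * l <= x -> c * l <= x -> l <= x ->
  x <= N * (1 / 50 / 80) ^+ 2 -> D * l <= (18 ^+ 4 * a + 16 * c + 2) * l -> D * l <= N / 64.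
Proof. move=> ? ? ? ? ? ?; lra. Qed.

End union_bound.

(** * The exceptional events and their probabilities *)

Section lasso_probability.
Context {R : realType} {d : measure_display} {T : measurableType d}.
Variable P : probability T R.
Variables (n p : nat) (X : T -> 'M[R]_(n, p)) (eps : T -> 'cV[R]_n).
Variables (Sigma : 'M[R]_p) (beta0 b : 'cV[R]_p) (bhat : T -> 'cV[R]_p) (lam : R).
Local Notation S0 := (active_set beta0).
Local Notation basis_vec := (basis_vec R).
Local Notation L := (ln (2 * p%:R) : R).
Local Notation K := `|Sigma|.
Local Notation q := (qform Sigma b).
Local Notation So := (pop_support Sigma b).
Local Notation kap := (kappa2 Sigma So / #|So|%:R).
Local Notation M := (lam ^+ 2 / n%:R / q).
Hypothesis hXlaw : forall i : 'I_n, centered_gaussian P (fun w => row i (X w)) Sigma.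
Hypothesis hXind : mutually_independent P (fun i : 'I_n => sigma_mx (fun w => row i (X w))).
Hypothesis hepslaw : forall i : 'I_n, has_normal_law P (fun w => eps w i 0) 0 1.
Hypothesis hepsind :
  mutually_independent P (fun i : 'I_n => sigma_mx (fun w => row i (eps w))).
Hypothesis hXeps : independent P (sigma_mx X) (sigma_mx eps).
Hypothesis psdS : psdmx Sigma.
Hypotheses (n0 : (0 < n)%N) (lam0 : 0 < lam).
Hypothesis hbhat : forall w, lasso (X w) (X w *m beta0 + eps w) lam (bhat w).
Hypothesis S0n0 : S0 != finset.set0.
Hypothesis argmin_b : compat_argmin Sigma S0 b.
Hypothesis q0 : 0 < q.
Hypothesis hbetamin : forall j, j \in S0 ->
  Num.sg (b j 0) * b j 0 / q * (lam / n%:R) < Num.sg (b j 0) * beta0 j 0.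
Hypothesis hlam : 18 * n%:R * K * L <= lam ^+ 2.
Variables (h r : R).
Hypotheses (h01 : 0 < h <= 1) (r0 : 0 < r) (hr : 50 * (80 * r) <= h).
Hypothesis hq : K * L / (n%:R * q) <= r ^+ 2.
Hypothesis kap0 : 0 < kappa2 Sigma So.
Hypothesis hkap : K * L / (n%:R * kap) <= r ^+ 2.
Hypothesis hL : max_eigenvalue Sigma / (K * L) <= r ^+ 2.

Lemma p_gt0 : (0 < p)%N.
Proof. by have /finset.set0Pn[j _] := S0n0; exact: leq_ltn_trans (ltn_ord j). Qed.

Let nR : 0 < n%:R :> R. Proof. by rewrite ltr0n. Qed.
Let qK : q <= K. Proof. exact: argmin_le_norm psdS _ _ argmin_b S0n0. Qed.
Let K0 : 0 < K. Proof. exact: lt_le_trans q0 qK. Qed.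
Let twop : 1 < 2 * p%:R :> R. Proof. exact: dim_double_gt1 S0n0. Qed.
Let L0 : 0 < L. Proof. exact: ln_gt0. Qed.
Let expL : expR L = 2 * p%:R. Proof. by rewrite lnK// posrE (lt_trans _ twop). Qed.
Let So0 : So != finset.set0.
Proof.
have /finset.set0Pn[j jS] := S0n0; apply/finset.set0Pn; exists j.
by have /fintype.subsetP := active_sub_support psdS argmin_b q0 hbetamin; apply.
Qed.
Let kapR : 0 < kap. Proof. by rewrite divr_gt0// ltr0n card_gt0. Qed.
Let r1 : r <= 1 / 50 / 80. Proof. by have /andP[_ ?] := h01; have := hr; lra. Qed.

Lemma L_le_n : L <= r ^+ 2 * n%:R.
Proof.
have := hq; rewrite ler_pdivrMr ?mulr_gt0// => h1.
rewrite -(ler_pM2l K0); apply: le_trans h1 _.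
by rewrite mulrA [leLHS]mulrC ler_wpM2r// mulr_ge0 ?sqr_ge0 ?(ltW nR).
Qed.

(** Since the largest entry is at most the largest eigenvalue, a small ratio of the eigenvalue to K
    L forces L to be large. *)
Lemma inv_r_le_L : (r ^+ 2)^-1 <= L.
Proof.
have hKL := norm_le_max_eigenvalue psdS p_gt0.
have : K / (K * L) <= r ^+ 2.
  by apply: le_trans hL; rewrite ler_pM2r// invr_gt0 mulr_gt0.
rewrite invfM mulrA mulfV ?gt_eqF// mul1r => h1.
by rewrite -[leRHS]invrK lef_pV2 ?posrE ?invr_gt0// exprn_gt0.
Qed.

(** Vectors for polarization: they recover the deviation of the Gram matrix between e_j and [b]. The
    scalings give both summands a form of at most 1. *)
Let dev_vec (js : 'I_p * bool) : 'cV[R]_p :=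
  (Num.sqrt K)^-1 *: basis_vec js.1 + ((-1) ^+ js.2 * (Num.sqrt q)^-1) *: b.

Lemma dev_vec_qform js : qform Sigma (dev_vec js) <= 4.
Proof.
have sK : (Num.sqrt K)^-1 ^+ 2 * K = 1 by rewrite exprVn sqr_sqrtr ?(ltW K0)// mulVf// gt_eqF.
have sq : (Num.sqrt q)^-1 ^+ 2 * q = 1 by rewrite exprVn sqr_sqrtr ?(ltW q0)// mulVf// gt_eqF.
set u := (Num.sqrt K)^-1 *: basis_vec js.1.
set v := ((-1) ^+ js.2 * (Num.sqrt q)^-1) *: b.
have qu : qform Sigma u <= 1.
  rewrite qformZ -sK ler_wpM2l ?sqr_ge0//; exact: qform_basis_le_norm.
have qv : qform Sigma v = 1 by rewrite qformZ exprMn sqrr_sign mul1r.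
have : 0 <= qform Sigma (u - v) by exact: (proj2 psdS).
rewrite /dev_vec -/u -/v !qformD ?(proj1 psdS)// qformN bformNr qv; lra.
Qed.

Lemma gram_error_polarization (Y : 'M[R]_(n, p)) j (s : R) :
  (forall js, `|l2norm (Y *m dev_vec js) ^+ 2 - n%:R * qform Sigma (dev_vec js)| <= n%:R * 4 * s) ->
  `|gram_error Y Sigma b (basis_vec j)| <= 2 * n%:R * s * (Num.sqrt K * Num.sqrt q).
Proof.
move=> hs; pose G := Y^T *m Y - n%:R *: Sigma.
have symG : G^T = G by rewrite linearB linearZ/= gram_sym (proj1 psdS).
have sK : 0 < Num.sqrt K by rewrite sqrtr_gt0.
have sq : 0 < Num.sqrt q by rewrite sqrtr_gt0.
have QE u : qform G u = l2norm (Y *m u) ^+ 2 - n%:R * qform Sigma u.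
  by rewrite qformB qform_gram.
have h1 := hs (j, false); have h2 := hs (j, true); rewrite -!QE in h1 h2.
have E : 4 * ((Num.sqrt K)^-1 * (Num.sqrt q)^-1 * bform G (basis_vec j) b) =
    qform G (dev_vec (j, false)) - qform G (dev_vec (j, true)).
  rewrite /dev_vec /= expr0 expr1 mul1r mulN1r scaleNr !qformD// qformN bformNr.
  by rewrite bformZl bformZr; ring.
rewrite /gram_error -/G bformC//.
have {h1 h2}E2 : `|(Num.sqrt K)^-1 * (Num.sqrt q)^-1 * bform G (basis_vec j) b| <= 2 * n%:R * s.
  rewrite -(ler_pM2l (ltr0n R 4)) -{1}(ger0_norm (ler0n R 4)) -normrM E.
  by apply: le_trans (ler_normB _ _) _; lra.
rewrite -ler_pdivrMr ?mulr_gt0//; apply: le_trans E2.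
by rewrite normrM gtr0_norm ?mulr_gt0 ?invr_gt0// mulrC invfM.
Qed.

(** This is s^2 K for the exponential parameter s in [prob_noise]. The bound lam^2 >= 18 n K L
    allows a constant up to 18 (9/20)^2 = 3.645; beating the union over p coordinates takes more
    than 2. *)
Let y0 := 7 / 2 * (L / n%:R) : R.
(** Half of the budget (h/100) sqrt(M); the other half is for the term with [eta]. *)
Let A0 := h / 200 * Num.sqrt M : R.
(** The tail exponent n s3^2 / 8 is 2 L, one L of which pays for the 2p vectors [dev_vec]. The
    constant 8 in [eta] is what [s3] becomes after polarization and scaling. *)
Let s3 := 4 * Num.sqrt (L / n%:R) : R.
Let eta := 8 * (Num.sqrt K * Num.sqrt (L / n%:R) / Num.sqrt q) : R.
(** With two successors, dd - 1 strictly exceeds the sum, hence each of the two lower bounds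
    required by [lasso_prediction_error]. *)
Let dd := (Num.truncn (18 ^+ 4 * (K / q) + 16 * (K / kap))).+2.

Let E_sums := [set w | exists s : dd.-tuple ('I_p * bool),
  l2norm (X w *m signed_sum R s) ^+ 2 < n%:R * qform Sigma (signed_sum R s) / 2].
Let E_cols := [set w | exists j : 'I_p, n%:R * K * (1 / 2) <
  `|l2norm (X w *m basis_vec j) ^+ 2 - n%:R * qform Sigma (basis_vec j)|].
Let E_gram := [set w | exists js : 'I_p * bool, n%:R * 4 * s3 <
  `|l2norm (X w *m dev_vec js) ^+ 2 - n%:R * qform Sigma (dev_vec js)|].
Let E_b := [set w | n%:R * q * (h / 2) < `|l2norm (X w *m b) ^+ 2 - n%:R * qform Sigma b|].
Let E_noise (F : seq 'cV[R]_p) := [set w | exists j : 'I_p,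
  9 / 20 * lam < `|noise_form X eps w (residual Sigma F (basis_vec j))|].
Let E_proj (F : seq 'cV[R]_p) := [set w |
  n%:R * A0 ^+ 2 < \sum_(f <- F) noise_form X eps w f ^+ 2].

Let mnorm u c : measurable [set w | c < `|l2norm (X w *m u) ^+ 2 - n%:R * qform Sigma u|].
Proof.
apply: measurable_gt; apply: measurableT_comp => //; apply: measurable_funB => //.
exact: measurable_design_norm hXlaw u.
Qed.

Let Ln1 : L / n%:R <= r ^+ 2.
Proof. by rewrite ler_pdivrMr// L_le_n. Qed.

Let Ln0 : 0 < L / n%:R. Proof. exact: divr_gt0. Qed.

Let dd_gt : 18 ^+ 4 * (K / q) + 16 * (K / kap) < dd%:R - 1 :> R.
Proof.
have -> : dd%:R = (Num.truncn (18 ^+ 4 * (K / q) + 16 * (K / kap))).+1%:R + 1 :> R by rewrite natr1.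
by rewrite addrK; exact: truncnS_gt.
Qed.

Let dd_le : dd%:R * L <= n%:R / 64.
Proof.
have y_ge0 : 0 <= 18 ^+ 4 * (K / q) + 16 * (K / kap).
  apply: addr_ge0; apply: mulr_ge0.
  - by apply: exprn_ge0; exact: ler0n.
  - by rewrite divr_ge0 ?(ltW K0) ?(ltW q0).
  - exact: ler0n.
  - by rewrite divr_ge0 ?(ltW K0) ?(ltW kapR).
have h1 : dd%:R <= 18 ^+ 4 * (K / q) + 16 * (K / kap) + 2.
  have -> : dd%:R = (Num.truncn (18 ^+ 4 * (K / q) + 16 * (K / kap)))%:R + 2 :> R.
    by rewrite /dd -addn2 natrD.
  by rewrite lerD2r truncn_le.
have e k : 0 < k -> K / k * L = n%:R * (K * L / (n%:R * k)).
  by move=> k0; field; rewrite !gt_eqF.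
have k1 : K / q * L <= n%:R * r ^+ 2 by rewrite e// ler_wpM2l// ltW.
have k2 : K / kap * L <= n%:R * r ^+ 2 by rewrite e// ler_wpM2l// ltW.
have k3 := L_le_n.
have r2 : r ^+ 2 <= (1 / 50 / 80) ^+ 2 by rewrite lerXn2r ?nnegrE ?(ltW r0)//; have := r1; lra.
have k4 : n%:R * r ^+ 2 <= n%:R * (1 / 50 / 80) ^+ 2 by rewrite ler_wpM2l// ltW.
have k5 := ler_wpM2r (ltW L0) h1.
by apply: block_size_arith nR k1 k2 _ k4 k5; rewrite [leRHS]mulrC.
Qed.

Lemma prob_sums : measurable E_sums /\ (P E_sums <= (64 / n%:R)%:E)%E.
Proof.
have m1 s : measurable [set w | l2norm (X w *m signed_sum R (s : dd.-tuple ('I_p * bool))) ^+ 2 <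
    n%:R * qform Sigma (signed_sum R s) / 2].
  have -> : [set w | l2norm (X w *m signed_sum R s) ^+ 2 < n%:R * qform Sigma (signed_sum R s) / 2] =
      [set w | - (n%:R * qform Sigma (signed_sum R s) / 2) < - l2norm (X w *m signed_sum R s) ^+ 2].
    by apply/seteqP; split => w /=; rewrite ltrN2.
  apply: measurable_gt; apply: measurableT_comp => //; exact: (measurable_design_norm hXlaw).
split; first exact: measurable_exists.
apply: le_trans (prob_exists_le m1 (fun s => design_lower_tail hXlaw hXind psdS _)) _.
rewrite lee_fin card_tuple card_prod card_ord card_bool natrX natrM mulrC [_ * 2]mulrC -expL.
rewrite -expRM_natl -expRD.
have n64 : 0 < n%:R / 64 :> R by rewrite divr_gt0.
have -> : 64 / n%:R = (n%:R / 64)^-1 :> R by rewrite invf_div.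
apply: (le_trans _ (expRN_le_inv n64)).
rewrite ler_expR; have := dd_le; lra.
Qed.

Lemma prob_cols : measurable E_cols /\ (P E_cols <= (64 / n%:R)%:E)%E.
Proof.
have m1 (j : 'I_p) : measurable [set w | n%:R * K * (1 / 2) <
  `|l2norm (X w *m basis_vec j) ^+ 2 - n%:R * qform Sigma (basis_vec j)|] by exact: mnorm.
split; first exact: measurable_exists.
have half : 0 <= (1 / 2 : R) <= 1 / 2 by apply/andP; split; lra.
apply: le_trans (prob_exists_le m1 (fun j => @design_deviation _ _ _ P _ _ X _ hXlaw hXind psdS
   (basis_vec j) K (1 / 2) K0 (qform_basis_le_norm _ _) half)) _.
rewrite lee_fin card_ord mulrA [p%:R * 2]mulrC -{1}expL -expRD.
have n64 : 0 < n%:R / 64 :> R by rewrite divr_gt0.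
have -> : 64 / n%:R = (n%:R / 64)^-1 :> R by rewrite invf_div.
apply: (le_trans _ (expRN_le_inv n64)).
rewrite ler_expR; have := dd_le.
have : L <= dd%:R * L by rewrite ler_peMl ?(ltW L0)// ler1n.
lra.
Qed.

Lemma prob_gram : measurable E_gram /\ (P E_gram <= (2 / L)%:E)%E.
Proof.
have m1 (js : 'I_p * bool) : measurable [set w | n%:R * 4 * s3 <
  `|l2norm (X w *m dev_vec js) ^+ 2 - n%:R * qform Sigma (dev_vec js)|] by exact: mnorm.
split; first exact: measurable_exists.
have sLn : Num.sqrt (L / n%:R) <= r.
  by rewrite -(ger0_norm (ltW r0)) -sqrtr_sqr ler_wsqrtr.
have s3b : 0 <= s3 <= 1 / 2.
  apply/andP; split; first by rewrite mulr_ge0// sqrtr_ge0.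
  by rewrite /s3; have := r1; lra.
apply: le_trans (prob_exists_le m1 (fun js => @design_deviation _ _ _ P _ _ X _ hXlaw hXind psdS
   (dev_vec js) 4 s3 (ltr0n R 4) (dev_vec_qform js) s3b)) _.
rewrite lee_fin card_prod card_ord card_bool natrM [p%:R * 2]mulrC -{1}expL.
have -> : n%:R * s3 ^+ 2 / 8 = 2 * L.
  by rewrite /s3 exprMn sqr_sqrtr ?(ltW Ln0)//; field; rewrite gt_eqF.
rewrite mulrCA -expRD ler_wpM2l//.
apply: (le_trans _ (expRN_le_inv L0)); rewrite ler_expR; have := L0; lra.
Qed.

Lemma prob_b : measurable E_b /\ (P E_b <= (64 / (n%:R * h ^+ 2))%:E)%E.
Proof.
have /andP[h0 h1] := h01.
split; first exact: mnorm.
have hb : 0 <= h / 2 <= 1 / 2 by apply/andP; split; lra.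
apply: le_trans (@design_deviation _ _ _ P _ _ X _ hXlaw hXind psdS b q (h / 2) q0 (lexx _) hb) _.
rewrite lee_fin.
have x0 : 0 < n%:R * h ^+ 2 / 32 by rewrite divr_gt0 ?mulr_gt0 ?exprn_gt0.
have := expRN_le_inv x0.
have -> : n%:R * (h / 2) ^+ 2 / 8 = n%:R * h ^+ 2 / 32 by field.
have -> : (n%:R * h ^+ 2 / 32)^-1 = 32 / (n%:R * h ^+ 2) by rewrite invfM invrK mulrC.
lra.
Qed.

Lemma prob_noise F : orthonormal_seq Sigma F ->
  measurable (E_noise F) /\ (P (E_noise F) <= (2 / L)%:E)%E.
Proof.
move=> Fo.
have m1 (j : 'I_p) : measurable [set w | 9 / 20 * lam <
    `|noise_form X eps w (residual Sigma F (basis_vec j))|].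
  apply: measurable_gt; apply: measurableT_comp => //.
  exact: (measurable_noise_form hXlaw hepslaw).
split; first exact: measurable_exists.
have y0_gt0 : 0 < y0 by apply: mulr_gt0; [lra | exact: Ln0].
have y0_le : y0 <= 1 / 40.
  have r2 : r ^+ 2 <= (1 / 50 / 80) ^+ 2 by rewrite lerXn2r ?nnegrE ?(ltW r0)//; have := r1; lra.
  rewrite /y0; have := Ln1; lra.
pose s := Num.sqrt (y0 / K).
have s0 : 0 <= s by exact: sqrtr_ge0.
have sK : s ^+ 2 * K = y0 by rewrite sqr_sqrtr ?divr_ge0 ?(ltW y0_gt0) ?(ltW K0)// divfK// gt_eqF.
have sK4 : s ^+ 2 * K <= 1 / 4 by rewrite sK; lra.
have res_le j : qform Sigma (residual Sigma F (basis_vec j)) <= K.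
  by apply: le_trans (residual_le _ Fo) _; exact: qform_basis_le_norm.
apply: le_trans (prob_exists_le m1 (fun j => @noise_tail _ _ _ P _ _ X eps _ hXlaw hXind hepslaw
  hepsind hXeps psdS _ s K (9 / 20 * lam) (res_le j) s0 sK4)) _.
rewrite lee_fin card_ord mulrA [p%:R * 2]mulrC -{1}expL -expRD sK.
have ny : n%:R * y0 = 7 / 2 * L by rewrite /y0; field; rewrite gt_eqF.
have sx : n%:R * y0 <= s * (9 / 20 * lam).
  rewrite -ler_sqr ?nnegrE ?mulr_ge0 ?(ltW lam0) ?(ltW y0_gt0) ?(ltW L0)//.
  have -> : (s * (9 / 20 * lam)) ^+ 2 = s ^+ 2 * (81 / 400) * lam ^+ 2 by field.
  have s2 := sqr_ge0 s.
  apply: le_trans (_ : _ <= s ^+ 2 * (81 / 400) * (18 * n%:R * K * L)) _; last first.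
    by apply: ler_wpM2l; [apply: mulr_ge0; [exact: s2 | lra] | exact: hlam].
  have -> : s ^+ 2 * (81 / 400) * (18 * n%:R * K * L) =
      (s ^+ 2 * K) * n%:R * (18 * 81 / 400 * L) by field.
  have -> : (n%:R * y0) ^+ 2 = y0 * n%:R * (n%:R * y0) by ring.
  rewrite sK; apply: ler_wpM2l; first by apply: mulr_ge0; rewrite ?(ltW y0_gt0) ?(ltW nR).
  rewrite ny; have := L0; lra.
have Lh : 0 < L / 2 by rewrite divr_gt0.
have inv_Lh : (L / 2)^-1 = 2 / L by rewrite invf_div.
rewrite -inv_Lh; apply: (le_trans _ (expRN_le_inv Lh)); rewrite ler_expR.
have -> : n%:R * (y0 / 2 + y0 ^+ 2 / 2) = n%:R * y0 * (1 + y0) / 2 by field.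
have : n%:R * y0 * (1 + y0) <= n%:R * y0 * (41 / 40).
  by rewrite ler_wpM2l ?mulr_ge0 ?(ltW y0_gt0)//; lra.
move: sx; rewrite ny; have := L0; lra.
Qed.

(** A single event, so a second moment is enough: the expectation is at most 32 n |So|. From |So| q
    <= 4 r^2 K L and lam^2 >= 18 n K L, this is a multiple of (r/h)^2 times n A0^2. *)
Lemma prob_proj F : orthonormal_seq Sigma F -> (size F <= #|So|)%N ->
  measurable (E_proj F) /\ (P (E_proj F) <= (512 * 600 * (r / h) ^+ 2)%:E)%E.
Proof.
move=> Fo sF; have /andP[h0 h1] := h01.
have mN f : measurable_fun [set: T] (fun w => noise_form X eps w f ^+ 2).
  by apply: measurable_funX; exact: (measurable_noise_form hXlaw hepslaw).
have mS : measurable_fun [set: T] (fun w => \sum_(f <- F) noise_form X eps w f ^+ 2).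
  by apply: measurable_sum => f; exact: mN.
split; first exact: measurable_gt.
have M0 : 0 < M by rewrite !divr_gt0// exprn_gt0.
have A2 : A0 ^+ 2 = h ^+ 2 / (200 * 200) * M.
  by rewrite /A0 exprMn (sqr_sqrtr (ltW M0)) expr_div_n (expr2 200).
have c200 : 0 < 200 * 200 :> R by apply: mulr_gt0; exact: ltr0n.
have A2_gt0 : 0 < A0 ^+ 2.
  by rewrite A2; apply: mulr_gt0 (divr_gt0 _ c200) M0; exact: exprn_gt0.
have a0 : 0 < n%:R * A0 ^+ 2 by rewrite mulr_gt0.
apply: (@le_trans _ _ (\int[P]_w ((n%:R * A0 ^+ 2)^-1%:E * (\sum_(f <- F) noise_form X eps w f ^+
  2)%:E))%E).
  under eq_integral do rewrite -EFinM.
  apply: prob_le_integral.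
  - exact: measurable_gt.
  - exact: measurable_funM.
  - by move=> w; rewrite mulr_ge0 ?invr_ge0 ?(ltW a0)// sumr_ge0// => f _; exact: sqr_ge0.
  - by move=> w /= hw; rewrite mulrC ler_pdivlMr// mul1r ltW.
rewrite ge0_integralZl_EFin//; last 3 first.
- by move=> w _; rewrite lee_fin sumr_ge0// => f _; exact: sqr_ge0.
- exact/measurable_EFinP.
- by rewrite invr_ge0 ltW.
have int_le : (\int[P]_w (\sum_(f <- F) noise_form X eps w f ^+ 2)%:E <= (#|So|%:R * (32 * n%:R))%:E)%E.
  under eq_integral do rewrite -sumEFin.
  rewrite ge0_integral_sum//; last 2 first.
  - by move=> f; apply/measurable_EFinP; exact: mN.
  - by move=> f w _; rewrite lee_fin sqr_ge0.
  apply: (@le_trans _ _ (\sum_(f <- F) (32 * n%:R)%:E)%E).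
    rewrite big_seq [leRHS]big_seq; apply: lee_sum => f fF.
    apply: (noise_second_moment hXlaw hXind hepslaw hepsind hXeps psdS n0).
    exact: (orthonormal_qform psdS Fo fF).
  rewrite sumEFin lee_fin big_const_seq count_predT iter_addr_0 -[leLHS]mulr_natl.
  by rewrite ler_wpM2r ?mulr_ge0// ler_nat.
apply: le_trans (lee_wpmul2l _ int_le) _; first by rewrite lee_fin invr_ge0 ltW.
rewrite -EFinM lee_fin A2.
have card_le : #|So|%:R * q <= 4 * max_eigenvalue Sigma by exact: card_pop_support psdS q0.
have eig_le : max_eigenvalue Sigma <= r ^+ 2 * (K * L) by rewrite -ler_pdivrMr ?mulr_gt0//; exact: hL.
have lam2 : 0 < lam ^+ 2 by rewrite exprn_gt0.
have -> : (n%:R * (h ^+ 2 / (200 * 200) * M))^-1 * (#|So|%:R * (32 * n%:R)) =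
    32 * (200 * 200) * ((#|So|%:R * q) * n%:R / lam ^+ 2) / h ^+ 2.
  by field; rewrite !gt_eqF.
have k1 : #|So|%:R * q * n%:R / lam ^+ 2 <= 4 / 18 * r ^+ 2.
  rewrite ler_pdivrMr//.
  have : 4 / 18 * r ^+ 2 * (18 * n%:R * K * L) <= 4 / 18 * r ^+ 2 * lam ^+ 2.
    by rewrite ler_wpM2l// mulr_ge0 ?sqr_ge0// divr_ge0.
  have : #|So|%:R * q * n%:R <= 4 * (r ^+ 2 * (K * L)) * n%:R.
    by rewrite ler_wpM2r ?(ltW nR)//; lra.
  lra.
rewrite expr_div_n [leRHS]mulrA ler_pM2r ?invr_gt0 ?exprn_gt0//.
have : 32 * (200 * 200) * (#|So|%:R * q * n%:R / lam ^+ 2) <= 32 * (200 * 200) * (4 / 18 * r ^+ 2).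
  apply: ler_wpM2l k1; apply: mulr_ge0 (ler0n R 32) (ltW c200).
have := sqr_ge0 r; lra.
Qed.

Hypothesis bhat_meas : random_mx bhat.

Lemma measurable_prediction_error :
  measurable_fun [set: T] (fun w => l2norm (X w *m (bhat w - beta0)) ^+ 2).
Proof.
under eq_fun do rewrite l2norm_sqr.
apply: measurable_sum => i; apply: measurable_funX.
under eq_fun do rewrite mxE.
apply: measurable_sum => j; apply: measurable_funM.
  exact: (design_measurable hXlaw).
under eq_fun do rewrite !mxE.
by apply: measurable_funB => //; exact: bhat_meas.
Qed.

Lemma prob_prediction_error :
  (P [set w | (h * M < `|l2norm (X w *m (bhat w - beta0)) ^+ 2 - M|)%R] <=
    (10 ^+ 6 * (r / h) ^+ 2)%:E)%E.
Proof.
have /andP[h0 h1] := h01.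
(* [F] depends on [Sigma] and the population support only and is thus not random, as the moment
   bounds for eps^T X f require. *)
have [F [sF Fo Fj Fi]] := gram_schmidt psdS (enum So).
rewrite -cardE in sF.
have Fres j : j \in So -> residual Sigma F (basis_vec j) = 0.
  move=> jS; apply: (residual_support psdS kap0 Fi) => //.
  by apply: Fj; rewrite mem_enum.
have scale_gt0 : 0 < pop_scale n Sigma b lam by rewrite divr_gt0// mulr_gt0.
have sqrt_ratio (k : R) : 0 < k -> K * L / (n%:R * k) <= r ^+ 2 ->
    Num.sqrt K * Num.sqrt (L / n%:R) / Num.sqrt k <= r.
  move=> k0 hk; rewrite -[leRHS](ger0_norm (ltW r0)) -[leRHS]sqrtr_sqr.
  rewrite -sqrtrM ?(ltW K0)// -sqrtrV ?(ltW k0)// -sqrtrM ?mulr_ge0 ?(ltW K0) ?(ltW Ln0) ?(ltW L0)//.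
  by apply: ler_wsqrtr; rewrite mulrA -mulrA -invfM.
have eta01 : 0 <= eta <= 1 / 80.
  apply/andP; split.
    by rewrite mulr_ge0// divr_ge0 ?mulr_ge0 ?sqrtr_ge0.
  rewrite /eta; have := sqrt_ratio _ q0 hq; have := r1; lra.
have [m1 p1] := prob_sums; have [m2 p2] := prob_cols; have [m3 p3] := prob_gram.
have [m4 p4] := prob_b; have [m5 p5] := prob_noise Fo; have [m6 p6] := prob_proj Fo sF.
have incl : [set w | h * M < `|l2norm (X w *m (bhat w - beta0)) ^+ 2 - M|] `<=`
    E_sums `|` E_cols `|` E_gram `|` E_b `|` E_noise F `|` E_proj F.
  move=> w /= bad; apply: contrapT => good.
  have {good}[g1 [g2 [g3 [g4 [g5 g6]]]]] :
      ~ E_sums w /\ ~ E_cols w /\ ~ E_gram w /\ ~ E_b w /\ ~ E_noise F w /\ ~ E_proj F w.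
    by tauto.
  move: bad; apply/negP; rewrite -leNgt.
  apply: (lasso_prediction_error psdS argmin_b n0 lam0 q0 hbetamin (hbhat w) (K := K) (eta := eta)
    (A0 := A0) (d := dd) kap0 So0 K0 eta01) => //.
  - by rewrite mulr_ge0 ?sqrtr_ge0 ?divr_ge0 ?(ltW h0).
  - by move=> s; rewrite leNgt; apply/negP => bad; apply: g1; exists s.
  - move=> j; have : ~ (n%:R * K * (1 / 2) <
        `|l2norm (X w *m basis_vec j) ^+ 2 - n%:R * qform Sigma (basis_vec j)|).
      by move=> bad; apply: g2; exists j.
    move/negP; rewrite -leNgt => /ler_normlW.
    have := ler_wpM2l (ltW nR) (qform_basis_le_norm Sigma j).
    move: (l2norm _ ^+ 2) (n%:R * qform _ _) => x y; rewrite -[2 * _ * _]mulrA.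
    have : 0 < n%:R * K by exact: mulr_gt0.
    move: (n%:R * K) => z; lra.
  - move=> j.
    have : `|gram_error (X w) Sigma b (basis_vec j)| <= 2 * n%:R * s3 * (Num.sqrt K * Num.sqrt q).
      apply: gram_error_polarization => js; rewrite leNgt; apply/negP => bad.
      by apply: g3; exists js.
    move=> /(ler_wpM2l (ltW scale_gt0)) /le_trans; apply; rewrite le_eqVlt; apply/orP; left.
    rewrite /pop_scale /eta /s3 -{1}(sqr_sqrtr (ltW q0)).
    have : 0 < Num.sqrt q by rewrite sqrtr_gt0.
    move: (Num.sqrt q) (Num.sqrt K) (Num.sqrt (L / n%:R)) => x y z x0.
    by apply/eqP; field; rewrite !gt_eqF.
  - exists F; split => //.
    + move=> j; rewrite leNgt; apply/negP => bad; apply: g5; exists j.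
      by rewrite /= /noise_form.
    + by rewrite leNgt; apply/negP => bad; apply: g6.
  - rewrite -ler_pdivrMr// -mulrA; apply: le_trans (ltW dd_gt); rewrite lerDr.
    apply: mulr_ge0; first exact: exprn_ge0 (ler0n R 18).
    by rewrite divr_ge0 ?(ltW K0) ?(ltW q0).
  - rewrite -ler_pdivrMr// -mulrA; apply: le_trans (ltW dd_gt); rewrite lerDl.
    by rewrite mulr_ge0// divr_ge0 ?(ltW K0) ?(ltW kapR).
  - by rewrite leNgt; apply/negP => bad; apply: g4.
  - have sM : Num.sqrt M = lam / Num.sqrt n%:R / Num.sqrt q.
      rewrite sqrtrM ?divr_ge0 ?sqr_ge0// sqrtrM ?sqr_ge0// sqrtr_sqr gtr0_norm//.
      by rewrite !sqrtrV ?(ltW nR) ?(ltW q0).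
    have -> : lam * eta / (Num.sqrt n%:R * Num.sqrt kap) =
        8 * (Num.sqrt K * Num.sqrt (L / n%:R) / Num.sqrt kap) * Num.sqrt M.
      rewrite sM /eta.
      have : 0 < Num.sqrt q by rewrite sqrtr_gt0.
      have : 0 < Num.sqrt kap by rewrite sqrtr_gt0.
      have : 0 < Num.sqrt n%:R :> R by rewrite sqrtr_gt0.
      move: (Num.sqrt q) (Num.sqrt K) (Num.sqrt (L / n%:R)) (Num.sqrt kap) (Num.sqrt n%:R).
      by move=> x1 x2 x3 x4 x5 ? ? ?; field; rewrite !gt_eqF.
    have M0 : 0 <= Num.sqrt M by exact: sqrtr_ge0.
    have := ler_wpM2r M0 (sqrt_ratio _ kapR hkap); have := ler_wpM2r M0 hr.
    have := mulr_ge0 (ltW h0) M0; rewrite /A0.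
    by move: (Num.sqrt M) (_ / Num.sqrt kap) => m x; lra.
apply: (@le_trans _ _ (P (E_sums `|` E_cols `|` E_gram `|` E_b `|` E_noise F `|` E_proj F))).
  apply: le_measure => //; rewrite inE; last by do 5?apply: measurableU.
  apply: measurable_gt; apply: measurableT_comp => //; apply: measurable_funB => //.
  exact: measurable_prediction_error.
have P12 := prob_setU_le m1 m2 p1 p2; have m12 := measurableU _ _ m1 m2.
have P13 := prob_setU_le m12 m3 P12 p3; have m13 := measurableU _ _ m12 m3.
have P14 := prob_setU_le m13 m4 P13 p4; have m14 := measurableU _ _ m13 m4.
have P15 := prob_setU_le m14 m5 P14 p5; have m15 := measurableU _ _ m14 m5.
apply: le_trans (prob_setU_le m15 m6 P15 p6) _; rewrite lee_fin.
have r20 : 0 < r ^+ 2 by rewrite exprn_gt0.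
have invL : L^-1 <= r ^+ 2.
  by rewrite -[leRHS]invrK lef_pV2 ?posrE ?invr_gt0//; exact: inv_r_le_L.
(* The product of 1 / L <= r^2 and L / n <= r^2. *)
have invn : n%:R^-1 <= r ^+ 2 * r ^+ 2.
  have := L_le_n; rewrite -ler_pdivrMr// => h2.
  have : L^-1 * (L / n%:R) <= r ^+ 2 * r ^+ 2 by apply: ler_pM => //; rewrite ?invr_ge0 ltW.
  by rewrite mulrA mulVf ?mul1r// gt_eqF.
have rle1 : r ^+ 2 <= 1 by rewrite expr_le1 ?(ltW r0)//; have := r1; lra.
have hV : 1 <= (h ^+ 2)^-1 by rewrite invf_ge1 ?exprn_gt0// expr_le1 ?(ltW h0).
have r2h : r ^+ 2 <= (r / h) ^+ 2 by rewrite expr_div_n ler_peMr// ltW.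
have n2 : n%:R^-1 <= r ^+ 2 by apply: le_trans invn _; rewrite ler_piMl// ltW.
have n3 : (n%:R * h ^+ 2)^-1 <= (r / h) ^+ 2.
  by rewrite expr_div_n invfM ler_pM2r ?invr_gt0 ?exprn_gt0.
have e0 := sqr_ge0 (r / h).
move: r2h n2 n3 invL e0; move: ((r / h) ^+ 2) (n%:R^-1) (L^-1) ((n%:R * h ^+ 2)^-1) (r ^+ 2).
move=> x1 x2 x3 x4 x5 ? ? ? ? ?; lra.
Qed.

End lasso_probability.

(** * Asymptotics *)

Section limits.
Context {R : realType}.

Definition rv_of_measurable {d : measure_display} {T : measurableType d} (P : probability T R) (f
  : T -> R)
  (mf : measurable_fun [set: T] f) : {RV P >-> R} :=
  HB.pack_for {RV P >-> R} f (isMeasurableFun.Build _ _ _ _ f mf).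

Lemma cvge0_near (f : nat -> \bar R) :
  (forall n, 0 <= f n)%E -> (forall n, f n \is a fin_num) ->
  (forall c, 0 < c -> \forall n \near \oo, (f n <= c%:E)%E) -> f n @[n --> \oo] --> 0%E.
Proof.
move=> f0 ffin hf; apply/fine_cvgP; split; first by near=> n; exact: ffin.
apply/cvgrPdist_le => c c0; near=> n.
rewrite /= sub0r normrN ger0_norm ?fine_ge0// -lee_fin fineK//.
by near: n; exact: hf.
Unshelve. all: by end_near. Qed.

Lemma max_compat_ratio_le (n p : nat) (Sigma : 'M[R]_p) (S0 S : {set 'I_p}) (c : R) :
  psdmx Sigma -> (0 < n)%N -> 0 < `|Sigma| -> 0 < ln (2 * p%:R) :> R ->
  S != finset.set0 ->
  #|S|%:R <= max_eigenvalue Sigma / kappa2 Sigma S0 * (4 * #|S0|%:R) ->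
  (max_compat_ratio n Sigma S0 <= c%:E)%E ->
  0 < kappa2 Sigma S /\ `|Sigma| * ln (2 * p%:R) / (n%:R * (kappa2 Sigma S / #|S|%:R)) <= c.
Proof.
move=> psdS n0 K0 L0 Sn0 hS /(le_trans (le_bigmax_cond _ _ _)) h.
have := h S; rewrite Sn0 hS => /(_ isT) {h}.
have S_gt0 : 0 < #|S|%:R :> R by rewrite ltr0n card_gt0.
have x0 : 0 < ln (2 * p%:R) * #|S|%:R / n%:R :> R by rewrite divr_gt0 ?ltr0n// mulr_gt0.
rewrite inver; have := kappa2_ge0 Sigma S; rewrite le_eqVlt => /orP[/eqP <-|k0].
  (* A vanishing constant would make the ratio +oo, against the finite bound; this is the source of
     positivity for the population support. *)
  by rewrite eqxx gt0_muley ?lte_fin// gt0_mulye ?lte_fin.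
rewrite gt_eqF// -!EFinM lee_fin => h; split => //; apply: le_trans h.
rewrite le_eqVlt; apply/orP; left; apply/eqP; move: (kappa2 Sigma S) k0 => k k0; field.
by rewrite (gt_eqF k0) (gt_eqF S_gt0) gt_eqF ?ltr0n.
Qed.

End limits.

(** * The estimate at a fixed sample size *)

Section one_sample_size.
Context {R : realType} {d : measure_display} {T : measurableType d}.
Variable P : probability T R.
Variables (n p : nat) (X : T -> 'M[R]_(n, p)) (eps : T -> 'cV[R]_n).
Variables (Sigma : 'M[R]_p) (beta0 b : 'cV[R]_p) (bhat : T -> 'cV[R]_p) (lam t : R).
Local Notation S0 := (active_set beta0).
Local Notation q := (l2norm (sqrtmx Sigma *m b) ^+ 2).
Local Notation M := (lam ^+ 2 / n%:R / q).
Local Notation L := (ln (2 * p%:R) : R).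
Hypothesis hXlaw : forall i : 'I_n, centered_gaussian P (fun w => row i (X w)) Sigma.
Hypothesis hXind : mutually_independent P (fun i : 'I_n => sigma_mx (fun w => row i (X w))).
Hypothesis hepslaw : forall i : 'I_n, has_normal_law P (fun w => eps w i 0) 0 1.
Hypothesis hepsind :
  mutually_independent P (fun i : 'I_n => sigma_mx (fun w => row i (eps w))).
Hypothesis hXeps : independent P (sigma_mx X) (sigma_mx eps).
Hypothesis psdS : psdmx Sigma.
Hypotheses (n0 : (0 < n)%N) (lam0 : 0 < lam).
Hypothesis bhat_meas : random_mx bhat.
Hypothesis hbhat : forall w, lasso (X w) (X w *m beta0 + eps w) lam (bhat w).
Hypothesis S0n0 : S0 != finset.set0.
Hypothesis kappa0 : 0 < kappa2 Sigma S0.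
Hypothesis t0 : 0 < t.
Hypothesis hlam : 3 * Num.sqrt `|Sigma| *
  (Num.sqrt (2 * n%:R * (L + t)) + 2 * (L + t)) <= lam.
Hypothesis argmin_b : compat_argmin Sigma S0 b.
Hypothesis hbetamin : forall j, j \in S0 ->
  Num.sg (b j 0) * b j 0 / q * (lam / n%:R) < Num.sg (b j 0) * beta0 j 0.

Lemma argmin_norm_gt0 : 0 < q.
Proof.
have := kappa0; rewrite -(kappa2_argmin psdS argmin_b) l2norm_sqrtmx// pmulr_rgt0//.
by rewrite ltr0n card_gt0.
Qed.

(** Compatibility is used at two sets: the active set, where kappa2 / s0 = q, and the population
    support, whose size is at most 4 Lambda / q. The former is admissible as a subset of the
    latter. *)
Lemma prob_relative_error (h r : R) : 0 < h <= 1 -> 0 < r -> 50 * (80 * r) <= h ->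
  max_eigenvalue Sigma / `|Sigma| <= r ^+ 2 * L ->
  (max_compat_ratio n Sigma S0 <= (r ^+ 2)%:E)%E ->
  (P [set w | (h < `|l2norm (X w *m (bhat w - beta0)) ^+ 2 / M - 1|)%R] <=
    (10 ^+ 6 * (r / h) ^+ 2)%:E)%E.
Proof.
move=> h01 r0 hr hL hmax.
have qE : q = qform Sigma b by rewrite l2norm_sqrtmx.
have q0 := argmin_norm_gt0; have nR : 0 < n%:R :> R by rewrite ltr0n.
have M0 : 0 < M by rewrite !divr_gt0// exprn_gt0.
have K0 : 0 < `|Sigma|.
  by apply: lt_le_trans q0 _; rewrite qE; exact: argmin_le_norm psdS _ _ argmin_b S0n0.
have L0 : 0 < L by rewrite ln_gt0//; exact: dim_double_gt1 S0n0.
have hbm j : j \in S0 ->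
    Num.sg (b j 0) * b j 0 / qform Sigma b * (lam / n%:R) < Num.sg (b j 0) * beta0 j 0.
  by rewrite -qE; exact: hbetamin.
have q0' : 0 < qform Sigma b by rewrite -qE.
set So := pop_support Sigma b.
have S0So : S0 \subset So := active_sub_support psdS argmin_b q0' hbm.
have s0 : 0 < #|S0|%:R :> R by rewrite ltr0n card_gt0.
have So0 : So != finset.set0.
  have /finset.set0Pn[j jS] := S0n0; apply/finset.set0Pn; exists j.
  by have /fintype.subsetP := S0So; apply.
have Socard : #|So|%:R <= max_eigenvalue Sigma / kappa2 Sigma S0 * (4 * #|S0|%:R).
  rewrite -(kappa2_argmin psdS argmin_b).
  have := card_pop_support psdS q0'; rewrite -/So -ler_pdivlMr// => /le_trans; apply.
  by rewrite le_eqVlt; apply/orP; left; apply/eqP; field; rewrite !gt_eqF.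
have S0card : #|S0|%:R <= max_eigenvalue Sigma / kappa2 Sigma S0 * (4 * #|S0|%:R).
  by apply: le_trans Socard; rewrite ler_nat subset_leq_card.
have [_ hq] := max_compat_ratio_le psdS n0 K0 L0 S0n0 S0card hmax.
have [kap0 hkap] := max_compat_ratio_le psdS n0 K0 L0 So0 Socard hmax.
(* The constant is 3^2 * 2, from squaring the square-root part of the lower bound on [lam]. *)
have hlam2 : 18 * n%:R * `|Sigma| * L <= lam ^+ 2.
  have : 3 * Num.sqrt `|Sigma| * Num.sqrt (2 * n%:R * L) <= lam.
    apply: le_trans hlam; rewrite ler_wpM2l ?mulr_ge0 ?sqrtr_ge0//.
    apply: (@le_trans _ _ (Num.sqrt (2 * n%:R * (L + t)))).
      by rewrite ler_wsqrtr// ler_wpM2l ?mulr_ge0 ?(ltW nR)// lerDl ltW.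
    by rewrite lerDl mulr_ge0// addr_ge0 ?(ltW L0) ?(ltW t0).
  rewrite -ler_sqr ?nnegrE ?mulr_ge0 ?sqrtr_ge0 ?(ltW lam0)//; apply: le_trans.
  rewrite !exprMn !sqr_sqrtr ?mulr_ge0 ?(ltW nR) ?(ltW K0) ?(ltW L0)//.
  by rewrite le_eqVlt; apply/orP; left; apply/eqP; ring.
have -> : [set w | h < `|l2norm (X w *m (bhat w - beta0)) ^+ 2 / M - 1|] =
    [set w | h * (lam ^+ 2 / n%:R / qform Sigma b) <
      `|l2norm (X w *m (bhat w - beta0)) ^+ 2 - lam ^+ 2 / n%:R / qform Sigma b|].
  have ratio x : (h < `|x / M - 1|) = (h * M < `|x - M|).
    have -> : x - M = (x / M - 1) * M by rewrite mulrBl divfK ?gt_eqF// mul1r.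
    by rewrite normrM (gtr0_norm M0) ltr_pM2r.
  by rewrite -qE; apply/seteqP; split => w /=; rewrite ratio.
apply: (prob_prediction_error hXlaw hXind hepslaw hepsind hXeps psdS n0 lam0 hbhat S0n0
  argmin_b q0' hbm hlam2 h01 r0 hr _ kap0 hkap) => //.
- move: hq; rewrite -(kappa2_argmin psdS argmin_b).
  by have -> : #|S0|%:R * qform Sigma b / #|S0|%:R = qform Sigma b by field; rewrite gt_eqF.
- by rewrite invfM mulrA ler_pdivrMr.
Qed.

End one_sample_size.

Theorem theorem1p1 (R : realType)
    (d : nat -> measure_display)
    (Omega : forall n, measurableType (d n))
    (P : forall n, probability (Omega n) R)
    (p : nat -> nat)
    (Sigma0 : forall n, 'M[R]_(p n))
    (beta0 : forall n, 'cV[R]_(p n))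
    (lambda : nat -> R)
    (X : forall n, Omega n -> 'M[R]_(n, p n))
    (eps : forall n, Omega n -> 'cV[R]_n)
    (betahat : forall n, Omega n -> 'cV[R]_(p n))
    (bstar : forall n, 'cV[R]_(p n))
    (t : R)
    (hSigma : forall n, (0 < n)%N -> psdmx (Sigma0 n))
    (hXlaw : forall n (i : 'I_n),
      centered_gaussian (P n) (fun w => row i (X n w)) (Sigma0 n))
    (hXind : forall n,
      mutually_independent (P n) (fun i : 'I_n =>
        sigma_mx (fun w => row i (X n w))))
    (hepslaw : forall n (i : 'I_n),
      has_normal_law (P n) (fun w => eps n w i 0) 0 1)
    (hepsind : forall n,
      mutually_independent (P n) (fun i : 'I_n =>
        sigma_mx (fun w => row i (eps n w))))
    (hXeps : forall n,
      independent (P n) (sigma_mx (X n)) (sigma_mx (eps n)))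
    (hlambda : forall n, (0 < n)%N -> 0 < lambda n)
    (hbetahat_meas : forall n, random_mx (betahat n))
    (hbetahat : forall n w, (0 < n)%N ->
      lasso (X n w) (X n w *m beta0 n + eps n w) (lambda n) (betahat n w))
    (hS0 : forall n, (0 < n)%N -> active_set (beta0 n) != finset.set0)
    (hkappa : forall n, (0 < n)%N -> 0 < kappa2 (Sigma0 n) (active_set (beta0 n)))
    (hLmax : (fun n => max_eigenvalue (Sigma0 n) / `|Sigma0 n| : R^o) =o_\oo
             (fun n => ln (2 * (p n)%:R) : R^o))
    (hmax : max_compat_ratio n (Sigma0 n) (active_set (beta0 n))
              @[n --> \oo] --> 0%E)
    (ht : 0 < t)
    (hlambda_lb : forall n, (0 < n)%N ->
      3 * Num.sqrt `|Sigma0 n| *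
        (Num.sqrt (2 * n%:R * (ln (2 * (p n)%:R) + t)) +
         2 * (ln (2 * (p n)%:R) + t)) <= lambda n)
    (hlambda_ub : (lambda : nat -> R^o) =O_\oo
      (fun n => Num.sqrt (`|Sigma0 n| * n%:R * ln (2 * (p n)%:R)) : R^o))
    (hbstar : forall n, (0 < n)%N ->
      compat_argmin (Sigma0 n) (active_set (beta0 n)) (bstar n))
    (hbetamin : forall n (j : 'I_(p n)), (0 < n)%N ->
      j \in active_set (beta0 n) ->
      Num.sg (bstar n j 0) * bstar n j 0 /
          l2norm (sqrtmx (Sigma0 n) *m bstar n) ^+ 2 * (lambda n / n%:R)
        < Num.sg (bstar n j 0) * beta0 n j 0) :
  (exists (oP1 OP1 : forall n, {RV P n >-> R}),
    [/\ cvg0_in_prob P oP1, bounded_in_prob P OP1 &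
        forall n w, (0 < n)%N ->
          l2norm (X n w *m (betahat n w - beta0 n)) ^+ 2 =
          lambda n ^+ 2 / n%:R / l2norm (sqrtmx (Sigma0 n) *m bstar n) ^+ 2 *
            (1 + oP1 n w) + OP1 n w]) /\
  (forall n, (0 < n)%N ->
    #|active_set (beta0 n)|%:R * l2norm (sqrtmx (Sigma0 n) *m bstar n) ^+ 2 =
    kappa2 (Sigma0 n) (active_set (beta0 n))).
Proof.
have q0 n : (0 < n)%N -> 0 < l2norm (sqrtmx (Sigma0 n) *m bstar n) ^+ 2.
  by move=> n0; exact: argmin_norm_gt0 (hSigma n n0) (hS0 n n0) (hkappa n n0) (hbstar n n0).
split; last first.
  move=> n n0; rewrite -(kappa2_argmin (hSigma n n0) (hbstar n n0)) l2norm_sqrtmx//.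
  exact: hSigma.
pose M n := lambda n ^+ 2 / n%:R / l2norm (sqrtmx (Sigma0 n) *m bstar n) ^+ 2.
pose Z n w := l2norm (X n w *m (betahat n w - beta0 n)) ^+ 2 / M n - 1.
have mZ n : measurable_fun [set: Omega n] (Z n).
  apply: measurable_funB => //; apply: measurable_funM => //.
  exact: measurable_prediction_error (hXlaw n) (hbetahat_meas n).
have m0 n : measurable_fun [set: Omega n] (fun=> 0 : R) by [].
(* The whole error is shown to be relative: the first witness is the ratio to M minus 1, the second
   is 0. *)
exists (fun n => rv_of_measurable (P n) (mZ n)), (fun n => rv_of_measurable (P n) (m0 n)).
split; last first.
- move=> n w n0; rewrite -[RHS]/(M n * (1 + Z n w) + 0) addr0 [1 + _]addrC subrK.
  have M0 : 0 < M n by rewrite divr_gt0 ?q0// divr_gt0 ?exprn_gt0 ?hlambda// ltr0n.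
  by rewrite mulrC divfK// gt_eqF.
- move=> e e0; exists 0; near=> n; rewrite /= normr0.
  rewrite (_ : [set _ | _] = set0) ?measure0 ?lee_fin ?(ltW e0)//.
  by apply/seteqP; split => w //=; rewrite ltxx.
move=> e e0.
have mA n : measurable [set w | e < `|Z n w|].
  by apply: measurable_gt; apply: measurableT_comp => //; exact: mZ.
apply: cvge0_near => [n|n|c c0]; first exact: measure_ge0.
  exact: fin_num_measure (mA n).
(* With r = h s the failure bound is 10^6 s^2 <= 10^6 s <= c, as s <= 1; the cap 1/4000 on [s] gives
   50 * 80 * r <= h. *)
pose h := Num.min e 1; pose s := Num.min (1 / 50 / 80) (c / 10 ^+ 6); pose r := h * s.
have h01 : 0 < h <= 1 by rewrite /h lt_min e0 ltr01 ge_min lexx orbT.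
have /andP[h0 h1] := h01.
have s0 : 0 < s by rewrite /s lt_min !divr_gt0// exprn_gt0.
have s1 : s <= 1 / 50 / 80 by rewrite /s ge_min lexx.
have sc : 10 ^+ 6 * s <= c by rewrite mulrC -ler_pdivlMr ?exprn_gt0// /s ge_min lexx orbT.
have r0 : 0 < r by rewrite mulr_gt0.
have r20 : 0 < r ^+ 2 by rewrite exprn_gt0.
have hr : 50 * (80 * r) <= h by have := ler_wpM2l (ltW h0) s1; rewrite /r; lra.
have rh : 10 ^+ 6 * (r / h) ^+ 2 <= c.
  rewrite /r [h * s]mulrC mulfK ?gt_eqF//; apply: le_trans sc.
  have s11 : s <= 1 by lra.
  by rewrite ler_wpM2l ?exprn_ge0// expr2 ler_piMl// ltW.
have /eqoP/(_ _ r20) near_L := hLmax.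
have near_max : \forall n \near \oo,
    (max_compat_ratio n (Sigma0 n) (active_set (beta0 n)) < (r ^+ 2)%:E)%E.
  apply: (hmax (fun x => (x < (r ^+ 2)%:E)%E)); apply: open_nbhs_nbhs; split; last by rewrite /= lte_fin.
  exact: open_ereal_lt_ereal.
near=> n.
have n0 : (0 < n)%N by near: n; exact: nbhs_infty_gt.
apply: (@le_trans _ _ (P n [set w | h < `|Z n w|])).
  apply: le_measure; rewrite ?inE//.
    by apply: measurable_gt; apply: measurableT_comp => //; exact: mZ.
  by move=> w /=; apply: le_lt_trans; rewrite ge_min lexx.
apply: le_trans (_ : _ <= (10 ^+ 6 * (r / h) ^+ 2)%:E)%E _; last by rewrite lee_fin.
apply: (prob_relative_error (hXlaw n) (hXind n) (hepslaw n) (hepsind n) (hXeps n) (hSigma n n0) n0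
  (hlambda n n0) (hbetahat_meas n) (fun w => hbetahat n w n0) (hS0 n n0) (hkappa n n0) ht
  (hlambda_lb n n0) (hbstar n n0) (fun j => hbetamin n j n0) h01 r0 hr).
- have : `|max_eigenvalue (Sigma0 n) / `|Sigma0 n| : R^o| <= r ^+ 2 * `|ln (2 * (p n)%:R) : R^o|.
    by near: n; exact: near_L.
  have L0 : 0 <= ln (2 * (p n)%:R) :> R.
    by rewrite ltW// ln_gt0//; exact: dim_double_gt1 (hS0 n n0).
  by rewrite (ger0_norm L0); apply: le_trans; exact: ler_norm.
- by apply: ltW; near: n; exact: near_max.
Unshelve. all: by end_near. Qed.
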